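(* Let $\mathcal X=[0,2\pi]_{\mathrm{per}}^2$ be the two-dimensional torus with the standard normalized Lebesgue measure, let $\{\hat x_j\}_{j=1}^\infty$ be a dense subset of $\mathcal X$, and $\Lambda_{[0,2\pi]_{\mathrm{per}}^2}=\{F\mapsto F(\hat x_j):j\in\mathbb N\}$. Let $$\Omega_p=\{F:\mathcal X\to\mathcal X\ :\ F\text{ is smooth, measure-preserving, invertible},\ \mathrm{Lip}(F)\le2,\ \mathrm{Lip}(F^{-1})\le2\}.$$ Let $\Xi_p:\Omega_p\to\mathcal M_{\mathrm H}$, $\Xi_p(F)=\mathrm{Sp}_{\mathrm{pp}}(\mathcal K_F)=\mathrm{Cl}(\{\lambda\in\mathbb C:\lambda\text{ is an eigenvalue of }\mathcal K_F\})$, and let $\Xi_p^{\mathrm{dec}}:\Omega_p\to\mathcal M_{\mathrm{dec}}=\{0,1\}$ be given by $\Xi_p^{\mathrm{dec}}(F)=0$ if $\mathcal K_F$ has no eigenvalues except $1$ and $\Xi_p^{\mathrm{dec}}(F)=1$ otherwise. Then $$\Delta_2^{\mathbb P,1/2}\not\owns\{\Xi_p,\Omega_p,\mathcal M_{\mathrm H},\Lambda_{[0,2\pi]_{\mathrm{per}}^2}\}^{\Delta_1}\in\Sigma_2^G,\qquad \Delta_2^{\mathbb P,1/2}\not\owns\{\Xi_p^{\mathrm{dec}},\Omega_p,\mathcal M_{\mathrm{dec}},\Lambda_{[0,2\pi]_{\mathrm{per}}^2}\}^{\Delta_1}\in\Sigma_2^G.$$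
   Context: $\mathbb N=\{1,2,\dots\}$. $[0,2\pi]_{\mathrm{per}}$ is $[0,2\pi]$ with endpoints identified; the torus carries its standard flat metric, and $\mathrm{Lip}$ is the optimal Lipschitz constant. $\mathrm{Cl}$ denotes closure. $\mathcal K_Fg=g\circ F$ on $L^2(\mathcal X)$ (complex-valued functions). **Metric spaces.** $\mathcal M_{\mathrm H}$ is the set of non-empty compact subsets of $\mathbb C$ with the Hausdorff metric $d_{\mathrm H}$. $\mathcal M_{\mathrm{dec}}=\{0,1\}$ with the discrete topology and its usual order. **Computational problems.** A computational problem $\{\Xi,\Omega,\mathcal M,\Lambda\}$ consists of a set $\Omega$, a metric space $(\mathcal M,d)$, a function $\Xi:\Omega\to\mathcal M$, and a set $\Lambda$ of functions on $\Omega$ such that $\Xi(A)\ne\Xi(B)$ implies $f(A)\neq f(B)$ for some $f\in\Lambda$. **$\Delta_1$-information.** If $\Lambda=\{f_j\}_{j\in\mathcal I}$ takes values in a metric space $(\mathcal M_\Lambda,d_\Lambda)$, then $\{\Xi,\Omega,\mathcal M,\Lambda\}^{\Delta_1}=\{\tilde\Xi,\tilde\Omega,\mathcal M,\tilde\Lambda\}$, where $\tilde\Omega$ is the set of all tuples $\tilde A=\{f_{j,n}(A)\}_{j\in\mathcal I,n\in\mathbb N}\subset\mathcal M_\Lambda$ with $A\in\Omega$ and $d_\Lambda(f_{j,n}(A),f_j(A))\le2^{-n}$ for all $j,n$ (all such choices of approximations are admitted); $\tilde\Xi(\tilde A)=\Xi(A)$; and $\tilde\Lambda=\{\tilde f_{j,n}\}$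 with $\tilde f_{j,n}(\tilde A)=f_{j,n}(A)$. **General algorithms and towers.** A general algorithm for $\{\Xi,\Omega,\mathcal M,\Lambda\}$ is a map $\Gamma:\Omega\to\mathcal M$ such that for every $A\in\Omega$ there is a non-empty finite $\Lambda_\Gamma(A)\subset\Lambda$ such that if $B\in\Omega$ and $f(A)=f(B)$ for all $f\in\Lambda_\Gamma(A)$, then $\Lambda_\Gamma(B)=\Lambda_\Gamma(A)$ and $\Gamma(B)=\Gamma(A)$. A (general) tower of algorithms of height $2$ is a family $\Gamma_{n_2},\Gamma_{n_2,n_1}:\Omega\to\mathcal M$ ($n_1,n_2\in\mathbb N$), where the $\Gamma_{n_2,n_1}$ are general algorithms and, for every $A\in\Omega$, $\Xi(A)=\lim_{n_2\to\infty}\Gamma_{n_2}(A)$ and $\Gamma_{n_2}(A)=\lim_{n_1\to\infty}\Gamma_{n_2,n_1}(A)$. **Class $\Sigma_2^G$.** For $\mathcal M=\mathcal M_{\mathrm H}$: there are a general tower $\{\Gamma_{n_2,n_1}\}$ of height $2$ and sets $X_{n_2}(A)\in\mathcal M_{\mathrm H}$ such that for all $A\in\Omega$: $\Gamma_{n_2}(A)\subset X_{n_2}(A)$, $\lim_{n_2\to\infty}\Gamma_{n_2}(A)=\Xi(A)$, and $d_{\mathrm H}(X_{n_2}(A),\Xi(A))\le2^{-n_2}$. For $\mathcal M=\mathcal M_{\mathrm{dec}}$: there is a general tower of height $2$ such that $\Gamma_{n_2}(A)\uparrow\Xi(A)$ (convergence from below as $n_2\to\infty$) for all $A\in\Omega$.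 **Probabilistic algorithms.** Let $\mathcal C=\{0,1\}^{\mathbb N}$ with the fair-coin product probability measure $\mathbb P$, and $p_j(a)=a_j$. Given $\{\Xi,\Omega,\mathcal M,\Lambda\}$, let $\Lambda^{\mathbb P}$ be the set of functions on $\Omega\times\mathcal C$ consisting of $(A,a)\mapsto f(A)$, $f\in\Lambda$, and $(A,a)\mapsto p_j(a)$, $j\in\mathbb N$. A probabilistic general algorithm is a map $\Gamma:\Omega\times\mathcal C\to\mathcal M\cup\{\mathrm{NH}\}$ ($\mathrm{NH}$, ''non-halting'', is added to $\mathcal M$ as an isolated point) such that for every $(A,a)$ there is a non-empty $\Lambda_\Gamma(A,a)\subset\Lambda^{\mathbb P}$ with: (i) if $f(A,a)=f(B,b)$ for all $f\in\Lambda_\Gamma(A,a)$, then $\Lambda_\Gamma(B,b)=\Lambda_\Gamma(A,a)$ and $\Gamma(B,b)=\Gamma(A,a)$; (ii) if $\Gamma(A,a)\ne\mathrm{NH}$ then $\Lambda_\Gamma(A,a)$ is finite. An SPGA is a sequence $\{\Gamma_n\}_{n\in\mathbb N}$ of probabilistic general algorithms. The problem is not in $\Delta_2^{\mathbb P,1/2}$ if for every SPGA $\{\Gamma_n\}$, $\inf_{A\in\Omega}\mathbb P(\lim_{n\to\infty}\Gamma_n(A)=\Xi(A))\le1/2$. For a problem with $\Delta_1$-information this is applied to $\{\tilde\Xi,\tilde\Omega,\mathcal M,\tilde\Lambda\}$. *)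

(* Defs.v *)
From HB Require Import structures.
From mathcomp Require Import all_boot all_order all_algebra.
From mathcomp Require Import all_classical all_reals all_analysis.
From mathcomp Require Import measurable_realfun.
From mathcomp Require Import complex ring lra.

Set Implicit Arguments.
Unset Strict Implicit.
Unset Printing Implicit Defensive.

Import Order.TTheory GRing.Theory Num.Theory.
Import numFieldNormedType.Exports.

Local Open Scope classical_set_scope.
Local Open Scope ring_scope.

Section circle.
Variable R : realType.

Lemma twopi_gt0 : 0 < 2 * pi :> R.
Proof. by rewrite mulr_gt0 ?pi_gt0. Qed.

(* [0, 2 pi] with its endpoints identified: each class is represented by its
   unique element of [0, 2 pi[. *)
Definition circle := {x : R | 0 <= x < 2 * pi}.

HB.instance Definition _ := Choice.on circle.

Definition wrap (x : R) : R := x - 2 * pi * (Num.floor (x / (2 * pi)))%:~R.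

Lemma wrap_itv x : 0 <= wrap x < 2 * pi.
Proof.
have p0 := twopi_gt0; have pn0 : 2 * pi != 0 :> R by rewrite gt_eqF.
rewrite /wrap -[X in X - _](divfK pn0) [X in X - _]mulrC -mulrBr.
rewrite mulr_ge0 ?(ltW p0) ?subr_ge0 ?floor_le//=.
by rewrite -[ltRHS]mulr1 ltr_pM2l// ltrBlDr addrC -[X in _ + X]/(1%:~R) -intrD floorD1_gt.
Qed.

Definition circle_of (x : R) : circle := exist _ (wrap x) (wrap_itv x).

HB.instance Definition _ := isPointed.Build circle (circle_of 0).

Definition circle_display :=
  preimage_display (val : circle -> measurableTypeR R).

(* The Borel sets of [0, 2 pi[ are also those of the circle: the two topologies
   differ only at the point 0. *)
HB.instance Definition _ := Measurable.copy circle
  (g_sigma_algebra_preimageType (val : circle -> measurableTypeR R)).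

Lemma measurable_floor_set (P : set int) :
  measurable ([set x : R | P (Num.floor x)] : set (measurableTypeR R)).
Proof.
rewrite [X in measurable X](_ : _ =
  \bigcup_(k in P) [set` `[k%:~R : R, (k + 1)%:~R[]).
  rewrite bigcup_mkcond; apply: countable_bigcupT_measurable => // k.
  by case: ifP => _; [exact: measurable_itv|exact: measurable0].
apply/seteqP; split=> [x Px|x [k Pk]] /=.
  by exists (Num.floor x) => //=; rewrite in_itv/= floor_itv.
by rewrite in_itv/= -floor_eq => /eqP ->.
Qed.

Lemma measurable_wrap :
  measurable_fun setT (wrap : measurableTypeR R -> measurableTypeR R).
Proof.
rewrite /wrap; apply: measurable_funB => //.
apply: measurable_funM => //.
apply: (@measurableT_comp _ _ _ _ _ _ (fun y : R => (Num.floor y)%:~R : R)); last first.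
  exact: measurable_funM.
move=> _ Y mY; rewrite setTI.
exact: (measurable_floor_set [set k | Y k%:~R]).
Qed.

Lemma measurable_circle_of :
  @measurable_fun _ _ (measurableTypeR R) circle setT circle_of.
Proof.
move=> _ _ [Y mY <-]; rewrite setTI setTI.
by rewrite -[X in measurable X]setTI; exact: measurable_wrap.
Qed.

Definition circle_dist (x y : circle) : R :=
  Num.min `|val x - val y| (2 * pi - `|val x - val y|).

Lemma circle_dist_ge0 x y : 0 <= circle_dist x y.
Proof.
case: x y => [x /= hx] [y /= hy]; rewrite /circle_dist /= le_min normr_ge0/=.
by move: hx hy; case: (ger0P (x - y)); lra.
Qed.

Lemma circle_distxx x : circle_dist x x = 0.
Proof.
by rewrite /circle_dist subrr normr0 subr0 min_l// ltW// twopi_gt0.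
Qed.

Lemma circle_dist_eq0 x y : circle_dist x y = 0 -> x = y.
Proof.
case: x y => [x /= hx] [y /= hy]; rewrite /circle_dist /= => h.
apply/val_inj => /=; move: hx hy h.
by rewrite /Num.min; case: ifP; case: (ger0P (x - y)); lra.
Qed.

Lemma circle_distC x y : circle_dist x y = circle_dist y x.
Proof. by rewrite /circle_dist distrC. Qed.

Lemma circle_dist_triangle y x z :
  circle_dist x z <= circle_dist x y + circle_dist y z.
Proof.
case: x y z => [x /= hx] [y /= hy] [z /= hz]; rewrite /circle_dist /=.
move: hx hy hz; move: (pi : R) => p.
rewrite !minEle.
by case: (ger0P (x - y)); case: (ger0P (x - z)); case: (ger0P (y - z));
  repeat case: ifP; lra.
Qed.

End circle.

Section torus.
Variable R : realType.
Import Normc.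

Definition torus := (circle R * circle R)%type.

HB.instance Definition _ := Choice.on torus.
HB.instance Definition _ := Pointed.on torus.
HB.instance Definition _ := Measurable.on torus.

Definition torus_dist (x y : torus) : R :=
  Num.sqrt (circle_dist x.1 y.1 ^+ 2 + circle_dist x.2 y.2 ^+ 2).

Let torus_distxx x : torus_dist x x = 0.
Proof. by rewrite /torus_dist !circle_distxx expr0n/= addr0 sqrtr0. Qed.

Let torus_dist_eq0 x y : torus_dist x y = 0 -> x = y.
Proof.
case: x y => [x1 x2] [y1 y2] /eqP; rewrite /torus_dist/= sqrtr_eq0 => h.
have /eqP : circle_dist x1 y1 ^+ 2 + circle_dist x2 y2 ^+ 2 == 0.
  by rewrite eq_le h/= addr_ge0// sqr_ge0.
move/eqP; rewrite paddr_eq0 ?sqr_ge0// !sqrf_eq0 => /andP[/eqP h1 /eqP h2].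
by rewrite (circle_dist_eq0 h1) (circle_dist_eq0 h2).
Qed.

Let torus_distC x y : torus_dist x y = torus_dist y x.
Proof. by rewrite /torus_dist circle_distC (circle_distC x.2). Qed.

Let torus_dist_triangle y x z :
  torus_dist x z <= torus_dist x y + torus_dist y z.
Proof.
pose c u v : R[i] := Complex (circle_dist u.1 v.1) (circle_dist u.2 v.2).
have := le_normcD (c x y) (c y z); apply: le_trans.
rewrite /= ler_sqrt ?addr_ge0 ?sqr_ge0// lerD// ler_pXn2r// ?nnegrE;
  by rewrite ?addr_ge0 ?circle_dist_ge0 ?circle_dist_triangle.
Qed.

HB.instance Definition _ := isMetric.Build R torus
  torus_distxx torus_dist_eq0 torus_distC torus_dist_triangle.

(* The covering map of the torus by the plane; its local inverses are the
   charts of the torus. *)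
Definition torus_of (z : R * R) : torus := (circle_of z.1, circle_of z.2).

Lemma measurable_torus_of : @measurable_fun _ _
  (measurableTypeR R * measurableTypeR R)%type torus setT torus_of.
Proof.
apply/measurable_fun_pair; apply: measurableT_comp => //;
  exact: measurable_circle_of.
Qed.

Definition torus_measure : set torus -> \bar R :=
  distribution (uniform_prob (twopi_gt0 R) \x uniform_prob (twopi_gt0 R))%E
    (@mfun_Sub _ _ (measurableTypeR R * measurableTypeR R)%type torus torus_of
      (mem_set measurable_torus_of)).

HB.instance Definition _ := Probability.on torus_measure.
Lemma torus_measureE A :
  torus_measure A =
  (uniform_prob (twopi_gt0 R) \x uniform_prob (twopi_gt0 R))%E
    (torus_of @^-1` A).
Proof. by []. Qed.

End torus.
Arguments torus_measure R : clear implicits.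

Section coins.
Variable R : realType.

Definition coordinate_sets : set (set (nat -> bool)) :=
  [set [set a : nat -> bool | a j = true] | j in setT].

Definition coins := g_sigma_algebraType coordinate_sets.
HB.instance Definition _ := Measurable.on coins.

(* The binary digits of a uniform random point of [0, 1] are independent fair
   coins; coin_measure_cylinder states the resulting product formula, which
   characterizes coin_measure. *)
Definition digits (x : R) : coins :=
  fun j => odd `|Num.floor (2 ^+ j.+1 * x)|%N.

Lemma measurable_digits :
  @measurable_fun _ _ (measurableTypeR R) coins setT digits.
Proof.
apply: (@measurability _ _ (measurableTypeR R) coins setT digits coordinate_sets) => // _ [_ [j _ <-]] <-.
rewrite setTI.
pose f (x : measurableTypeR R) : measurableTypeR R := 2 ^+ j.+1 * x.
have mf : measurable_fun setT f by exact: measurable_funM.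
have := mf measurableT _ (measurable_floor_set [set k | odd `|k|%N]).
by rewrite setTI.
Qed.

Definition coin_measure : set coins -> \bar R :=
  distribution (uniform_prob (@ltr01 R))
    (@mfun_Sub _ _ (measurableTypeR R) coins digits
      (mem_set measurable_digits)).

HB.instance Definition _ := Probability.on coin_measure.

Let code (b : nat -> bool) := fix code n : nat :=
  if n is m.+1 then ((code m).*2 + b m)%N else 0%N.

Let code_lt b n : (code b n < 2 ^ n)%N.
Proof.
elim: n => //= n IH; rewrite expnS mul2n.
case: (b n); rewrite ?addn0 ?ltn_double// addn1.
by rewrite -doubleS leq_double in IH *.
Qed.

Let floor_natP (x : R) (m : nat) :
  (Num.floor x = m%:Z) <-> (m%:R <= x < m%:R + 1).
Proof.
split=> [fx|h].
  by have := floor_itv x; rewrite fx intrD -!pmulrn.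
by apply: floor_def; rewrite intrD -!pmulrn.
Qed.

Let natr_double (k : nat) : k.*2%:R = 2 * k%:R :> R.
Proof. by rewrite -mul2n natrM. Qed.

Let floor_double (y : R) k : Num.floor y = k%:Z ->
  forall c : bool, (odd `|Num.floor (2 * y)|%N = c) <->
     Num.floor (2 * y) = (k.*2 + c)%N%:Z.
Proof.
move=> /floor_natP/andP[ky yk] c.
have h : exists d : bool, Num.floor (2 * y) = (k.*2 + d)%N%:Z.
  have [y1|y1] := ltP (2 * y) (k.*2.+1)%:R; rewrite -(natr1 k.*2) natr_double in y1.
    by exists false; apply/floor_natP; rewrite addn0 natr_double; lra.
  by exists true; apply/floor_natP; rewrite addn1 -(natr1 k.*2) natr_double; lra.
case: h => d ->; rewrite absz_nat oddD odd_double /= oddb.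
split=> [->//|[/eqP]]; rewrite eqn_add2l => /eqP.
by case: c; case: d.
Qed.

Let digits_floor (b : nat -> bool) n (x : R) : Num.floor x = 0 ->
  (forall j, (j < n)%N -> digits x j = b j) <->
  Num.floor (2 ^+ n * x) = (code b n)%:Z.
Proof.
move=> x0; elim: n => [|n IH]; first by rewrite expr0 mul1r.
split=> [h|h].
  have /IH/floor_double fd : forall j, (j < n)%N -> digits x j = b j.
    by move=> j jn; apply: h; rewrite ltnS ltnW.
  by rewrite exprS -mulrA; apply/fd; rewrite mulrA -exprS; exact: h.
have fn : Num.floor (2 ^+ n * x) = (code b n)%:Z.
  move/floor_natP : h; rewrite exprS -mulrA /= natrD natr_double => h.
  apply/floor_natP; move: h.
  by case: (b n) => /=; rewrite ?mulr0n ?mulr1n; lra.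
move=> j; rewrite ltnS leq_eqVlt => /orP[/eqP->|]; last by move: j; apply/IH.
have /floor_double/(_ (b n))[_] := fn.
by rewrite mulrA -exprS => /(_ h).
Qed.

Lemma coin_measure_cylinder (b : nat -> bool) n :
  coin_measure [set a | forall j, (j < n)%N -> a j = b j] = (2 ^- n)%:E.
Proof.
pose A : set coins := [set a | forall j, (j < n)%N -> a j = b j].
pose I : set (measurableTypeR R) :=
  `[(code b n)%:R / 2 ^+ n, (code b n).+1%:R / 2 ^+ n[%classic.
have p2 : 0 < 2 ^+ n :> R by rewrite exprn_gt0.
have mI : measurable I by exact: measurable_itv.
have mA : measurable A.
  rewrite [A](_ : _ = \big[setI/setT]_(j < n)
      (if b j then [set a : coins | a j = true]
              else ~` [set a : coins | a j = true])).
    apply: bigsetI_measurable => j _ /=.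
    have mj : measurable ([set a : coins | a j = true] : set coins).
      by apply: sub_sigma_algebra; exists (nat_of_ord j).
    by case: (b j) => //; exact: measurableC.
  apply/seteqP; split=> a.
    move=> Aa; apply: (big_ind (fun S : set coins => S a)) => // j _.
    by have := Aa j (ltn_ord j); case: (b j) => /= ->.
  move=> + j jn; rewrite (bigD1 (Ordinal jn))//= => -[+ _].
  by case: (b j) => //=; case: (a j).
have I01 : I `<=` `[0, 1[%classic.
  move=> x; rewrite /I/= !in_itv/= => /andP[cx xc]; apply/andP; split.
    by rewrite (le_trans _ cx)// divr_ge0// ltW.
  rewrite (lt_le_trans xc)// ler_pdivrMr// mul1r -natrX ler_nat.
  exact: code_lt.
have IE x : 0 <= x < 1 -> A (digits x) <-> I x.
  move=> x01; have f0 : Num.floor x = 0.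
    by apply/(floor_natP x 0); rewrite add0r.
  rewrite /A /=; split.
    move/(digits_floor b n f0)/floor_natP.
    by rewrite /I/= in_itv/= ler_pdivrMr// ltr_pdivlMr// mulrC natr1.
  rewrite /I/= in_itv/= ler_pdivrMr// ltr_pdivlMr// mulrC => h j.
  by apply: (digits_floor b n f0).2; apply/floor_natP; rewrite natr1.
change (uniform_prob (@ltr01 R) (digits @^-1` A) = (2 ^- n)%:E).
have mdA : measurable (digits @^-1` A : set (measurableTypeR R)).
  by rewrite -[X in measurable X]setTI; exact: measurable_digits.
have mJ : measurable (digits @^-1` A `&` `[0, 1] : set (measurableTypeR R)).
  by apply: measurableI => //; exact: measurable_itv.
have -> : uniform_prob (@ltr01 R) (digits @^-1` A) =
          lebesgue_measure (digits @^-1` A `&` `[0, 1] : set (measurableTypeR R)).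
  rewrite /uniform_prob integral_uniform_pdf.
  rewrite (eq_integral (fun=> 1%:E)); last first.
    move=> x; rewrite inE => -[_]; rewrite /= in_itv/= => x01.
    by rewrite /uniform_pdf x01 subr0 invr1.
  by rewrite integral_cst// mul1e.
have lI : lebesgue_measure I = (2 ^- n)%:E.
  rewrite /I lebesgue_measure_itv/= lte_fin ltr_pM2r ?invr_gt0// ltr_nat ltnSn.
  by rewrite -EFinD -mulrBl -natrB// subSnn mul1r.
apply/eqP; rewrite eq_le -lI; apply/andP; split.
  apply: (@le_trans _ _ (lebesgue_measure (I `|` [set 1]))).
    apply: le_measure; rewrite ?inE//; first exact: measurableU.
    move=> x [Ax]; rewrite /= in_itv/= => /andP[x0].
    rewrite le_eqVlt => /orP[/eqP ->|x1]; [by right|left].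
    by apply/IE => //; rewrite x0.
  by rewrite -[leRHS]adde0 -(lebesgue_measure_set1 (1 : R)); exact: measureU2.
apply: le_measure; rewrite ?inE// => x Ix; split.
  apply/IE => //; have := I01 x Ix; by rewrite /= in_itv/=.
by have := I01 x Ix; rewrite /= !in_itv/= => /andP[-> /ltW].
Qed.
End coins.
Arguments coin_measure R : clear implicits.

Section hausdorff_metric.
Variable R : realType.
Import Normc.
Local Notation C := (R[i])^o.

Lemma normc_continuous : continuous (@normc R : C -> R).
Proof.
move=> x A /nbhs_ballP[e/= e0 eA].
apply/nbhs_ballP; exists e%:C%C => /=; first by rewrite ltcR.
move=> y /=; rewrite -ball_normE/= => xy; apply: eA.
rewrite -ball_normE /=.
have {}xy : normc (x - y) < e by rewrite -ltcR.
rewrite (le_lt_trans _ xy)// ler_norml; apply/andP; split.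
  have := le_normcD x (y - x); rewrite subrKC -(normcN (y - x)) opprB.
  by rewrite lerNl opprB lerBlDl.
by have := le_normcD (x - y) y; rewrite subrK lerBlDr.
Qed.

Lemma complex_continuous :
  continuous (fun z : R * R => Complex z.1 z.2 : C).
Proof.
move=> -[a b] A /nbhs_ballP[[e1 e2]] /=.
rewrite ltcE /= => /andP[/eqP -> {e2} e0] eA.
have e20 : 0 < e1 / 2 by rewrite divr_gt0.
apply/nbhs_ballP; exists (e1 / 2) => //= -[c d] [/=].
rewrite -!ball_normE/= => ac bd; apply: eA; rewrite -ball_normE/= ltcR.
rewrite -(ltr_pXn2r (_ : 0 < 2)%N)// ?nnegrE ?sqrtr_ge0 ?(ltW e0)//.
rewrite sqr_sqrtr ?addr_ge0 ?sqr_ge0//.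
have {}ac : (a - c) ^+ 2 < (e1 / 2) ^+ 2 by rewrite -[(a - c) ^+ 2]real_normK ?num_real// ltr_pXn2r// nnegrE// ltW.
have {}bd : (b - d) ^+ 2 < (e1 / 2) ^+ 2 by rewrite -[(b - d) ^+ 2]real_normK ?num_real// ltr_pXn2r// nnegrE// ltW.
nra.
Qed.

Lemma bounded_closed_compactC (A : set C) (M : R) :
  closed A -> A `<=` [set z | normc z <= M] -> compact A.
Proof.
move=> cA AM.
have cI : compact (`[- M, M]%classic `*` `[- M, M]%classic : set (R * R)).
  by apply: compact_setX; exact: segment_compact.
have := @continuous_compact _ _ (fun z : R * R => Complex z.1 z.2 : C) _
  (continuous_subspaceT complex_continuous) cI.
move/(subclosed_compact cA); apply => -[a b] /AM /= abM.
exists (a, b) => //=.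
have M0 : 0 <= M by rewrite (le_trans _ abM)// sqrtr_ge0.
have : a ^+ 2 + b ^+ 2 <= M ^+ 2.
  rewrite -(@sqr_sqrtr _ (a ^+ 2 + b ^+ 2)) ?addr_ge0 ?sqr_ge0//.
  by rewrite ler_pXn2r// nnegrE ?sqrtr_ge0.
move=> h; split; rewrite /= in_itv/= -ler_norml -(ler_pXn2r (_ : 0 < 2)%N)//;
  rewrite ?nnegrE// real_normK ?num_real//; rewrite (le_trans _ h)//.
- by rewrite lerDl sqr_ge0.
- by rewrite lerDr sqr_ge0.
Qed.

Lemma compact_normc_bounded (A : set C) :
  compact A -> exists M, forall z, A z -> normc z <= M.
Proof.
move=> cA.
have cI := continuous_compact (continuous_subspaceT normc_continuous) cA.
have [M [Mr MA]] := compact_bounded cI.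
exists (M + 1) => z Az.
rewrite (le_trans (ler_norm _))//; apply: MA; first by rewrite ltrDl.
by exists z.
Qed.

Definition point_dist (z : C) (K : set C) : R :=
  inf [set normc (z - w) | w in K].

Definition hausdorff_dist (K L : set C) : R :=
  Num.max (sup [set point_dist z L | z in K])
          (sup [set point_dist w K | w in L]).

Definition compacts := {K : set C | compact K /\ K !=set0}.

HB.instance Definition _ := gen_eqMixin compacts.
HB.instance Definition _ := gen_choiceMixin compacts.

Section facts.
Implicit Types K L M : compacts.

Let has_inf_dist z K : has_inf [set normc (z - w) | w in sval K].
Proof.
case: K => K [cK [k Kk]] /=; split; first by exists (normc (z - k)), k.
by exists 0 => _ [w _ <-]; case: (z - w) => a b; rewrite /= sqrtr_ge0.
Qed.

Let normc_ge0 (z : C) : 0 <= normc z.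
Proof. by case: z => a b; rewrite /= sqrtr_ge0. Qed.

Let point_dist_ge0 z K : 0 <= point_dist z (sval K).
Proof.
apply: lb_le_inf; first by case: (has_inf_dist z K).
by move=> _ [w _ <-].
Qed.

Let point_dist_le z K w : sval K w -> point_dist z (sval K) <= normc (z - w).
Proof.
by move=> Kw; apply: ge_inf; [case: (has_inf_dist z K)|exists w].
Qed.

Let has_sup_dist K L : has_sup [set point_dist z (sval L) | z in sval K].
Proof.
case: K => K [cK [k Kk]] /=; split; first by exists (point_dist k (sval L)), k.
have [M KM] := compact_normc_bounded cK.
have [l Ll] := (svalP L).2.
exists (M + normc l) => _ [z Kz <-].
apply: le_trans (point_dist_le z Ll) _.
rewrite (le_trans (le_normcD _ _))// normcN lerD2r.
exact: KM.
Qed.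

Let point_dist_le_hausdorff K L z :
  sval K z -> point_dist z (sval L) <= hausdorff_dist (sval K) (sval L).
Proof.
move=> Kz; rewrite /hausdorff_dist le_max; apply/orP; left.
by apply: ub_le_sup; [case: (has_sup_dist K L)|exists z].
Qed.

Let hausdorff_distC K L :
  hausdorff_dist (sval K) (sval L) = hausdorff_dist (sval L) (sval K).
Proof. by rewrite /hausdorff_dist maxC. Qed.

Let hausdorff_distxx K : hausdorff_dist (sval K) (sval K) = 0.
Proof.
rewrite /hausdorff_dist maxxx.
rewrite [X in sup X](_ : _ = [set 0]) ?sup1//; apply/seteqP; split.
  move=> _ [z Kz <-]; apply/eqP; rewrite eq_le point_dist_ge0 andbT.
  by rewrite (le_trans (point_dist_le z Kz))// subrr normc0.
move=> _ ->; have [k Kk] := (svalP K).2; exists k => //.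
apply/eqP; rewrite eq_le point_dist_ge0 andbT.
by rewrite (le_trans (point_dist_le k Kk))// subrr normc0.
Qed.

Let compact_closedC K : closed (sval K).
Proof. by apply: compact_closed; [exact: norm_hausdorff|exact: (svalP K).1]. Qed.

Let hausdorff_dist0_sub K L :
  hausdorff_dist (sval K) (sval L) = 0 -> sval K `<=` sval L.
Proof.
move=> h z Kz; have := point_dist_le_hausdorff L Kz; rewrite h => d0.
apply: compact_closedC => B /nbhs_ballP[[e1 e2]] /=.
rewrite ltcE /= => /andP[/eqP -> {e2} e0] eB.
have [_ [w Lw <-] wd] := inf_adherent e0 (has_inf_dist z L).
exists w; split => //; apply: eB; rewrite -ball_normE /=.
have : normc (z - w) < e1.
  by rewrite (lt_le_trans wd)// gerDr.
by rewrite -ltcR.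
Qed.

Let hausdorff_dist_eq0 K L :
  hausdorff_dist (sval K) (sval L) = 0 -> K = L.
Proof.
move=> h; have KL : sval K = sval L.
  apply/seteqP; split; apply: hausdorff_dist0_sub => //.
  by rewrite hausdorff_distC.
case: K L KL {h} => [K pK] [L pL] /= KL; move: pK pL; rewrite KL => pK pL.
by congr exist; exact: Prop_irrelevance.
Qed.

Let half_triangle L K M z : sval K z ->
  point_dist z (sval M) <= hausdorff_dist (sval K) (sval L)
                           + hausdorff_dist (sval L) (sval M).
Proof.
move=> Kz; rewrite -lerBlDr (le_trans _ (point_dist_le_hausdorff L Kz))//.
apply: lb_le_inf; first by case: (has_inf_dist z L).
move=> _ [w Lw <-]; rewrite lerBlDr.
rewrite -lerBlDl (le_trans _ (point_dist_le_hausdorff M Lw))//.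
apply: lb_le_inf; first by case: (has_inf_dist w M).
move=> _ [v Mv <-]; rewrite lerBlDl (le_trans (point_dist_le z Mv))//.
by rewrite (le_trans _ (le_normcD _ _))// addrA subrK.
Qed.

Let hausdorff_triangle L K M :
  hausdorff_dist (sval K) (sval M) <=
  hausdorff_dist (sval K) (sval L) + hausdorff_dist (sval L) (sval M).
Proof.
rewrite {1}/hausdorff_dist ge_max; apply/andP; split.
  apply: ge_sup; first by case: (has_sup_dist K M).
  by move=> _ [z Kz <-]; exact: half_triangle.
apply: ge_sup; first by case: (has_sup_dist M K).
move=> _ [z Mz <-]; rewrite addrC hausdorff_distC.
by rewrite (hausdorff_distC K); exact: half_triangle.
Qed.

HB.instance Definition _ := isMetric.Build R compacts
  hausdorff_distxx hausdorff_dist_eq0 hausdorff_distC hausdorff_triangle.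

End facts.

Lemma mdist_compacts (K L : compacts) :
  mdist K L = hausdorff_dist (sval K) (sval L).
Proof. by []. Qed.

End hausdorff_metric.

Section decision.
Variable R : realType.
(* The parameter fixes the field in which the discrete metric takes values. *)
Definition decision (_ : realType) : Type := bool.

HB.instance Definition _ := Choice.on (decision R).

Let discrete_dist (x y : decision R) : R := (x != y)%:R.

Let discrete_distxx x : discrete_dist x x = 0.
Proof. by rewrite /discrete_dist eqxx. Qed.

Let discrete_dist_eq0 x y : discrete_dist x y = 0 -> x = y.
Proof.
by move/eqP; rewrite /discrete_dist pnatr_eq0 eqb0 negbK => /eqP.
Qed.

Let discrete_distC x y : discrete_dist x y = discrete_dist y x.
Proof. by rewrite /discrete_dist eq_sym. Qed.

Let discrete_triangle y x z :
  discrete_dist x z <= discrete_dist x y + discrete_dist y z.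
Proof. by rewrite -natrD ler_nat; case: x y z => [] [] []. Qed.

HB.instance Definition _ := isMetric.Build R (decision R)
  discrete_distxx discrete_dist_eq0 discrete_distC discrete_triangle.
End decision.

Section problems.
Variable R : realType.

Record comp_problem (M V : metricType R) := CompProblem {
  problem_dom : Type;
  info_index : Type;
  info : info_index -> problem_dom -> V;
  target : problem_dom -> M;
  info_determines : forall A B : problem_dom,
    target A <> target B -> exists j, info j A <> info j B }.

Definition evaluations M V (P : comp_problem M V) : set (problem_dom P -> V) :=
  range (@info M V P).
Arguments evaluations {M V} P.

Section delta1.
Variables (M V : metricType R) (P : comp_problem M V).

(* The positive integers are encoded by nat, n : nat standing for n.+1; hence
   the bound 2 ^- n.+1 here and in Sigma2G_compacts. *)
Definition approximates (t : info_index P -> nat -> V) (A : problem_dom P) :=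
  forall j n, mdist (t j n) (info j A) <= 2 ^- n.+1.

Definition delta1_dom :=
  {t : info_index P -> nat -> V | exists A, approximates t A}.

Definition delta1_info (jn : info_index P * nat) (t : delta1_dom) : V :=
  sval t jn.1 jn.2.

(* Well defined, whatever the choice of the approximated element: see
   delta1_targetE. *)
Definition delta1_target (t : delta1_dom) : M :=
  target (sval (cid (svalP t))).

Lemma approximates_target t (A B : problem_dom P) :
  approximates t A -> approximates t B -> target A = target B.
Proof.
move=> tA tB; apply: contrapT => /info_determines[j]; apply.
apply: mdist_positivity; apply/eqP; rewrite eq_le mdist_ge0 andbT.
apply/ler_addgt0Pl => e e0; rewrite addr0.
have [n ne] : exists n, 2 ^- n <= e :> R.
  have [n] := @ltr_add_invr R 0 e e0; rewrite add0r => ne.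
  exists n; apply: ltW; apply: le_lt_trans ne.
  rewrite lef_pV2 ?posrE ?exprn_gt0 ?ltr0n//.
  by rewrite -natrX ler_nat; exact: ltn_expl.
rewrite (le_trans (metric_triangle _ (t j n) _))// metric_sym.
rewrite (le_trans (lerD (tA j n) (tB j n)))//.
rewrite (le_trans _ ne)// -mulr2n exprS invfM -mulrnAl -[_ *+ 2]mulr_natr.
by rewrite mulVf// mul1r.
Qed.

Lemma delta1_targetE (t : delta1_dom) (A : problem_dom P) :
  approximates (sval t) A -> delta1_target t = target A.
Proof.
by move=> tA; rewrite /delta1_target; case: cid => B /= tB;
  exact: approximates_target tB tA.
Qed.

Lemma delta1_determines (s t : delta1_dom) :
  delta1_target s <> delta1_target t ->
  exists jn, delta1_info jn s <> delta1_info jn t.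
Proof.
apply: contra_notP => /forallNP h.
have [A tA] := svalP t; rewrite (delta1_targetE tA); apply: delta1_targetE.
move=> j n; have /contrapT := h (j, n); rewrite /delta1_info /= => ->.
exact: tA.
Qed.

Definition delta1 : comp_problem M V := CompProblem delta1_determines.

End delta1.

Definition general_algorithm (Omega T M : Type) (L : set (Omega -> T))
    (Gamma : Omega -> M) :=
  exists LG : Omega -> set (Omega -> T), forall A,
    [/\ LG A `<=` L, LG A !=set0, finite_set (LG A) &
        forall B, (forall f, LG A f -> f A = f B) ->
          LG B = LG A /\ Gamma B = Gamma A].

Definition tower2 (M V : metricType R) (P : comp_problem M V)
    (Gamma2 : nat -> problem_dom P -> M)
    (Gamma21 : nat -> nat -> problem_dom P -> M) :=
  [/\ forall n2 n1, general_algorithm (evaluations P) (Gamma21 n2 n1),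
      forall A, Gamma2 n2 A @[n2 --> \oo] --> target A &
      forall n2 A, Gamma21 n2 n1 A @[n1 --> \oo] --> Gamma2 n2 A].
Arguments tower2 {M V} P.

Definition Sigma2G_compacts (V : metricType R)
    (P : comp_problem (compacts R) V) :=
  exists Gamma2 Gamma21 (X : nat -> problem_dom P -> compacts R),
    tower2 P Gamma2 Gamma21 /\
    forall n2 A, sval (Gamma2 n2 A) `<=` sval (X n2 A) /\
                 mdist (X n2 A) (target A) <= 2 ^- n2.+1.

(* The convergence from below is stated as monotonicity in n2. Since the tower
   converges, this gives Gamma2 n2 A <= target A; conversely, a tower with
   Gamma2 n2 A <= target A for all n2 becomes monotone by replacing
   Gamma2 n2 and Gamma21 n2 n1 by their maxima over the indices up to n2. *)
Definition Sigma2G_decision (V : metricType R)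
    (P : comp_problem (decision R) V) :=
  exists Gamma2 Gamma21, tower2 P Gamma2 Gamma21 /\
    forall A, {homo (fun n2 => Gamma2 n2 A : bool) :
                 m n / (m <= n)%N >-> (m <= n)%O}.

Definition coin_evaluations (Omega V : Type) (L : set (Omega -> V)) :
    set (Omega * coins -> V + bool) :=
  [set (fun Aa => inl (f Aa.1)) | f in L] `|`
  [set (fun Aa => inr (Aa.2 j)) | j in [set: nat]].

(* None is the non-halting value NH. *)
Definition probabilistic_general_algorithm (M V : metricType R)
    (P : comp_problem M V) (Gamma : problem_dom P * coins -> option M) :=
  let L := coin_evaluations (evaluations P) in
  exists LG : problem_dom P * coins -> set (problem_dom P * coins -> V + bool),
    forall Aa,
    [/\ LG Aa `<=` L, LG Aa !=set0,
        forall Bb, (forall f, LG Aa f -> f Aa = f Bb) ->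
          LG Bb = LG Aa /\ Gamma Bb = Gamma Aa &
        Gamma Aa <> None -> finite_set (LG Aa)].
Arguments probabilistic_general_algorithm {M V} P.

(* Convergence to m in M with the isolated point NH adjoined. *)
Definition cvg_halting (M : metricType R) (u : nat -> option M) (m : M) :=
  exists2 v : nat -> M,
    (\forall n \near \oo, u n = Some (v n)) & v n @[n --> \oo] --> m.

Definition notin_Delta2P_half (M V : metricType R) (P : comp_problem M V) :=
  forall Gamma : nat -> problem_dom P * coins -> option M,
    (forall n, probabilistic_general_algorithm P (Gamma n)) ->
    (ereal_inf [set coin_measure R
        [set a | cvg_halting (fun n => Gamma n (A, a)) (target A)]
        | A in [set: problem_dom P]] <= (2^-1)%:E)%E.

End problems.

Section koopman.
Variable R : realType.
Local Notation C := (R[i])^o.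
Local Notation torus := (torus R).
Local Notation mu := (torus_measure R).
Import Normc.

Definition Lip (F : torus -> torus) : \bar R :=
  ereal_inf [set L%:E | L in
    [set L : R | 0 <= L /\ forall x y, mdist (F x) (F y) <= L * mdist x y]].

Definition iterated_derivative (vs : seq (R * R)) (G : R * R -> R * R) :
    R * R -> R * R :=
  foldr (fun v H z => 'D_v H z) G vs.

(* C^oo on a neighbourhood of z. *)
Definition smooth_near (G : R * R -> R * R) (z : R * R) :=
  \forall w \near z, forall vs, differentiable (iterated_derivative vs G) w.

(* Smoothness in charts: near every point F has a C^oo lift to the plane. *)
Definition smooth (F : torus -> torus) :=
  forall z : R * R, exists2 G : R * R -> R * R, smooth_near G z &
    (\forall w \near z, F (torus_of w) = torus_of (G w)).

Definition measure_preserving (F : torus -> torus) :=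
  measurable_fun setT F /\
  forall A : set torus, measurable A -> mu (F @^-1` A) = mu A.

Definition Omega_p_pred (F : torus -> torus) :=
  [/\ smooth F, measure_preserving F &
      exists Finv, [/\ cancel F Finv, cancel Finv F,
                       (Lip F <= 2%:E)%E & (Lip Finv <= 2%:E)%E]].

Definition Omega_p := {F : torus -> torus | Omega_p_pred F}.

Definition sqnorm (g : torus -> C) : \bar R :=
  (\int[mu]_x (normc (g x) ^+ 2)%:E)%E.

(* Square-integrable representatives; equality in L^2 is [= %[ae mu]]. *)
Definition L2 (g : torus -> C) :=
  [/\ measurable_fun setT (fun x => complex.Re (g x)),
      measurable_fun setT (fun x => complex.Im (g x)) &
      (sqnorm g < +oo)%E].

Definition koopman (F : torus -> torus) (g : torus -> C) : torus -> C :=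
  g \o F.

Definition eigenvalue (F : torus -> torus) (lambda : C) :=
  exists g, [/\ L2 g, ~ (g = (fun=> 0) %[ae mu]) &
    koopman F g = (fun x => lambda * g x) %[ae mu]].

Definition Sp_pp (F : torus -> torus) : set C :=
  closure [set lambda | eigenvalue F lambda].

Let normc_ge0 (z : C) : 0 <= normc z.
Proof. by case: z => a b; rewrite /= sqrtr_ge0. Qed.

Let normc2E (z : C) : normc z ^+ 2 = complex.Re z ^+ 2 + complex.Im z ^+ 2.
Proof. by case: z => a b; rewrite /= sqr_sqrtr// addr_ge0 ?sqr_ge0. Qed.

Let measurable_sqnorm g : L2 g ->
  measurable_fun [set: torus] (fun x => (normc (g x) ^+ 2)%:E).
Proof.
move=> [mr mi _]; apply/measurable_EFinP.
rewrite (_ : (fun x => _) =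
  (fun x => complex.Re (g x) ^+ 2 + complex.Im (g x) ^+ 2)); last first.
  by apply/funext => x; rewrite normc2E.
by apply: measurable_funD; exact: measurable_funX.
Qed.

Let sqnorm_koopman F g : measure_preserving F -> L2 g ->
  sqnorm (koopman F g) = sqnorm g.
Proof.
move=> [mF muF] Lg; rewrite /sqnorm.
transitivity (\int[pushforward mu F]_x (normc (g x) ^+ 2)%:E)%E.
  rewrite (ge0_integral_pushforward mF)//; first exact: (measurable_sqnorm Lg).
  by move=> x _; rewrite lee_fin sqr_ge0.
by apply: eq_measure_integral => A mA _; exact: muF.
Qed.

Let sqnormZ lambda g : L2 g ->
  sqnorm (fun x => lambda * g x) = ((normc lambda ^+ 2)%:E * sqnorm g)%E.
Proof.
move=> Lg; rewrite /sqnorm -ge0_integralZl//; last 3 first.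
- exact: measurable_sqnorm.
- by move=> x _; rewrite lee_fin sqr_ge0.
- by rewrite lee_fin sqr_ge0.
by apply: eq_integral => x _; rewrite normcM exprMn EFinM.
Qed.

Let L2_koopman F g : measure_preserving F -> L2 g -> L2 (koopman F g).
Proof.
move=> mpF Lg; have [mr mi fin] := Lg; have [mF _] := mpF; split.
- exact: (measurableT_comp mr mF).
- exact: (measurableT_comp mi mF).
- by rewrite sqnorm_koopman.
Qed.

Let measurable_L2Z lambda g : L2 g ->
  measurable_fun [set: torus] (fun x => (normc (lambda * g x) ^+ 2)%:E).
Proof.
move=> Lg; rewrite (_ : (fun x => _) =
  (fun x => (normc lambda ^+ 2)%:E * (normc (g x) ^+ 2)%:E)%E).
  by apply: measurable_funeM; exact: measurable_sqnorm.
by apply/funext => x; rewrite normcM exprMn.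
Qed.

Lemma eigenvalue_normc F lambda :
  measure_preserving F -> eigenvalue F lambda -> normc lambda = 1.
Proof.
move=> mpF [g [Lg g0 Fg]]; have Lg' := Lg; case: Lg' => _ _ gfin.
have e : sqnorm (koopman F g) = sqnorm (fun x => lambda * g x).
  apply: ge0_ae_eq_integral => //.
  - exact: (measurable_sqnorm (L2_koopman mpF Lg)).
  - exact: measurable_L2Z.
  - by move=> x _; rewrite lee_fin sqr_ge0.
  - by move=> x _; rewrite lee_fin sqr_ge0.
  - by apply: filterS Fg => x /(_ I) /= ->.
rewrite sqnorm_koopman// sqnormZ// in e.
have ge0 : (0 <= sqnorm g)%E.
  by apply: integral_ge0 => x _; rewrite lee_fin sqr_ge0.
have n0 : sqnorm g != 0%E.
  apply/eqP => s0; apply: g0.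
  have := (ae_eq_integral_abs mu measurableT (measurable_sqnorm Lg)).1.
  rewrite (eq_integral (fun x => (normc (g x) ^+ 2)%:E)); last first.
    by move=> x _; rewrite gee0_abs// lee_fin sqr_ge0.
  move=> /(_ s0); apply: filterS => x /(_ I) /= [/eqP].
  by rewrite sqrf_eq0 => /eqP/eq0_normc.
move: e ge0 n0 gfin; rewrite -/(sqnorm g).
case: (sqnorm g) => // r [e] _; rewrite eqe => r0 _.
have : normc lambda ^+ 2 = 1.
  by apply: (mulIf r0); rewrite mul1r.
by move/eqP; rewrite sqrf_eq1 => /orP[/eqP//|/eqP h]; have := normc_ge0 lambda;
   rewrite h lerNr oppr0 ler10.
Qed.

Lemma eigenvalue1 F : eigenvalue F 1.
Proof.
exists (fun=> 1); split.
- split => //; rewrite /sqnorm; under eq_integral do rewrite normc1 expr1n.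
  by rewrite integral_cst// mul1e (le_lt_trans (probability_le1 _ _))// ltry.
- move=> [A [mA A0 sA]].
  have : mu setT = 0%E.
    apply/eqP; rewrite eq_le measure_ge0 andbT -A0; apply: le_measure.
    + by rewrite inE.
    + by rewrite inE.
    + by move=> x _; apply: sA => /= /(_ I)/eqP; rewrite oner_eq0.
  by rewrite probability_setT => /eqP; rewrite onee_eq0.
- by apply: aeW => x _; rewrite /koopman/= mulr1.
Qed.

Lemma Sp_pp_compact F : Omega_p_pred F ->
  compact (Sp_pp F) /\ Sp_pp F !=set0.
Proof.
move=> [_ mpF _]; split; last first.
  by exists 1; apply: subset_closure; exact: eigenvalue1.
apply: (@bounded_closed_compactC _ _ 1); first exact: closed_closure.
have cl : closed [set z : C | normc z <= 1].
  by apply: (@closed_comp _ _ (@normc R : C -> R) [set x | x <= 1]);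
    [move=> x _; exact: normc_continuous|exact: closed_le].
rewrite ((closure_id _).1 cl); apply: closureS => z /= ez.
by rewrite (eigenvalue_normc mpF ez).
Qed.

Definition Xi_p (F : Omega_p) : compacts R :=
  exist _ (Sp_pp (sval F)) (Sp_pp_compact (svalP F)).

(* The value false stands for 0 and true for 1. *)
Definition Xi_p_dec (F : Omega_p) : decision R :=
  ~~ `[< forall lambda, eigenvalue (sval F) lambda -> lambda = 1 >].

Section sampling.
Variables (M : metricType R) (Xi : Omega_p -> M) (xhat : nat -> torus).
Hypothesis xhat_dense : dense (range xhat).

Let Lip2 (F : torus -> torus) x y :
  (Lip F <= 2%:E)%E -> mdist (F x) (F y) <= 2 * mdist x y.
Proof.
move=> LF; apply/ler_addgt0Pl => e e0.
have d1 : 0 < mdist x y + 1 by rewrite ltr_wpDl ?mdist_ge0.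
have [_ [L [L0 FL] <-] Le] : exists2 L, [set L%:E | L in
    [set L : R | 0 <= L /\ forall x y, mdist (F x) (F y) <= L * mdist x y]] L &
    (L < (2 + e / (mdist x y + 1))%:E)%E.
  apply: ereal_inf_lt.
  by rewrite (le_lt_trans LF)// lte_fin ltrDl divr_gt0.
rewrite lte_fin in Le.
rewrite (le_trans (FL x y))// (le_trans (ler_wpM2r _ (ltW Le))) ?mdist_ge0//.
rewrite mulrDl addrC lerD2r mulrAC ler_pdivrMr// ler_pM2l// lerDl//.
Qed.

Lemma samples_determine (F G : Omega_p) :
  Xi F <> Xi G -> exists j, sval F (xhat j) <> sval G (xhat j).
Proof.
apply: contra_notP => /forallNP FG; congr Xi.
suff e : sval F = sval G.
  case: F G e {FG} => [F pF] [G pG] /= e; move: pF pG; rewrite e => pF pG.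
  by congr exist; exact: Prop_irrelevance.
have [_ _ [_ [_ _ LF _]]] := svalP F; have [_ _ [_ [_ _ LG _]]] := svalP G.
apply/funext => x; apply: mdist_positivity.
apply/eqP; rewrite eq_le mdist_ge0 andbT; apply/ler_addgt0Pl => e e0.
rewrite addr0; have e4 : 0 < e / 4 by rewrite divr_gt0.
have [y [xy [j _ xj]]] : (ball x (e / 4))^° `&` range xhat !=set0.
  apply: xhat_dense; last exact: open_interior.
  by exists x; apply: nbhsx_ballx.
have {}xy : mdist x y < e / 4.
  by have /interior_subset := xy; rewrite ballEmdist.
have FGy : sval F y = sval G y by rewrite -xj; exact: contrapT (FG j).
rewrite (le_trans (metric_triangle _ (sval F y) _))// {2}FGy.
rewrite (le_trans (lerD (Lip2 x y LF) (Lip2 y x LG)))// (metric_sym y).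
lra.
Qed.

Definition sampling_problem : comp_problem M torus :=
  @CompProblem R M torus Omega_p nat (fun j F => sval F (xhat j)) Xi
    samples_determine.

End sampling.
End koopman.

(* Main.v *)
Require Import Defs.
From HB Require Import structures.
From mathcomp Require Import all_boot all_order all_algebra.
From mathcomp Require Import all_classical all_reals all_analysis.
From mathcomp Require Import measurable_realfun complex ring lra.
Set Implicit Arguments.
Unset Strict Implicit.
Unset Printing Implicit Defensive.
Import Order.TTheory GRing.Theory Num.Theory.
Import numFieldNormedType.Exports.
Local Open Scope classical_set_scope.
Local Open Scope ring_scope.
(** The proof has two independent halves.

    Upper bounds. Fix F and lambda on the unit circle, start from a character
    e of the torus and let the isometry h |-> lambda * h o F act on it. By the
    mean ergodic theorem the element of least norm in the closed convex hull
    of the orbit of e is the projection of e on the fixed functions of this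
    isometry, whose complex conjugates are the eigenfunctions of the Koopman
    operator for lambda. Since the characters span L^2 ([fourier_uniqueness]),
    lambda is an eigenvalue if and only if, for some character, the finite
    averages of its orbit have squared norm bounded below by some d > 0
    ([eigenvalue_energy], [energy_eigenvalue]). For given character and d this
    condition is a conjunction of integral inequalities, each of which is
    stable under pointwise convergence of F and convergence of lambda
    ([energy_ge_closed]); hence so is the condition that a lambda in a given
    closed set K satisfies it ([detected_closed]). A closed condition on F is
    decided in one limit: by compactness of the information, it holds as soon
    as every finite set of approximate samples is compatible with some element
    that satisfies it ([plausible_eventually]). The second limit lets the list
    of characters and bounds d grow. With K the points away from 1 this gives
    the tower for the decision problem, and with K small discs around the
    points of a lattice the tower for the spectrum.

    Lower bounds. The maps (x, y) |-> (x, y + phi x) with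
    phi x = pi + h (cos x) are smooth and preserve the measure. If h vanishes on
    [-1, b] for some b > -1, then F is a half turn on a strip and -1 is an
    eigenvalue ([eigenvalue_plateau]); if h increases strictly on [-1, 1], the
    level sets of phi are negligible and 1 is the only eigenvalue
    ([eigenvalue_strict]). Take h a sum of terms c_k E (t - a_k), with
    E t = exp (- 1 / t) for t > 0 and E t = 0 elsewhere: from a state of the
    first kind an arbitrarily small new term with a_k = -1 leads to the second
    kind, and moving this a_k slightly to the right leads back to the first,
    as often as desired and with a convergent limit. An algorithm that succeeds
    with probability more than 1/2 on every input must, on each state, give with
    probability more than 1/2 an output close to the right answer after reading
    finitely many samples and coins only, so an adversary may then change the
    state by less than the precision of what was read. On the limit of such a
    play the outputs are, for infinitely many indices, with probability more
    than 1/2 near the answers of the first kind, and for infinitely many others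
    near those of the second, which contradicts convergence with probability
    more than 1/2 ([adversary_wins]). *)

Local Notation wrap := Defs.wrap.

(** * The circle and the torus *)

Section circle_facts.
Variable R : realType.
Local Notation tau := (2 * pi : R).
Implicit Types (x y : R) (p q : circle R) (m : int).

Lemma twopi_neq0 : tau != 0.
Proof. by rewrite gt_eqF// twopi_gt0. Qed.

Lemma wrap_id x : 0 <= x < tau -> wrap x = x.
Proof.
move=> /andP[x0 x1]; rewrite /wrap.
suff -> : Num.floor (x / tau) = 0 by rewrite mulr0 subr0.
apply: floor_def; rewrite add0r mulr0z mulr1z.
by rewrite divr_ge0 ?(ltW (twopi_gt0 _))//= ltr_pdivrMr ?twopi_gt0// mul1r.
Qed.

Lemma wrapD x m : wrap (x + tau * m%:~R) = wrap x.
Proof.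
have e : (x + tau * m%:~R) / tau = x / tau + m%:~R.
  by move: twopi_neq0; set t := 2 * pi => t0; field.
by rewrite /wrap e floorDrz ?intr_int// intrKfloor intrD; ring.
Qed.

Lemma wrapE x : exists m, wrap x = x + tau * m%:~R.
Proof. by exists (- Num.floor (x / tau)); rewrite /wrap mulrNz mulrN. Qed.

Lemma circle_ofD x m : circle_of (x + tau * m%:~R) = circle_of x.
Proof. by apply/val_inj; rewrite /= wrapD. Qed.

Lemma circle_ofK p : circle_of (val p) = p.
Proof. by apply/val_inj; rewrite /= wrap_id//; exact: (valP p). Qed.

Lemma circle_of_wrapD x y : circle_of (wrap x + y) = circle_of (x + y).
Proof. by have [m ->] := wrapE x; rewrite addrAC circle_ofD. Qed.

Lemma periodic_nat (f : R -> R) (n : nat) x :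
  (forall x, f (x + tau) = f x) -> f (x + tau * n%:R) = f x.
Proof.
move=> fp; elim: n x => [|n IH] x; first by rewrite mulr0 addr0.
by rewrite -[n.+1%:R]natr1 [tau * _]mulrDr mulr1 addrA fp.
Qed.

Lemma periodic_int (f : R -> R) m x :
  (forall x, f (x + tau) = f x) -> f (x + tau * m%:~R) = f x.
Proof.
case: m => n fp; first exact: periodic_nat.
rewrite NegzE mulrNz mulrN -(@periodic_nat f n.+1)//; congr f.
by rewrite -pmulrn subrK.
Qed.

Lemma cosD_tau x : cos (x + tau) = cos x.
Proof. by rewrite mulr_natl cosD2pi. Qed.

Lemma sinD_tau x : sin (x + tau) = sin x.
Proof. by rewrite mulr_natl sinD2pi. Qed.

Lemma periodic_wrap (f : R -> R) x :
  (forall x, f (x + tau) = f x) -> f (wrap x) = f x.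
Proof. by move=> fp; have [m ->] := wrapE x; rewrite periodic_int. Qed.

(** The distance on the circle is the least absolute value among the
    representatives of the difference; this lemma gives one that attains it and
    [circle_dist_le] the minimality, so that periodic functions can be treated
    on the line without following the two branches of the minimum. *)
Lemma circle_dist_rep p q :
  exists m, circle_dist p q = `|val p - val q + tau * m%:~R|.
Proof.
rewrite /circle_dist minEle; case: ifP => _; first by exists 0; rewrite mulr0 addr0.
have /andP[p0 p1] := valP p; have /andP[q0 q1] := valP q.
have [h|h] := leP 0 (val p - val q).
  exists (-1); rewrite mulrN mulr1 ger0_norm//.
  by rewrite ltr0_norm; lra.
exists 1; rewrite mulr1 ltr0_norm// opprK gtr0_norm; lra.
Qed.

Lemma circle_dist_le p q m : circle_dist p q <= `|val p - val q + tau * m%:~R|.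
Proof.
have /andP[p0 p1] := valP p; have /andP[q0 q1] := valP q.
have t0 := twopi_gt0 R.
rewrite /circle_dist ge_min; case: m => [[|n]|n].
- by rewrite mulr0 addr0 lexx.
- apply/orP; right.
  have := ler_norm (- (val p - val q)); rewrite normrN => ?.
  rewrite (le_trans _ (ler_norm _))//.
  have : tau <= tau * n.+1%:R by rewrite ler_pMr// ler1n.
  lra.
- apply/orP; right.
  have := ler_norm (val p - val q) => ?.
  rewrite NegzE mulrNz mulrN.
  have := ler_norm (- (val p - val q - tau * n.+1%:~R)); rewrite normrN.
  have : tau <= tau * n.+1%:~R by rewrite ler_pMr// ler1z.
  lra.
Qed.

Lemma circle_dist_of x y : circle_dist (circle_of x) (circle_of y) <= `|x - y|.
Proof.
have [m xm] := wrapE x; have [n yn] := wrapE y.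
have := circle_dist_le (circle_of x) (circle_of y) (n - m).
by rewrite /= xm yn intrB; congr (_ <= `|_|); ring.
Qed.

(** The triangle inequality for the group law of the circle, on which the
    Lipschitz bound of a shear rests. *)
Lemma circle_dist_ofD p q x y :
  circle_dist (circle_of (val p + x)) (circle_of (val q + y)) <=
  circle_dist p q + circle_dist (circle_of x) (circle_of y).
Proof.
have [m ->] := circle_dist_rep p q.
have [n ->] := circle_dist_rep (circle_of x) (circle_of y).
have [k xk] := wrapE x; have [l yl] := wrapE y.
rewrite /= xk yl -(circle_ofD (val p + x) (m + n + k - l)) !intrD mulrNz.
rewrite (le_trans (circle_dist_of _ _))// (le_trans _ (ler_normD _ _))//.
by rewrite le_eqVlt; apply/orP; left; apply/eqP; congr `|_| => /=; ring.
Qed.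

Lemma periodic_lipschitz (f : R -> R) (l : R) p q :
  (forall x, f (x + tau) = f x) ->
  (forall x y, `|f x - f y| <= l * `|x - y|) ->
  `|f (val p) - f (val q)| <= l * circle_dist p q.
Proof.
move=> fp fl; have [m ->] := circle_dist_rep p q.
by rewrite addrAC -(periodic_int m (val p) fp).
Qed.

End circle_facts.

Section torus_facts.
Variable R : realType.
Implicit Types x y : torus R.

Lemma mdist_torusE x y :
  mdist x y = Num.sqrt (circle_dist x.1 y.1 ^+ 2 + circle_dist x.2 y.2 ^+ 2).
Proof. by []. Qed.

Lemma circle_dist_le_mdist1 x y : circle_dist x.1 y.1 <= mdist x y.
Proof.
rewrite mdist_torusE -[leLHS]ger0_norm ?circle_dist_ge0// -sqrtr_sqr.
by rewrite ler_sqrt ?addr_ge0 ?sqr_ge0// lerDl sqr_ge0.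
Qed.

Lemma circle_dist_le_mdist2 x y : circle_dist x.2 y.2 <= mdist x y.
Proof.
rewrite mdist_torusE -[leLHS]ger0_norm ?circle_dist_ge0// -sqrtr_sqr.
by rewrite ler_sqrt ?addr_ge0 ?sqr_ge0// lerDr sqr_ge0.
Qed.

Lemma mdist_le_circle_dist x y :
  mdist x y <= circle_dist x.1 y.1 + circle_dist x.2 y.2.
Proof.
have a0 := circle_dist_ge0 x.1 y.1; have b0 := circle_dist_ge0 x.2 y.2.
rewrite mdist_torusE -[leRHS]ger0_norm ?addr_ge0// -sqrtr_sqr.
rewrite ler_sqrt ?sqr_ge0//; nra.
Qed.

(** The infimum that defines [Lip] is attained in the limit of the admissible
    constants. *)
Lemma Lip_le (F : torus R -> torus R) x y :
  (Lip F <= 2%:E)%E -> mdist (F x) (F y) <= 2 * mdist x y.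
Proof.
move=> LF; apply/ler_addgt0Pl => e e0.
have d1 : 0 < mdist x y + 1 by rewrite ltr_wpDl ?mdist_ge0.
have [_ [L [L0 FL] <-] Le] : exists2 L, [set L%:E | L in
    [set L : R | 0 <= L /\ forall x y, mdist (F x) (F y) <= L * mdist x y]] L &
    (L < (2 + e / (mdist x y + 1))%:E)%E.
  apply: ereal_inf_lt.
  by rewrite (le_lt_trans LF)// lte_fin ltrDl divr_gt0.
rewrite lte_fin in Le.
rewrite (le_trans (FL x y))// (le_trans (ler_wpM2r _ (ltW Le))) ?mdist_ge0//.
by rewrite mulrDl addrC lerD2r mulrAC ler_pdivrMr// ler_pM2l// lerDl.
Qed.

Lemma le_Lip (F : torus R -> torus R) (L : R) : 0 <= L ->
  (forall x y, mdist (F x) (F y) <= L * mdist x y) -> (Lip F <= L%:E)%E.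
Proof. by move=> L0 FL; apply: ereal_inf_lbound; exists L. Qed.

End torus_facts.

(** * Integration over a probability space *)

Section integration_tools.
Context d (T : measurableType d) (R : realType) (mu : probability T R).
Implicit Types (f g w : T -> R).

Lemma integrable_mulr_bounded f w (M : R) :
  mu.-integrable setT (EFin \o f) -> measurable_fun setT w ->
  (forall x, `|w x| <= M) -> mu.-integrable setT (EFin \o (fun x => f x * w x)).
Proof.
move=> fi mw wM.
have mf : measurable_fun setT f by apply/measurable_EFinP; exact: measurable_int fi.
apply: (@le_integrable _ _ _ mu setT measurableT _ (fun x => (M * f x)%:E)).
- by apply/measurable_EFinP; exact: measurable_funM.
- move=> x _ /=; rewrite lee_fin !normrM mulrC ler_wpM2r//.
  exact: le_trans (wM x) (ler_norm _).
- rewrite (_ : (fun x => _) = (fun x => M%:E * (EFin \o f) x)%E).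
    exact: integrableZl.
  by apply/funext => x; rewrite /= EFinM.
Qed.

Lemma integrable_bounded w (M : R) : measurable_fun setT w ->
  (forall x, `|w x| <= M) -> mu.-integrable setT (EFin \o w).
Proof.
move=> mw wM; apply: (@le_integrable _ _ _ mu setT measurableT _ (fun x => M%:E)).
- exact/measurable_EFinP.
- by move=> x _ /=; rewrite lee_fin (le_trans (wM x))// ler_norm.
- exact: finite_measure_integrable_cst.
Qed.

Lemma integrable_addr f g :
  mu.-integrable setT (EFin \o f) -> mu.-integrable setT (EFin \o g) ->
  mu.-integrable setT (EFin \o (fun x => f x + g x)).
Proof. exact: integrableD. Qed.

Lemma integrable_subr f g :
  mu.-integrable setT (EFin \o f) -> mu.-integrable setT (EFin \o g) ->
  mu.-integrable setT (EFin \o (fun x => f x - g x)).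
Proof. exact: integrableB. Qed.

Lemma integrable_scaler (c : R) f :
  mu.-integrable setT (EFin \o f) ->
  mu.-integrable setT (EFin \o (fun x => c * f x)).
Proof. exact: integrableZl. Qed.

Lemma measurable_combination (a b : R) f g :
  measurable_fun setT f -> measurable_fun setT g ->
  measurable_fun setT (fun x => a * f x + b * g x).
Proof. by move=> mf mg; apply: measurable_funD; apply: measurable_funM. Qed.

Lemma measurable_sumsq f g :
  measurable_fun setT f -> measurable_fun setT g ->
  measurable_fun setT (fun x => f x ^+ 2 + g x ^+ 2).
Proof. by move=> mf mg; apply: measurable_funD; apply: measurable_funX. Qed.

(** Dominated convergence with almost everywhere convergence and pointwise
    domination, the only form used below. *)
Lemma cvg_Rintegral (w_ : nat -> T -> R) w g :
  (forall n, measurable_fun setT (w_ n)) -> measurable_fun setT w ->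
  mu.-integrable setT (EFin \o g) ->
  (forall n x, `|w_ n x| <= g x) ->
  {ae mu, forall x, w_ n x @[n --> \oo] --> w x} ->
  (\int[mu]_x w_ n x)%R @[n --> \oo] --> (\int[mu]_x w x)%R.
Proof.
move=> mw_ mw gi wg wcvg.
have [] := @dominated_convergence _ _ _ mu setT measurableT
  (fun n => EFin \o w_ n) (EFin \o w) (EFin \o g).
- by move=> n; exact/measurable_EFinP.
- exact/measurable_EFinP.
- apply: filterS wcvg => x cx _; apply: cvg_EFin => //.
  exact: nearW.
- exact: gi.
- by apply: aeW => x n _; rewrite /= lee_fin.
move=> wi _; rewrite /Rintegral => h; apply: fine_cvg.
by rewrite fineK//; exact: integrable_fin_num.
Qed.

Lemma integral_invariant (F : T -> T) f : measurable_fun setT F ->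
  (forall A, measurable A -> mu (F @^-1` A) = mu A) ->
  mu.-integrable setT (EFin \o f) ->
  mu.-integrable setT (EFin \o (f \o F)) /\
  (\int[mu]_x f (F x))%R = (\int[mu]_x f x)%R.
Proof.
move=> mF muF fi; have mf := measurable_int _ fi.
have muE (h : T -> \bar R) : (\int[pushforward mu F]_x h x = \int[mu]_x h x)%E.
  by apply: eq_measure_integral => A mA _; exact: muF.
have fFi : mu.-integrable setT ((EFin \o f) \o F).
  apply/integrableP; split; first exact: measurableT_comp mf mF.
  case/integrableP : fi => _; rewrite -muE ge0_integral_pushforward//.
  exact: measurableT_comp.
split => //; rewrite /Rintegral; congr fine.
by rewrite -[RHS]muE; rewrite (integral_pushforward mF mf fFi measurableT).
Qed.

Lemma ae_invariant (F : T -> T) (P : T -> Prop) : measurable_fun setT F ->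
  (forall A, measurable A -> mu (F @^-1` A) = mu A) ->
  {ae mu, forall x, P x} -> {ae mu, forall x, P (F x)}.
Proof.
move=> mF muF [N [mN N0 PN]]; exists (F @^-1` N); split.
- by rewrite -[X in measurable X]setTI; exact: mF.
- by rewrite muF.
- by move=> x /= nP; exact: PN.
Qed.

End integration_tools.

(** * Uniqueness of Fourier coefficients *)

Section step_function.
Variable R : realType.
Implicit Types (x u : R) (n : nat).

Lemma bernoulli_lower x n : 0 <= x <= 1 -> 1 - n%:R * x <= (1 - x) ^+ n.
Proof.
move=> /andP[x0 x1]; elim: n => [|n IH]; first by rewrite mul0r subr0 expr0.
have : (1 - n%:R * x) * (1 - x) <= (1 - x) ^+ n * (1 - x).
  by rewrite ler_wpM2r// subr_ge0.
rewrite exprSr; apply: le_trans; rewrite -natr1.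
have : 0 <= n%:R * x * x by rewrite !mulr_ge0.
lra.
Qed.

Lemma bernoulli_upper x n : 0 <= x <= 1 -> (1 - x) ^+ n * (1 + n%:R * x) <= 1.
Proof.
move=> /andP[x0 x1]; elim: n => [|n IH]; first by rewrite mul0r addr0 expr0 mulr1.
apply: le_trans IH; rewrite exprSr -mulrA ler_wpM2l ?exprn_ge0 ?subr_ge0//.
rewrite -natr1; have : 0 <= (n%:R + 1) * x * x by rewrite !mulr_ge0// addr_ge0.
lra.
Qed.

Lemma cvg_natr_expr x : 0 <= x < 1 -> (n%:R * x ^+ n) @[n --> \oo] --> (0 : R).
Proof.
move=> /andP[x0 x1]; pose s := Num.sqrt x.
have s0 : 0 <= s by exact: sqrtr_ge0.
have s1 : s < 1 by rewrite -sqrtr1 ltr_sqrt.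
have sE : x = s * s by rewrite -expr2 sqr_sqrtr.
have bnd n : n%:R * s ^+ n * (1 - s) <= 1.
  have h01 : 0 <= 1 - s <= 1 by apply/andP; split; lra.
  have := bernoulli_upper n h01; rewrite subKr.
  have : 0 <= s ^+ n by exact: exprn_ge0.
  set a := s ^+ n; set k : R := n%:R; lra.
have cs : (s ^+ n / (1 - s)) @[n --> \oo] --> (0 : R).
  rewrite -[X in _ --> X](mul0r (1 - s)^-1); apply: cvgM; last exact: cvg_cst.
  by apply: cvg_expr; rewrite ger0_norm.
apply: (squeeze_cvgr _ (cvg_cst 0) cs); apply: nearW => n.
rewrite mulr_ge0 ?exprn_ge0//= sE exprMn mulrA ler_pdivlMr ?subr_gt0//.
have := bnd n; have := exprn_ge0 n s0.
set a := s ^+ n; set k : R := n%:R => a0 b.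
by have := ler_wpM2r a0 b; lra.
Qed.

(** An explicit approximation of a step function by polynomials: for
    N = n * 2 ^ n the product N * u ^ n = n * (2 u) ^ n tends to 0 if
    u < 1/2 and to infinity otherwise, and (1 - t) ^ N lies between 1 - N t and
    1 / (1 + N t) by the two forms of Bernoulli's inequality. *)
Lemma cvg_step u : 0 <= u <= 1 ->
  ((1 - u ^+ n) ^+ (n * 2 ^ n)%N) @[n --> \oo] --> ((u < 2^-1)%R%:R : R).
Proof.
move=> /andP[u0 u1]; have un n : 0 <= u ^+ n <= 1.
  by rewrite exprn_ge0//= exprn_ile1.
have K n : (n * 2 ^ n)%:R * u ^+ n = n%:R * (2 * u) ^+ n.
  by rewrite natrM natrX exprMn mulrA.
have [u2|u2] := ltP u 2^-1.
  apply: (@squeeze_cvgr _ _ _ _ (fun n => 1 - n%:R * (2 * u) ^+ n) (cst 1)).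
  - apply: nearW => n; rewrite -K bernoulli_lower//= exprn_ile1 ?subr_ge0 //.
      by case/andP : (un n).
    by rewrite gerBl; case/andP : (un n).
  - rewrite -[X in _ --> X]subr0; apply: cvgB; first exact: cvg_cst.
    by apply: cvg_natr_expr; apply/andP; split; lra.
  - exact: cvg_cst.
apply: (@squeeze_cvgr _ _ _ _ (cst 0) (fun n => (1 + n%:R)^-1)).
- apply: nearW => n /=; rewrite exprn_ge0 ?subr_ge0//=; last by case/andP : (un n).
  have := bernoulli_upper (n * 2 ^ n) (un n); rewrite K => h.
  have n0 : 0 < 1 + n%:R :> R by rewrite ltr_wpDr.
  rewrite -[leRHS]mul1r ler_pdivlMr// (le_trans _ h)// ler_wpM2l//.
    by rewrite exprn_ge0 ?subr_ge0//; case/andP : (un n).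
  by rewrite lerD2l ler_peMr// exprn_ege1//; lra.
- exact: cvg_cst.
- apply/cvgrPdist_lt => e e0; have [N Ne] := @ltr_add_invr R 0 e e0.
  near=> n; rewrite sub0r normrN ger0_norm ?invr_ge0//.
  rewrite add0r in Ne; rewrite (le_lt_trans _ Ne)// lef_pV2 ?posrE// addrC.
  by rewrite natr1 ler_nat ltnS; near: n; exact: nbhs_infty_ge.
Unshelve. all: by end_near.
Qed.

End step_function.

Section trigonometric_closure.
Variable R : realType.
Local Notation torus := (torus R).
Local Notation mu := (torus_measure R).
Implicit Types (k m : int) (x : torus) (v w : torus -> R).

Definition phase k m x : R := k%:~R * val x.1 + m%:~R * val x.2.

Lemma measurable_circle_val : measurable_fun [set: circle R] (val : circle R -> R).
Proof. by move=> _ Y mY; rewrite setTI; exists Y => //; rewrite setTI. Qed.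

Lemma measurable_val1 : measurable_fun [set: torus] (fun x => val x.1 : R).
Proof. exact: (measurableT_comp measurable_circle_val measurable_fst). Qed.

Lemma measurable_val2 : measurable_fun [set: torus] (fun x => val x.2 : R).
Proof. exact: (measurableT_comp measurable_circle_val measurable_snd). Qed.

Lemma measurable_phase k m : measurable_fun [set: torus] (phase k m).
Proof.
apply: measurable_funD; apply: measurable_funM => //.
  exact: measurable_val1.
exact: measurable_val2.
Qed.

Lemma measurable_cos_phase k m : measurable_fun [set: torus] (cos \o phase k m).
Proof.
apply: measurableT_comp (measurable_phase k m).
by apply: continuous_measurable_fun; exact: continuous_cos.
Qed.

Lemma measurable_sin_phase k m : measurable_fun [set: torus] (sin \o phase k m).
Proof.
apply: measurableT_comp (measurable_phase k m).
by apply: continuous_measurable_fun; exact: continuous_sin.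
Qed.

Lemma phaseD k m k' m' x : phase (k + k') (m + m') x = phase k m x + phase k' m' x.
Proof. by rewrite /phase !intrD; ring. Qed.

Lemma phaseB k m k' m' x : phase (k - k') (m - m') x = phase k m x - phase k' m' x.
Proof. by rewrite /phase !intrB; ring. Qed.

Lemma phase0 x : phase 0 0 x = 0.
Proof. by rewrite /phase !mul0r addr0. Qed.

(** The closure of the trigonometric polynomials under bounded pointwise
    limits. It contains the indicators of all Borel sets, as shown below, while
    a vanishing integral against an integrable function passes through each of
    its constructors. *)
Inductive trig_closure : (torus -> R) -> Prop :=
| trig_cos k m : trig_closure (cos \o phase k m)
| trig_sin k m : trig_closure (sin \o phase k m)
| trig_add v w : trig_closure v -> trig_closure w -> trig_closure (fun x => v x + w x)
| trig_scale (c : R) w : trig_closure w -> trig_closure (fun x => c * w x)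
| trig_lim (w_ : nat -> torus -> R) w (M : R) :
    (forall n, trig_closure (w_ n)) -> (forall n x, `|w_ n x| <= M) ->
    (forall x, w_ n x @[n --> \oo] --> w x) -> trig_closure w.

Lemma trig_closure_ext v w : v =1 w -> trig_closure v -> trig_closure w.
Proof. by move=> /funext ->. Qed.

Lemma trig_closure_measurable w : trig_closure w -> measurable_fun setT w.
Proof.
elim => {w} [k m|k m|v w _ mv _ mw|c w _ mw|w_ w M _ mw _ cw].
- exact: measurable_cos_phase.
- exact: measurable_sin_phase.
- exact: measurable_funD.
- exact: measurable_funM.
- by apply: measurable_fun_cvg mw _ => // x _; exact: cw.
Qed.

Lemma cvg_norm_le (u : nat -> R) (l M : R) :
  u n @[n --> \oo] --> l -> (forall n, `|u n| <= M) -> `|l| <= M.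
Proof.
move=> ul uM; have h : `|u n| @[n --> \oo] --> `|l| by exact: cvg_norm ul.
rewrite -(cvg_lim _ h)//; apply: limr_le; last exact: nearW.
by apply/cvg_ex; exists `|l|.
Qed.

Lemma trig_closure_bounded w : trig_closure w -> exists M, forall x, `|w x| <= M.
Proof.
elim => {w} [k m|k m|v w _ [M vM] _ [N wN]|c w _ [M wM]|w_ w M _ _ wM cw].
- by exists 1 => x; exact: cos_max.
- by exists 1 => x; exact: sin_max.
- by exists (M + N) => x; rewrite (le_trans (ler_normD _ _))// lerD.
- by exists (`|c| * M) => x; rewrite normrM ler_wpM2l.
- by exists M => x; apply: cvg_norm_le (cw x) _ => n.
Qed.

Lemma trig_const (c : R) : trig_closure (fun=> c).
Proof.
apply: (trig_closure_ext _ (trig_scale c (trig_cos 0 0))) => x /=.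
by rewrite phase0 cos0 mulr1.
Qed.

Lemma trig_closure_mul_cos k m w : trig_closure w ->
  trig_closure (fun x => cos (phase k m x) * w x).
Proof.
elim => {w} [k' m'|k' m'|v w _ hv _ hw|c w _ hw|w_ w M _ hw wM cw].
- apply: (trig_closure_ext _ (trig_scale 2^-1
    (trig_add (trig_cos (k + k') (m + m')) (trig_cos (k - k') (m - m'))))) => x /=.
  by rewrite phaseD phaseB cosD cosB; lra.
- apply: (trig_closure_ext _ (trig_scale 2^-1
    (trig_add (trig_sin (k + k') (m + m')) (trig_scale (-1) (trig_sin (k - k') (m - m')))))) => x /=.
  by rewrite phaseD phaseB sinD sinB; lra.
- by apply: (trig_closure_ext _ (trig_add hv hw)) => x /=; rewrite mulrDr.
- by apply: (trig_closure_ext _ (trig_scale c hw)) => x /=; rewrite mulrCA.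
- apply: (trig_lim (M := M) hw) => [n x|x].
    by rewrite normrM (le_trans _ (wM n x))// ler_piMl// cos_max.
  by apply: cvgM; [exact: cvg_cst|exact: cw].
Qed.

Lemma trig_closure_mul_sin k m w : trig_closure w ->
  trig_closure (fun x => sin (phase k m x) * w x).
Proof.
elim => {w} [k' m'|k' m'|v w _ hv _ hw|c w _ hw|w_ w M _ hw wM cw].
- apply: (trig_closure_ext _ (trig_scale 2^-1
    (trig_add (trig_sin (k + k') (m + m')) (trig_sin (k - k') (m - m'))))) => x /=.
  by rewrite phaseD phaseB sinD sinB; lra.
- apply: (trig_closure_ext _ (trig_scale 2^-1
    (trig_add (trig_cos (k - k') (m - m')) (trig_scale (-1) (trig_cos (k + k') (m + m')))))) => x /=.
  by rewrite phaseB cosB phaseD cosD; lra.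
- by apply: (trig_closure_ext _ (trig_add hv hw)) => x /=; rewrite mulrDr.
- by apply: (trig_closure_ext _ (trig_scale c hw)) => x /=; rewrite mulrCA.
- apply: (trig_lim (M := M) hw) => [n x|x].
    by rewrite normrM (le_trans _ (wM n x))// ler_piMl// sin_max.
  by apply: cvgM; [exact: cvg_cst|exact: cw].
Qed.

(** One factor at a time: the product formulas of trigonometry when it is a
    sine or a cosine, and bounded limits in general. *)
Lemma trig_closure_mul v w : trig_closure v -> trig_closure w ->
  trig_closure (fun x => v x * w x).
Proof.
move=> cv cw; have [N wN] := trig_closure_bounded cw.
elim: cv => {v} [k m|k m|v v' _ hv _ hv'|c v _ hv|v_ v M _ hv vM cv].
- exact: trig_closure_mul_cos.
- exact: trig_closure_mul_sin.
- by apply: (trig_closure_ext _ (trig_add hv hv')) => x /=; rewrite mulrDl.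
- by apply: (trig_closure_ext _ (trig_scale c hv)) => x /=; rewrite mulrA.
- apply: (trig_lim (M := M * N) hv) => [n x|x].
    by rewrite normrM ler_pM.
  by apply: cvgM; [exact: cv|exact: cvg_cst].
Qed.

Lemma trig_closure_exp w n : trig_closure w -> trig_closure (fun x => w x ^+ n).
Proof.
move=> cw; elim: n => [|n IH].
  by apply: (trig_closure_ext _ (trig_const 1)) => x; rewrite expr0.
by apply: (trig_closure_ext _ (trig_closure_mul cw IH)) => x; rewrite exprS.
Qed.

Lemma trig_closure_integral0 (a : torus -> R) w :
  mu.-integrable setT (EFin \o a) ->
  (forall k m, (\int[mu]_x (a x * cos (phase k m x)))%R = 0) ->
  (forall k m, (\int[mu]_x (a x * sin (phase k m x)))%R = 0) ->
  trig_closure w -> (\int[mu]_x (a x * w x))%R = 0.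
Proof.
move=> ia ac asn cw.
have iw v : trig_closure v -> mu.-integrable setT (EFin \o (fun x => a x * v x)).
  move=> cv; have [M vM] := trig_closure_bounded cv.
  exact: (integrable_mulr_bounded ia (trig_closure_measurable cv) vM).
have ma : measurable_fun setT a by apply/measurable_EFinP; exact: measurable_int ia.
elim: cw => {w} [k m|k m|v w cv hv cw hw|c w cw hw|w_ w M cw hw wM cvgw].
- exact: ac.
- exact: asn.
- under eq_Rintegral do rewrite mulrDr.
  by rewrite RintegralD ?hv ?hw ?addr0//; exact: iw.
- under eq_Rintegral do rewrite mulrCA.
  by rewrite RintegralZl ?hw ?mulr0//; exact: iw.
- have h : (\int[mu]_x (a x * w_ n x))%R @[n --> \oo] --> (\int[mu]_x (a x * w x))%R.
    apply: (@cvg_Rintegral _ _ _ mu _ _ (fun x => `|a x| * M)).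
    + by move=> n; apply: measurable_funM => //; exact: trig_closure_measurable.
    + apply: measurable_funM => //; apply: trig_closure_measurable.
      exact: trig_lim cw wM cvgw.
    + apply: (@integrable_mulr_bounded _ _ _ mu _ (fun=> M) `|M|) => //.
      rewrite (_ : EFin \o _ = abse \o (EFin \o a))//.
      exact: integrable_abse.
    + by move=> n x; rewrite normrM ler_wpM2l.
    + by apply: aeW => x; apply: cvgM; [exact: cvg_cst|exact: cvgw].
  have h0 : (\int[mu]_x (a x * w_ n x))%R @[n --> \oo] --> (0 : R).
    by under eq_fun do rewrite hw; exact: cvg_cst.
  exact: (cvg_unique _ h h0).
Qed.

(** After rescaling v to u = (1 - v / N) / 2 with values in [0, 1], its
    positivity set is the set u < 1/2, and [cvg_step] applies. *)
Lemma trig_closure_positivity v : trig_closure v ->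
  trig_closure (\1_[set x | 0 < v x]).
Proof.
move=> cv; have [M vM] := trig_closure_bounded cv.
pose N := `|M| + 1; have N0 : 0 < N by rewrite ltr_wpDl.
have vN x : `|v x| <= N by rewrite (le_trans (vM x))// ler_wpDr// ler_norm.
pose u x := 2^-1 * (1 + (- N^-1) * v x).
have cu : trig_closure u.
  exact: trig_scale (trig_add (trig_const 1) (trig_scale _ cv)).
have u01 x : 0 <= u x <= 1.
  have : `|v x / N| <= 1 by rewrite normrM normfV (gtr0_norm N0) ler_pdivrMr// mul1r.
  by rewrite ler_norml /u mulNr mulrC => /andP[h1 h2]; apply/andP; split; lra.
have uE x : (u x < 2^-1) = (0 < v x).
  have : (0 < v x) = (0 < N^-1 * v x) by rewrite pmulr_rgt0// invr_gt0.
  by move=> ->; rewrite /u mulNr; apply/idP/idP => h; lra.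
apply: (trig_lim (M := 1)
    (w_ := fun n x => (1 + -1 * u x ^+ n) ^+ (n * 2 ^ n))) => [n|n x|x].
- apply: trig_closure_exp; apply: trig_add; first exact: trig_const.
  by apply: trig_scale; exact: trig_closure_exp.
- have /andP[h0 h1] := u01 x; rewrite mulN1r normrX exprn_ile1// ger0_norm.
    by rewrite gerBl exprn_ge0.
  by rewrite subr_ge0 exprn_ile1.
- rewrite indicE (_ : (x \in _) = (u x < 2^-1)); last first.
    by rewrite uE; apply/idP/idP; rewrite inE.
  under eq_fun do rewrite mulN1r.
  exact: cvg_step.
Qed.

Local Notation G := (fun A : set torus => trig_closure (\1_A)).

Lemma trig_indic0 : G set0.
Proof. by apply: (trig_closure_ext _ (trig_const 0)) => x; rewrite indic0. Qed.

Lemma trig_indicC A : G A -> G (~` A).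
Proof.
move=> GA; apply: (trig_closure_ext _ (trig_add (trig_const 1) (trig_scale (-1) GA))).
move=> x /=; rewrite !indicE in_setC mulN1r.
by case: (x \in A); rewrite ?subrr ?subr0.
Qed.

Lemma trig_indicI A B : G A -> G B -> G (A `&` B).
Proof.
move=> GA GB; apply: (trig_closure_ext _ (trig_closure_mul GA GB)) => x.
by rewrite indicI.
Qed.

Lemma trig_indicU A B : G A -> G B -> G (A `|` B).
Proof.
move=> GA GB; rewrite -(setCK (A `|` B)) setCU.
by apply: trig_indicC; apply: trig_indicI; exact: trig_indicC.
Qed.

Lemma trig_indic_bigcup (A : nat -> set torus) :
  (forall n, G (A n)) -> G (\bigcup_n A n).
Proof.
move=> GA; pose B n := \big[setU/set0]_(i < n) A i.
have GB n : G (B n).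
  rewrite /B; elim: n => [|n IH]; first by rewrite big_ord0; exact: trig_indic0.
  by rewrite big_ord_recr; exact: trig_indicU.
apply: (trig_lim (M := 1) GB) => [n x|x].
  by rewrite indicE; case: (_ \in _); rewrite ?normr1 ?normr0.
apply: cvg_near_cst; have [[n _ Anx]|nA] := pselect ((\bigcup_n A n) x).
  exists n.+1 => // m /= nm; rewrite !indicE !mem_set//; first by exists n.
  by rewrite /B -bigcup_mkord; exists n.
apply: nearW => n; rewrite !indicE !memNset//.
by rewrite /B -bigcup_mkord => -[k _ Akx]; apply: nA; exists k.
Qed.

Lemma trig_indic_sigma_algebra : sigma_algebra setT G.
Proof.
split; first exact: trig_indic0.
- by move=> A GA; rewrite setTD; exact: trig_indicC.
- exact: trig_indic_bigcup.
Qed.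

Lemma sin_ge0E (t : R) : 0 <= t < 2 * pi -> (0 <= sin t) = (t <= pi).
Proof.
move=> /andP[t0 t2]; have [tp|tp] := leP t pi; first by rewrite sin_ge0_pi// t0.
apply/negbTE; rewrite -ltNge -(subrK pi t) sinDpi oppr_lt0 sin_gt0_pi//.
by rewrite subr_gt0 tp/=; lra.
Qed.

Lemma lt_cosE (t c : R) : 0 <= t < 2 * pi -> 0 < c < 2 * pi ->
  (t < c) = if c <= pi then (0 <= sin t) && (cos c < cos t)
            else (0 <= sin t) || (cos t < cos c).
Proof.
move=> t02 /andP[c0 c2]; have /andP[t0 t2] := t02; rewrite sin_ge0E//.
have [cp|cp] := leP c pi; have [tp|tp] := leP t pi => /=.
- by rewrite ltr_cos// in_itv/= ?t0 ?tp ?cp ?(ltW c0).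
- by apply/negbTE; rewrite -leNgt (le_trans cp)// ltW.
- exact: le_lt_trans tp cp.
- have e (s : R) : cos s = cos (2 * pi - s) by rewrite -cosN -cosD_tau; congr cos; ring.
  rewrite (e t) (e c) ltr_cos ?in_itv/=; last 2 first.
  + by apply/andP; split; lra.
  + by apply/andP; split; lra.
  by apply/idP/idP; lra.
Qed.

(** Rays generate the Borel sets of the circle, and a ray is described by sign
    conditions on a sine and a cosine ([lt_cosE]). *)
Lemma trig_indic_ray (p : torus -> circle R) (k m : int) (c : R) :
  (forall x, phase k m x = val (p x)) -> G [set x | c <= val (p x)].
Proof.
move=> pE; have pv x := valP (p x).
have -> : [set x | c <= val (p x)] = ~` [set x | val (p x) < c].
  by apply/seteqP; split=> x /=; rewrite leNgt => /negP.
apply: trig_indicC.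
have [c0|c0] := leP c 0.
  rewrite (_ : [set x | _] = set0); first exact: trig_indic0.
  apply/seteqP; split => // x /= xc; have /andP[h _] := pv x.
  by move: (lt_le_trans xc c0); rewrite ltNge h.
have [c2|c2] := leP (2 * pi) c.
  rewrite (_ : [set x | _] = ~` set0); first exact: trig_indicC trig_indic0.
  apply/seteqP; split => x /= _; first by [].
  by have /andP[_ h] := pv x; exact: lt_le_trans h c2.
have Gs : G [set x | 0 <= sin (phase k m x)].
  rewrite (_ : [set x | _] = ~` [set x | 0 < (-1) * sin (phase k m x)]).
    by apply: trig_indicC; apply: trig_closure_positivity; exact: trig_scale (trig_sin _ _).
  apply/seteqP; split => x /=; first by move=> h; apply/negP; rewrite -leNgt; lra.
  by move/negP; rewrite -leNgt; lra.
have c02 : 0 < c < 2 * pi by rewrite c0.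
have ltE x := lt_cosE (pv x) c02.
have [cp|cp] := leP c pi.
  rewrite (_ : [set x | _] = [set x | 0 <= sin (phase k m x)] `&`
    [set x | 0 < cos (phase k m x) + - cos c]).
    apply: trig_indicI => //; apply: trig_closure_positivity.
    by apply: trig_add; [exact: trig_cos|exact: trig_const].
  apply/seteqP; split => x /=; rewrite ltE cp subr_gt0 pE.
    by move/andP.
  by move=> [-> ->].
rewrite (_ : [set x | _] = [set x | 0 <= sin (phase k m x)] `|`
  [set x | 0 < cos c + (-1) * cos (phase k m x)]).
  apply: trig_indicU => //; apply: trig_closure_positivity.
  by apply: trig_add; [exact: trig_const|apply: trig_scale; exact: trig_cos].
apply/seteqP; split => x /=; rewrite ltE (leNgt c) cp/= mulN1r subr_gt0 pE.
  by move/orP.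
by move=> h; apply/orP.
Qed.

Lemma trig_indic_preimage (p : torus -> circle R) (k m : int) (B : set (circle R)) :
  (forall x, phase k m x = val (p x)) -> measurable B -> G (p @^-1` B).
Proof.
move=> pE [Y mY <-]; rewrite setTI.
pose H : set (set R) := [set Y | G [set x | Y (val (p x))]].
suff : measurable `<=` H by apply.
rewrite [X in X `<=` _]RGenCInfty.measurableE; apply: smallest_sub.
  split => [|A|A].
  - exact: trig_indic0.
  - by rewrite setTD => /trig_indicC.
  - by move=> /trig_indic_bigcup; rewrite /H/=; congr G; apply/seteqP; split.
move=> _ [c ->]; rewrite /H/=.
rewrite (_ : [set x | _] = [set x | c <= val (p x)]); first exact: trig_indic_ray pE.
by apply/seteqP; split => x /=; rewrite in_itv/= andbT.
Qed.

Lemma trig_indic_measurable A : measurable A -> G A.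
Proof.
rewrite measurable_prod_measurableType => mA; move: A mA; apply: smallest_sub.
  exact: trig_indic_sigma_algebra.
move=> _ [A mA [B mB <-]].
rewrite (_ : A `*` B = (fst @^-1` A) `&` (snd @^-1` B)) //.
apply: trig_indicI.
  apply: (@trig_indic_preimage _ 1 0) => // x.
  by rewrite /phase mul1r mul0r addr0.
apply: (@trig_indic_preimage _ 0 1) => // x.
by rewrite /phase mul1r mul0r add0r.
Qed.

(** The function integrates to 0 over every Borel set. *)
Theorem fourier_uniqueness (a : torus -> R) :
  mu.-integrable setT (EFin \o a) ->
  (forall k m, (\int[mu]_x (a x * cos (phase k m x)))%R = 0) ->
  (forall k m, (\int[mu]_x (a x * sin (phase k m x)))%R = 0) ->
  a = (fun=> 0) %[ae mu].
Proof.
move=> ia ac asn.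
have ae0 : ae_eq mu setT (EFin \o a) (cst 0%E).
  apply: integral_ae_eq => // E _ mE.
  have h := trig_closure_integral0 ia ac asn (trig_indic_measurable mE).
  rewrite integral0 integral_mkcond.
  rewrite (eq_integral (EFin \o (fun x => a x * \1_E x))); last first.
    move=> x _; rewrite patchE /= indicE; case: ifPn => xE /=; last by rewrite mulr0.
    by rewrite mulr1.
  rewrite -[LHS]fineK; first by congr EFin; exact: h.
  apply: integrable_fin_num => //.
  apply: (@integrable_mulr_bounded _ _ _ mu _ _ 1) => //.
  by move=> x; rewrite indicE; case: (_ \in _); rewrite ?normr1 ?normr0.
by apply: filterS ae0 => x /(_ I) /= [].
Qed.

End trigonometric_closure.

(** * Averages of a character along the Koopman operator *)

Section lipschitz.
Variable R : realType.

Lemma lipschitz_of_derive (f df : R -> R) (M : R) :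
  (forall x : R, is_derive x 1 f (df x)) -> (forall x, `|df x| <= M) ->
  forall x y, `|f x - f y| <= M * `|x - y|.
Proof.
move=> fd dfM x y; wlog yx : x y / y <= x => [h|].
  have [/h //|/ltW/h] := leP y x.
  by rewrite distrC (distrC y).
have cf : {within `[y, x], continuous f}.
  apply: derivable_within_continuous => z _.
  exact: (@ex_derive _ _ _ _ _ _ _ (fd z)).
have [c _ ->] := MVT_segment yx (fun z _ => fd z) cf.
by rewrite normrM ler_wpM2r.
Qed.

Lemma cos_lipschitz (x y : R) : `|cos x - cos y| <= `|x - y|.
Proof.
rewrite -[leRHS]mul1r; apply: (@lipschitz_of_derive cos (fun x => - sin x)) => z.
by rewrite normrN sin_max.
Qed.

Lemma sin_lipschitz (x y : R) : `|sin x - sin y| <= `|x - y|.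
Proof.
rewrite -[leRHS]mul1r; apply: (@lipschitz_of_derive sin cos) => z.
exact: cos_max.
Qed.

End lipschitz.

Section phase_continuity.
Variable R : realType.
Local Notation torus := (torus R).
Implicit Types (x y : torus) (k m : int).

(** The phase itself jumps when a coordinate crosses the point 0 of the circle,
    but a periodic function of it does not. *)
Lemma phase_lipschitz (f : R -> R) k m x y :
  (forall t, f (t + 2 * pi) = f t) ->
  (forall s t, `|f s - f t| <= `|s - t|) ->
  `|f (phase k m x) - f (phase k m y)| <=
  (`|k%:~R| + `|m%:~R|) * mdist x y.
Proof.
move=> fp fl.
have cd1 := circle_dist_le_mdist1 x y; have cd2 := circle_dist_le_mdist2 x y.
have per (l : int) (c : R) t : f (l%:~R * (t + 2 * pi) + c) = f (l%:~R * t + c).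
  rewrite (_ : _ + c = l%:~R * t + c + 2 * pi * l%:~R); last by ring.
  by rewrite periodic_int.
have lip (l : int) (c : R) s t :
    `|f (l%:~R * s + c) - f (l%:~R * t + c)| <= `|l%:~R| * `|s - t|.
  rewrite (le_trans (fl _ _))// -normrM le_eqVlt; apply/orP; left; apply/eqP.
  by congr `|_|; ring.
have h1 : `|f (phase k m x) - f (phase k m (y.1, x.2))| <= `|k%:~R| * mdist x y.
  rewrite /phase/=; apply: le_trans (ler_wpM2l (normr_ge0 _) cd1).
  apply: (@periodic_lipschitz R (fun t => f (k%:~R * t + m%:~R * val x.2))) => *.
    exact: per.
  exact: lip.
have h2 : `|f (phase k m (y.1, x.2)) - f (phase k m y)| <= `|m%:~R| * mdist x y.
  rewrite /phase/=; apply: le_trans (ler_wpM2l (normr_ge0 _) cd2).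
  rewrite ![k%:~R * _ + _]addrC.
  apply: (@periodic_lipschitz R (fun t => f (m%:~R * t + k%:~R * val y.1))) => *.
    exact: per.
  exact: lip.
rewrite mulrDl -(subrK (f (phase k m (y.1, x.2))) (f (phase k m x))) -addrA.
by rewrite (le_trans (ler_normD _ _))// lerD.
Qed.

Lemma cvg_phase (f : R -> R) k m (x_ : nat -> torus) x :
  (forall t, f (t + 2 * pi) = f t) ->
  (forall s t, `|f s - f t| <= `|s - t|) ->
  mdist (x_ n) x @[n --> \oo] --> (0 : R) ->
  f (phase k m (x_ n)) @[n --> \oo] --> f (phase k m x).
Proof.
move=> fp fl xx; apply/cvgrPdist_le => e e0.
have c0 : 0 < `|k%:~R| + `|m%:~R| + 1 :> R by rewrite ltr_wpDl// addr_ge0.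
have /cvgrPdist_le /(_ (e / (`|k%:~R| + `|m%:~R| + 1))) := xx.
rewrite divr_gt0// => /(_ isT); apply: filterS => n.
rewrite sub0r normrN ger0_norm ?mdist_ge0// distrC ler_pdivlMr// => h.
rewrite (le_trans (phase_lipschitz _ _ _ _ fp fl))// (le_trans _ h)//.
by rewrite mulrC ler_wpM2l ?mdist_ge0// lerDl.
Qed.

End phase_continuity.

Section hull.
Variable R : realType.
Local Notation torus := (torus R).
Local Notation mu := (torus_measure R).
Local Notation C := (R[i]).
Local Notation Re := (@complex.Re R).
Local Notation Im := (@complex.Im R).
Import Normc.
Implicit Types (k m : int) (x : torus) (F : torus -> torus) (lambda : C).

Lemma Re_mulc (z w : C) : Re (z * w) = Re z * Re w - Im z * Im w.
Proof. by case: z w => a b [c d]. Qed.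

Lemma Im_mulc (z w : C) : Im (z * w) = Re z * Im w + Im z * Re w.
Proof. by case: z w => a b [c d]. Qed.

Lemma normc_sqrE (z : C) : normc z ^+ 2 = Re z ^+ 2 + Im z ^+ 2.
Proof. by case: z => a b; rewrite /= sqr_sqrtr// addr_ge0 ?sqr_ge0. Qed.

Definition character k m x : C := Complex (cos (phase k m x)) (sin (phase k m x)).

(** Formal expressions for the averages of the orbit of a character. Repeated
    midpoints give a dense set of convex combinations, and they are what the
    parallelogram identity speaks of. Keeping the syntax apart from the function
    that it denotes lets F and lambda vary for a fixed expression. *)
Inductive average := Seed | Shift of average | Mid of average & average.

Fixpoint avg F lambda k m (t : average) : torus -> C :=
  match t with
  | Seed => character k m
  | Shift t => fun x => lambda * avg F lambda k m t (F x)
  | Mid s t => fun x =>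
     let z := avg F lambda k m s x in let w := avg F lambda k m t x in
     Complex (2^-1 * (Re z + Re w)) (2^-1 * (Im z + Im w))
  end.

Definition energy (g : torus -> C) : R :=
  (\int[mu]_x (Re (g x) ^+ 2 + Im (g x) ^+ 2))%R.

Lemma avg_measurable F lambda k m t : measurable_fun setT F ->
  measurable_fun setT (Re \o avg F lambda k m t) /\
  measurable_fun setT (Im \o avg F lambda k m t).
Proof.
move=> mF; elim: t => [|t [mr mi]|s [mr mi] t [mr' mi']] /=.
- by split; [exact: measurable_cos_phase|exact: measurable_sin_phase].
- have mr' := measurableT_comp mr mF; have mi' := measurableT_comp mi mF.
  split.
    rewrite (_ : Re \o _ = (fun x => Re lambda * ((Re \o avg F lambda k m t) \o F) x
       + - Im lambda * ((Im \o avg F lambda k m t) \o F) x)); last first.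
      by apply/funext => x /=; rewrite Re_mulc mulNr.
    exact: measurable_combination.
  rewrite (_ : Im \o _ = (fun x => Re lambda * ((Im \o avg F lambda k m t) \o F) x
       + Im lambda * ((Re \o avg F lambda k m t) \o F) x)); last first.
    by apply/funext => x /=; rewrite Im_mulc.
  exact: measurable_combination.
- split.
    rewrite (_ : Re \o _ = (fun x => 2^-1 * (Re \o avg F lambda k m s) x
       + 2^-1 * (Re \o avg F lambda k m t) x)); last first.
      by apply/funext => x /=; rewrite mulrDr.
    exact: measurable_combination.
  rewrite (_ : Im \o _ = (fun x => 2^-1 * (Im \o avg F lambda k m s) x
       + 2^-1 * (Im \o avg F lambda k m t) x)); last first.
    by apply/funext => x /=; rewrite mulrDr.
  exact: measurable_combination.
Qed.

Lemma midpoint_sqr (a b c d : R) :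
  (2^-1 * (a + c)) ^+ 2 + (2^-1 * (b + d)) ^+ 2 =
  2^-1 * (a ^+ 2 + b ^+ 2) + 2^-1 * (c ^+ 2 + d ^+ 2)
  - 4^-1 * ((a - c) ^+ 2 + (b - d) ^+ 2).
Proof. by field. Qed.

(** The unit disc is convex and invariant under rotation by lambda. *)
Lemma avg_le1 F lambda k m t x : normc lambda = 1 ->
  Re (avg F lambda k m t x) ^+ 2 + Im (avg F lambda k m t x) ^+ 2 <= 1.
Proof.
move=> l1; elim: t x => [|t IH|s IHs t IHt] x /=.
- by rewrite cos2Dsin2.
- by rewrite -normc_sqrE normcM l1 mul1r normc_sqrE.
- have := IHs x; have := IHt x.
  rewrite midpoint_sqr.
  set c := (X in 4^-1 * X); have : 0 <= c by rewrite addr_ge0 ?sqr_ge0.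
  lra.
Qed.

Lemma sqr_le1_norm (a b : R) : a ^+ 2 + b ^+ 2 <= 1 -> `|a| <= 1 /\ `|b| <= 1.
Proof.
by move=> h; split; rewrite -(@ler_pXn2r _ 2)// ?nnegrE// expr1n real_normK ?num_real//;
  nra.
Qed.

Lemma Rintegral_measure_preserving F (f : torus -> R) : measure_preserving F ->
  mu.-integrable setT (EFin \o f) ->
  mu.-integrable setT (EFin \o (f \o F)) /\
  (\int[mu]_x f (F x))%R = (\int[mu]_x f x)%R.
Proof.
by move=> [mF muF] fi; exact: (@integral_invariant _ _ _ mu).
Qed.

Lemma energy_shift F lambda k m t : measure_preserving F -> normc lambda = 1 ->
  energy (avg F lambda k m (Shift t)) = energy (avg F lambda k m t).
Proof.
move=> mpF l1; have [mF _] := mpF; have [mr mi] := avg_measurable lambda k m t mF.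
rewrite /energy -[RHS](Rintegral_measure_preserving mpF _).2; last first.
  apply: (@integrable_bounded _ _ _ mu _ 1).
    exact: measurable_sumsq.
  by move=> x; rewrite ger0_norm ?addr_ge0 ?sqr_ge0// avg_le1.
apply: eq_Rintegral => x _; rewrite -!normc_sqrE /= normcM l1 mul1r.
by [].
Qed.

Lemma energy_integrable F lambda k m t : measurable_fun setT F -> normc lambda = 1 ->
  mu.-integrable setT (EFin \o (fun x => Re (avg F lambda k m t x) ^+ 2 +
                                         Im (avg F lambda k m t x) ^+ 2)).
Proof.
move=> mF l1; have [mr mi] := avg_measurable lambda k m t mF.
apply: (@integrable_bounded _ _ _ mu _ 1).
  exact: measurable_sumsq.
by move=> x; rewrite ger0_norm ?addr_ge0 ?sqr_ge0// avg_le1.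
Qed.

Lemma L2_integrable (g : torus -> C) : L2 g ->
  [/\ mu.-integrable setT (EFin \o (Re \o g)),
      mu.-integrable setT (EFin \o (Im \o g)) &
      mu.-integrable setT (EFin \o (fun x => Re (g x) ^+ 2 + Im (g x) ^+ 2))].
Proof.
move=> [mr mi fin].
have msq : measurable_fun setT (fun x => Re (g x) ^+ 2 + Im (g x) ^+ 2).
  exact: measurable_sumsq.
have isq : mu.-integrable setT (EFin \o (fun x => Re (g x) ^+ 2 + Im (g x) ^+ 2)).
  apply/integrableP; split; first exact/measurable_EFinP.
  move: fin; rewrite /sqnorm; congr (_ < _)%E; apply: eq_integral => x _.
  by rewrite normc_sqrE gee0_abs// lee_fin addr_ge0 ?sqr_ge0.
have i1 : mu.-integrable setT (EFin \o (fun x =>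
    (fun x => Re (g x) ^+ 2 + Im (g x) ^+ 2) x + 1)).
  by apply: integrable_addr => //; exact: finite_measure_integrable_cst.
have bnd (h : torus -> R) : measurable_fun setT h ->
    (forall x, h x ^+ 2 <= Re (g x) ^+ 2 + Im (g x) ^+ 2) ->
    mu.-integrable setT (EFin \o h).
  move=> mh hg; apply: (@le_integrable _ _ _ mu setT measurableT) i1.
    exact/measurable_EFinP.
  move=> x _ /=; rewrite lee_fin.
  have := hg x; rewrite -(real_normK (num_real (h x))).
  have : 0 <= (`|h x| - 1) ^+ 2 by exact: sqr_ge0.
  set a := `|h x|; set b := Re _ ^+ 2 + _ => h1 h2.
  have a0 : 0 <= a by exact: normr_ge0.
  rewrite (le_trans _ (ler_norm _))//; nra.
split => //; apply: bnd => // x; rewrite ?lerDl ?lerDr sqr_ge0//.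
Qed.

(** The real part of the bilinear pairing, the integral of g h. *)
Definition pairing (g h : torus -> C) : R :=
  (\int[mu]_x (Re (g x) * Re (h x) - Im (g x) * Im (h x)))%R.

Lemma pairing_integrable (g h : torus -> C) (M : R) : L2 g ->
  measurable_fun setT (Re \o h) -> measurable_fun setT (Im \o h) ->
  (forall x, `|Re (h x)| <= M) -> (forall x, `|Im (h x)| <= M) ->
  mu.-integrable setT
    (EFin \o (fun x => Re (g x) * Re (h x) - Im (g x) * Im (h x))).
Proof.
move=> /L2_integrable [ir ii _] mr mi rM iM.
have ir' := @integrable_mulr_bounded _ _ _ mu (Re \o g) _ _ ir mr rM.
have ii' := @integrable_mulr_bounded _ _ _ mu (Im \o g) _ _ ii mi iM.
exact: integrable_subr ir' ii'.
Qed.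

(** The key invariance: lambda * g = g o F almost everywhere, hence the integral
    of g * lambda * (h o F) is that of (g h) o F, and F preserves the measure. *)
Lemma pairing_shift F lambda (g h : torus -> C) (M : R) :
  measure_preserving F -> L2 g ->
  koopman F g = (fun x => lambda * g x) %[ae mu] ->
  measurable_fun setT (Re \o h) -> measurable_fun setT (Im \o h) ->
  (forall x, `|Re (h x)| <= M) -> (forall x, `|Im (h x)| <= M) ->
  pairing g (fun x => lambda * h (F x)) = pairing g h.
Proof.
move=> mpF Lg gF mr mi rM iM; have [mF muF] := mpF.
have i1 := pairing_integrable Lg mr mi rM iM.
rewrite /pairing; have [i2 <-] := Rintegral_measure_preserving mpF i1.
have N0 : 0 <= `|M| by [].
have hb (a b : R) z : `|a * Re (h z) + b * Im (h z)| <= (`|a| + `|b|) * M.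
  by rewrite (le_trans (ler_normD _ _))// !normrM mulrDl lerD// ler_wpM2l.
have i3 : mu.-integrable setT (EFin \o (fun x => Re (g x) * Re (lambda * h (F x))
     - Im (g x) * Im (lambda * h (F x)))).
  apply: (@pairing_integrable _ (fun x => lambda * h (F x))
    ((`|Re lambda| + `|Im lambda|) * M)) => //.
  - rewrite (_ : Re \o _ = (fun x => Re lambda * ((Re \o h) \o F) x
       + - Im lambda * ((Im \o h) \o F) x)); last first.
      by apply/funext => x /=; rewrite Re_mulc mulNr.
    exact: measurable_combination (measurableT_comp mr mF) (measurableT_comp mi mF).
  - rewrite (_ : Im \o _ = (fun x => Re lambda * ((Im \o h) \o F) x
       + Im lambda * ((Re \o h) \o F) x)); last first.
      by apply/funext => x /=; rewrite Im_mulc.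
    exact: measurable_combination (measurableT_comp mi mF) (measurableT_comp mr mF).
  - move=> x; rewrite Re_mulc -mulNr (le_trans (hb _ _ _))//.
    by rewrite normrN.
  - by move=> x; rewrite Im_mulc addrC (le_trans (hb _ _ _))// addrC.
rewrite /pairing /Rintegral; congr fine; apply: ae_eq_integral => //.
- exact: measurable_int i3.
- exact: measurable_int i2.
apply: filterS gF => x /(_ I); rewrite /koopman /= => gFx _; congr EFin.
by rewrite gFx !Re_mulc !Im_mulc; ring.
Qed.

Lemma pairing_avg F lambda k m (g : torus -> C) t :
  measure_preserving F -> normc lambda = 1 -> L2 g ->
  koopman F g = (fun x => lambda * g x) %[ae mu] ->
  pairing g (avg F lambda k m t) = pairing g (character k m).
Proof.
move=> mpF l1 Lg gF; have [mF _] := mpF.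
have b1 t' x := sqr_le1_norm (avg_le1 F k m t' x l1).
elim: t => [//|t IH|s IHs t IHt].
- have [mr mi] := avg_measurable lambda k m t mF.
  rewrite -IH; apply: (@pairing_shift _ _ _ _ 1) => // x.
    by case: (b1 t x).
  by case: (b1 t x).
- have [mr mi] := avg_measurable lambda k m t mF.
  have [mr' mi'] := avg_measurable lambda k m s mF.
  have is_ := @pairing_integrable g _ 1 Lg mr' mi' (fun x => (b1 s x).1) (fun x => (b1 s x).2).
  have it := @pairing_integrable g _ 1 Lg mr mi (fun x => (b1 t x).1) (fun x => (b1 t x).2).
  transitivity (2^-1 * (pairing g (avg F lambda k m s) + pairing g (avg F lambda k m t))).
    rewrite /pairing -RintegralD// -RintegralZl//; last exact: integrable_addr is_ it.
    by apply: eq_Rintegral => x _ /=; ring.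
  by rewrite IHs IHt; lra.
Qed.

(** All averages have the same pairing l with g, so that their norms are bounded
    below by the Cauchy-Schwarz inequality, in the form
    2 s l <= energy h + s ^ 2 energy g with s = l / (energy g + 1). *)
Lemma energy_ge_pairing F lambda k m (g : torus -> C) :
  measure_preserving F -> normc lambda = 1 -> L2 g ->
  koopman F g = (fun x => lambda * g x) %[ae mu] ->
  pairing g (character k m) != 0 ->
  exists2 d : R, 0 < d & forall t, d <= energy (avg F lambda k m t).
Proof.
move=> mpF l1 Lg gF l0; have [mF _] := mpF.
have [_ _ isq] := L2_integrable Lg.
set l := pairing g (character k m) in l0 *.
pose n2 : R := energy g.
have n20 : 0 <= n2 by apply: Rintegral_ge0 => x _; rewrite addr_ge0 ?sqr_ge0.
pose s := l / (n2 + 1); have n1 : 0 < n2 + 1 by rewrite ltr_wpDl.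
(* the denominator n2 + 1 avoids the case n2 = 0 *)
exists (l ^+ 2 / (n2 + 1)); first by rewrite divr_gt0// exprn_even_gt0.
move=> t; have b1 x := sqr_le1_norm (avg_le1 F k m t x l1).
have [mr mi] := avg_measurable lambda k m t mF.
have ip := @pairing_integrable g _ 1 Lg mr mi (fun x => (b1 x).1) (fun x => (b1 x).2).
have ie := energy_integrable k m t mF l1.
have key : 2 * s * l <= energy (avg F lambda k m t) + s ^+ 2 * n2.
  rewrite /l -(pairing_avg k m t mpF l1 Lg gF) /pairing /n2 /energy.
  have is2 : mu.-integrable setT (EFin \o (fun x => s ^+ 2 * (Re (g x) ^+ 2 + Im (g x) ^+ 2))).
    exact: integrable_scaler isq.
  rewrite -RintegralZl// -RintegralZl// -RintegralD//.
  apply: le_Rintegral => //.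
  - exact: integrable_scaler ip.
  - exact: integrable_addr ie is2.
  - move=> x _; set a := Re (g x); set b := Im (g x); set u := Re _; set v := Im _.
    rewrite -subr_ge0; have := addr_ge0 (sqr_ge0 (u - s * a)) (sqr_ge0 (v + s * b)).
    by congr (_ <= _); ring.
have e : 2 * s * l = 2 * (l ^+ 2 / (n2 + 1)) by rewrite /s; ring.
have e2 : s ^+ 2 * n2 <= l ^+ 2 / (n2 + 1).
  rewrite /s expr_div_n -mulrA ler_wpM2l ?sqr_ge0//.
  rewrite expr2 invfM -mulrA ler_piMr ?invr_ge0 ?(ltW n1)//.
  by rewrite mulrC ler_pdivrMr// mul1r lerDl.
rewrite -[X in X <= _](addrK (l ^+ 2 / (n2 + 1))) -mulr2n -mulr_natl -e.
by rewrite lerBlDr (le_trans key)// lerD2l.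
Qed.

Lemma L2_mulI (g : torus -> C) : L2 g -> L2 (fun x => Complex 0 1 * g x).
Proof.
move=> [mr mi fin]; split.
- rewrite (_ : (fun x => _) = (fun x => - Im (g x))).
    exact: measurable_funN.
  by apply/funext => x; case: (g x) => a b /=; ring.
- rewrite (_ : (fun x => _) = (fun x => Re (g x))) //.
  by apply/funext => x; case: (g x) => a b /=; ring.
- move: fin; rewrite /sqnorm; congr (_ < _)%E; apply: eq_integral => x _.
  rewrite !normc_sqrE; case: (g x) => a b /=; congr EFin; ring.
Qed.

(** If no character had averages of energy bounded below, the real parts of the
    integrals of g e and of i g e would vanish for all characters e
    ([energy_ge_pairing]), hence all Fourier coefficients of g, hence g. *)
Theorem eigenvalue_energy F lambda : measure_preserving F -> Defs.eigenvalue F lambda ->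
  exists k m, exists2 d : R, 0 < d & forall t, d <= energy (avg F lambda k m t).
Proof.
move=> mpF ev; have l1 := eigenvalue_normc mpF ev.
have [g [Lg g0 gF]] := ev; have [ir ii _] := L2_integrable Lg.
pose ig x : C := Complex 0 1 * g x.
have LI : L2 ig by exact: L2_mulI.
have IF : koopman F ig = (fun x => lambda * ig x) %[ae mu].
  apply: filterS gF => x /(_ I) + _; rewrite /koopman /= /ig => ->.
  by rewrite mulrCA.
apply: contrapT => nex; apply: g0.
have p0 k m : pairing g (character k m) = 0.
  apply/eqP; apply: contrapT => /negP pg0; apply: nex; exists k, m.
  exact: energy_ge_pairing pg0.
have q0 k m : pairing ig (character k m) = 0.
  apply/eqP; apply: contrapT => /negP pg0; apply: nex; exists k, m.
  exact: energy_ge_pairing pg0.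
have mc k m : measurable_fun setT (cos \o phase k m : torus -> R) by exact: measurable_cos_phase.
have ms k m : measurable_fun setT (sin \o phase k m : torus -> R) by exact: measurable_sin_phase.
have irc k m := @integrable_mulr_bounded _ _ _ mu (Re \o g) _ 1 ir (mc k m) (fun x => cos_max _).
have iis k m := @integrable_mulr_bounded _ _ _ mu (Im \o g) _ 1 ii (ms k m) (fun x => sin_max _).
have irs k m := @integrable_mulr_bounded _ _ _ mu (Re \o g) _ 1 ir (ms k m) (fun x => sin_max _).
have iic k m := @integrable_mulr_bounded _ _ _ mu (Im \o g) _ 1 ii (mc k m) (fun x => cos_max _).
have phaseN k m x : phase (- k) (- m) x = - phase k m x :> R.
  by rewrite /phase !mulrNz; ring.
have e1 k m : (\int[mu]_x (Re (g x) * cos (phase k m x)))%R =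
              (\int[mu]_x (Im (g x) * sin (phase k m x)))%R.
  have := p0 k m; rewrite /pairing => /=.
  by rewrite (RintegralB measurableT (irc k m) (iis k m)) => /subr0_eq.
have e2 k m : (\int[mu]_x (Im (g x) * cos (phase k m x)))%R =
              - (\int[mu]_x (Re (g x) * sin (phase k m x)))%R.
  apply/eqP; rewrite -addr_eq0 -(RintegralD measurableT (iic k m) (irs k m)); apply/eqP.
  apply: oppr_inj; rewrite oppr0 -[RHS](q0 k m) -mulN1r -RintegralZl//; last first.
    exact: integrable_addr (iic k m) (irs k m).
  apply: eq_Rintegral => x _; rewrite /ig /character Re_mulc Im_mulc /=; ring.
have flip_c (h : torus -> R) k m : (\int[mu]_x (h x * cos (phase (- k) (- m) x)))%R =
    (\int[mu]_x (h x * cos (phase k m x)))%R.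
  by apply: eq_Rintegral => x _; rewrite phaseN cosN.
have flip_s (h : torus -> R) k m : mu.-integrable setT (EFin \o (fun x => h x * sin (phase k m x))) ->
    (\int[mu]_x (h x * sin (phase (- k) (- m) x)))%R =
    - (\int[mu]_x (h x * sin (phase k m x)))%R.
  move=> ih; rewrite -[RHS]mulN1r -RintegralZl//.
  by apply: eq_Rintegral => x _; rewrite phaseN sinN; ring.
have rc k m : (\int[mu]_x (Re (g x) * cos (phase k m x)))%R = 0.
  have := e1 (- k) (- m); rewrite flip_c flip_s//; last exact: iis.
  by rewrite -e1 => h; lra.
have ic k m : (\int[mu]_x (Im (g x) * cos (phase k m x)))%R = 0.
  have := e2 (- k) (- m); rewrite flip_c flip_s//; last exact: irs.
  by rewrite opprK => h; have := e2 k m; lra.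
have rs k m : (\int[mu]_x (Re (g x) * sin (phase k m x)))%R = 0.
  by have := e2 k m; rewrite ic => /eqP; rewrite eq_sym oppr_eq0 => /eqP.
have is_ k m : (\int[mu]_x (Im (g x) * sin (phase k m x)))%R = 0.
  by rewrite -e1 rc.
have r0 := fourier_uniqueness ir rc rs.
have i0 := fourier_uniqueness ii ic is_.
apply: filterS2 r0 i0 => x /(_ I) rx /(_ I) ix _.
by move: rx ix => /=; case: (g x) => a b /= -> ->.
Qed.

End hull.

(** * From averages of large energy to eigenfunctions *)

Section fast_convergence.
Context d (T : measurableType d) (R : realType) (mu : probability T R).
Implicit Types (u : nat -> T -> R).

Lemma sum_geometric_half (n : nat) : \sum_(i < n) 2 ^- i <= 2 :> R.
Proof.
suff -> : \sum_(i < n) 2 ^- i = 2 - 2 * 2 ^- n :> R.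
  by rewrite gerBl mulr_ge0// invr_ge0 exprn_ge0.
elim: n => [|n IH]; first by rewrite big_ord0 expr0 invr1; lra.
by rewrite big_ord_recr /= IH exprS invfM; lra.
Qed.

(** From 2 a <= t a ^ 2 + 1 / t; the parameter t is chosen below so as to balance
    the two terms. *)
Lemma Rintegral_abs_le_sqr (h : T -> R) (M t : R) : measurable_fun setT h ->
  (forall x, `|h x| <= M) -> 0 < t ->
  (\int[mu]_x `|h x|)%R <= 2^-1 * (t * (\int[mu]_x (h x ^+ 2))%R + t^-1).
Proof.
move=> mh hM t0.
have ih := integrable_bounded mu mh hM.
have ia : mu.-integrable setT (EFin \o (fun x => `|h x|)).
  apply: (integrable_bounded mu (M := M)) => [|x]; last by rewrite normr_id.
  exact: measurableT_comp.
have i2 : mu.-integrable setT (EFin \o (fun x => h x ^+ 2)).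
  apply: (integrable_bounded mu (M := M ^+ 2)) => [|x]; first exact: measurable_funX.
  by rewrite normrX; apply: lerXn2r; rewrite ?nnegrE// (le_trans _ (hM x)).
have i1 : mu.-integrable setT (EFin \o (fun=> t^-1 : R)).
  exact: finite_measure_integrable_cst.
have i3 := integrable_addr (integrable_scaler t i2) i1.
have -> : 2^-1 * (t * (\int[mu]_x (h x ^+ 2))%R + t^-1) =
    (\int[mu]_x (2^-1 * (t * h x ^+ 2 + t^-1)))%R.
  rewrite RintegralZl// RintegralD//; last exact: integrable_scaler.
  have p1 : fine (mu setT) = 1 by rewrite probability_setT.
  by rewrite RintegralZl// (Rintegral_cst mu measurableT) p1 mulr1.
apply: le_Rintegral => //; first exact: integrable_scaler.
move=> x _; rewrite -(real_normK (num_real (h x))); set a := `|h x|.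
have : 0 <= t * (a - t^-1) ^+ 2 by rewrite mulr_ge0 ?sqr_ge0 ?ltW.
rewrite (_ : t * (a - t^-1) ^+ 2 = t * a ^+ 2 - 2 * a * (t * t^-1) + t^-1 * (t * t^-1)); last by ring.
by rewrite mulfV ?gt_eqF//; lra.
Qed.

Lemma Rintegral_eq0_ae (h : T -> R) : (forall x, 0 <= h x) ->
  mu.-integrable setT (EFin \o h) -> (\int[mu]_x h x)%R = 0 ->
  {ae mu, forall x, h x = 0}.
Proof.
move=> h0 ih e0; have mh := measurable_int _ ih.
have i0 : (\int[mu]_x `|(EFin \o h) x| = 0)%E.
  rewrite (eq_integral (EFin \o h)); last first.
    by move=> x _; rewrite gee0_abs// lee_fin.
  by rewrite -[LHS]fineK ?(integrable_fin_num _ ih)//; congr EFin.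
have := (ae_eq_integral_abs mu measurableT mh).1 i0.
by apply: filterS => x /(_ I) [].
Qed.

(** Completeness of L^2 for sequences that converge fast: the integrals of the
    absolute increments are summable, so the sum of the increments is finite
    almost everywhere. *)
Lemma ae_cvg_fast u :
  (forall n, measurable_fun setT (u n)) -> (forall n x, `|u n x| <= 1) ->
  (forall n, (\int[mu]_x ((u n.+1 x - u n x) ^+ 2))%R <= 4 * 4 ^- n) ->
  exists v : T -> R, [/\ measurable_fun setT v, (forall x, `|v x| <= 1) &
     {ae mu, forall x, u n x @[n --> \oo] --> v x}].
Proof.
move=> mu_ u1 ud; pose dd n x := u n.+1 x - u n x.
have mdd n : measurable_fun setT (dd n) by exact: measurable_funB.
have dd2 n x : `|dd n x| <= 2.
  by rewrite (le_trans (ler_normB _ _))// (_ : 2 = 1 + 1)// lerD.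
have madd n : measurable_fun setT (fun x => `|dd n x|%:E).
  by apply/measurable_EFinP; exact: measurableT_comp.
have iadd n : mu.-integrable setT (EFin \o (fun x => `|dd n x|)).
  apply: (integrable_bounded mu (M := 2)) => [|x]; last by rewrite normr_id.
  exact: measurableT_comp.
have bnd n : (\int[mu]_x `|dd n x|)%R <= 5 / 2 * 2 ^- n.
  have p2 : 0 < 2 ^+ n :> R by rewrite exprn_gt0.
  rewrite (le_trans (Rintegral_abs_le_sqr (mdd n) (dd2 n) p2))//.
  have : 2 ^+ n * (\int[mu]_x (dd n x ^+ 2))%R <= 2 ^+ n * (4 * 4 ^- n).
    by rewrite ler_wpM2l ?(ltW p2)//; exact: ud.
  have -> : 2 ^+ n * (4 * 4 ^- n) = 4 * 2 ^- n :> R.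
    rewrite (_ : 4 = 2 * 2 :> R); last by lra.
    by rewrite exprMn; field; rewrite gt_eqF.
  lra.
pose S x := (\sum_(0 <= n <oo) `|dd n x|%:E)%E.
have S0 x : (0 <= S x)%E by apply: nneseries_ge0 => n _ _; rewrite lee_fin.
have iS : mu.-integrable setT S.
  apply/integrableP; split.
    exact: ge0_emeasurable_sum.
  under eq_integral do rewrite gee0_abs//.
  rewrite integral_nneseries//.
  apply: (@le_lt_trans _ _ 5%:E); last exact: ltry.
  apply: lime_le.
    apply: is_cvg_nneseries => n _ _; apply: integral_ge0 => x _; by rewrite lee_fin.
  apply: nearW => n.
  rewrite (eq_bigr (fun i => ((\int[mu]_x `|dd i x|)%R)%:E)); last first.
    by move=> i _; rewrite /Rintegral fineK//; exact: (integrable_fin_num measurableT (iadd i)).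
  rewrite sumEFin lee_fin big_mkord.
  apply: (@le_trans _ _ (\sum_(i < n) 5 / 2 * 2 ^- i)); first exact: ler_sum.
  by rewrite -mulr_sumr; have := sum_geometric_half n; lra.
have cvg_ae : {ae mu, forall x, cvg (u n x @[n --> \oo])}.
  apply: filterS (integrable_ae measurableT iS) => x /(_ I) Sfin.
  have cd : cvgn (series (fun n => dd n x)).
    apply: normed_cvg; apply: nondecreasing_is_cvgn.
      by apply: nondecreasing_series => n *; exact: normr_ge0.
    exists (fine (S x)) => _ [n _ <-]; rewrite -lee_fin fineK//.
    rewrite /series/= -sumEFin; apply: nneseries_lim_ge => i _ _.
    by rewrite lee_fin.
  rewrite (_ : u ^~ x = (fun n => u 0%N x + series (fun n => dd n x) n)).
    by apply: is_cvgD => //; exact: is_cvg_cst.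
  apply/funext => n; exact: (eq_sum_telescope (u ^~ x) n).
(* outside a measurable null set, so that the limit is measurable everywhere *)
have [N [mN N0 PN]] := cvg_ae.
pose u' n x := u n x * \1_(~` N) x.
have cu' x : cvg (u' n x @[n --> \oo]).
  rewrite /u'; have [xN|xN] := pselect (N x).
    rewrite (_ : (fun n => _) = (fun=> 0)); first exact: is_cvg_cst.
    by apply/funext => n; rewrite indicE memNset ?mulr0//; apply.
  apply: is_cvgM; last exact: is_cvg_cst.
  by apply: contrapT => h; apply: xN; exact: PN.
have u'1 n x : `|u' n x| <= 1.
  rewrite normrM -[leRHS]mulr1 ler_pM// indicE.
  by case: (_ \in _); rewrite ?normr1 ?normr0.
exists (fun x => lim (u' n x @[n --> \oo])); split.
- apply: (measurable_fun_cvg (h := u')) => // n.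
  apply: measurable_funM => //; apply: measurable_indic; exact: measurableC.
- by move=> x; apply: cvg_norm_le (cu' x) _ => n.
- exists N; split => // x /= h; apply: contrapT => xN; apply: h.
  have -> : u ^~ x = u' ^~ x.
    by apply/funext => n; rewrite /u' indicE mem_set// mulr1.
  exact: cu'.
Qed.

End fast_convergence.

Lemma cvg_sqr (R : realType) (u : nat -> R) (l : R) :
  u n @[n --> \oo] --> l -> (u n ^+ 2) @[n --> \oo] --> l ^+ 2.
Proof. by move=> ul; rewrite expr2; apply: cvgM. Qed.

Section hull_limit.
Variable R : realType.
Local Notation torus := (torus R).
Local Notation mu := (torus_measure R).
Local Notation C := (R[i]).
Local Notation Re := (@complex.Re R).
Local Notation Im := (@complex.Im R).
Import Normc.
Implicit Types (k m : int) (x : torus) (F : torus -> torus) (lambda : C).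

Definition energy_gap F lambda k m s t : R := (\int[mu]_x (
  (Re (avg F lambda k m s x) - Re (avg F lambda k m t x)) ^+ 2 +
  (Im (avg F lambda k m s x) - Im (avg F lambda k m t x)) ^+ 2))%R.

Lemma sumsq_bounded (a b c d : R) : `|a| <= 1 -> `|b| <= 1 -> `|c| <= 1 -> `|d| <= 1 ->
  `|(a - b) ^+ 2 + (c - d) ^+ 2| <= 8.
Proof.
move=> ha hb hc hd; rewrite ger0_norm ?addr_ge0 ?sqr_ge0//.
have h (e f : R) : `|e| <= 1 -> `|f| <= 1 -> (e - f) ^+ 2 <= 4.
  move=> e1 f1; rewrite -(real_normK (num_real (e - f))).
  have : `|e - f| <= 2 by rewrite (le_trans (ler_normB _ _))// (_ : 2 = 1 + 1)// lerD.
  by have := normr_ge0 (e - f); nra.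
by have := h _ _ ha hb; have := h _ _ hc hd; lra.
Qed.

Lemma energy_gap_integrable F lambda k m s t :
  measurable_fun setT F -> normc lambda = 1 ->
  mu.-integrable setT (EFin \o (fun x =>
  (Re (avg F lambda k m s x) - Re (avg F lambda k m t x)) ^+ 2 +
  (Im (avg F lambda k m s x) - Im (avg F lambda k m t x)) ^+ 2)).
Proof.
move=> mF l1.
have [mr mi] := avg_measurable lambda k m t mF.
have [mr' mi'] := avg_measurable lambda k m s mF.
apply: (integrable_bounded mu (M := 8)) => [|x].
  by apply: measurable_sumsq; exact: measurable_funB.
have [? ?] := sqr_le1_norm (avg_le1 F k m t x l1).
have [? ?] := sqr_le1_norm (avg_le1 F k m s x l1).
exact: sumsq_bounded.
Qed.

(** The parallelogram identity. *)
Lemma energy_gapE F lambda k m s t : measurable_fun setT F -> normc lambda = 1 ->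
  energy_gap F lambda k m s t =
  2 * energy (avg F lambda k m s) + 2 * energy (avg F lambda k m t)
  - 4 * energy (avg F lambda k m (Mid s t)).
Proof.
move=> mF l1.
have is_ := energy_integrable k m s mF l1.
have it := energy_integrable k m t mF l1.
have im := energy_integrable k m (Mid s t) mF l1.
rewrite /energy /energy_gap -!RintegralZl// -RintegralD//; try exact: integrable_scaler.
rewrite -RintegralB//; last 2 first.
- exact: integrable_addr (integrable_scaler 2 is_) (integrable_scaler 2 it).
- by apply: integrable_scaler; exact: im.
by apply: eq_Rintegral => x _ /=; rewrite midpoint_sqr; lra.
Qed.

Section minimizing.
Variables (F : torus -> torus) (lambda : C) (k m : int) (delta : R).
Hypothesis mpF : measure_preserving F.
Hypothesis l1 : normc lambda = 1.
Hypothesis delta0 : 0 < delta.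
Hypothesis energy_ge : forall t, delta <= energy (avg F lambda k m t).

Let mF : measurable_fun setT F. Proof. by case: mpF. Qed.
Let a := avg F lambda k m.
Let inf_energy := inf (range (fun t => energy (a t))).

Let has_inf_energy : has_inf (range (fun t => energy (a t))).
Proof.
split; first by exists (energy (a Seed)), Seed.
by exists delta => _ [t _ <-]; exact: energy_ge.
Qed.

Let inf_le t : inf_energy <= energy (a t).
Proof. by apply: ge_inf; [case: has_inf_energy|exists t]. Qed.

Let minimizer : {t : nat -> average | forall n, energy (a (t n)) < inf_energy + 4 ^- n}.
Proof.
have H n : exists t, energy (a t) < inf_energy + 4 ^- n.
  have e0 : 0 < 4 ^- n :> R by rewrite invr_gt0 exprn_gt0.
  by have [_ [t _ <-] h] := inf_adherent e0 has_inf_energy; exists t.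
by exists (fun n => sval (cid (H n))) => n; exact: (svalP (cid (H n))).
Qed.

Let t := sval minimizer.
Let tE n : energy (a (t n)) < inf_energy + 4 ^- n.
Proof. exact: (svalP minimizer). Qed.

Let gap n s : energy (a s) < inf_energy + 4 ^- n ->
  energy_gap F lambda k m s (t n) <= 4 * 4 ^- n.
Proof.
move=> h; rewrite energy_gapE//.
have := inf_le (Mid s (t n)); have := tE n; rewrite -/a; lra.
Qed.

Let tS_lt n : energy (a (t n.+1)) < inf_energy + 4 ^- n.
Proof.
rewrite (lt_le_trans (tE _))// lerD2l lef_pV2 ?posrE ?exprn_gt0//.
by rewrite exprS ler_peMl// ?exprn_ge0// ler1n.
Qed.

Let Re1 s x : `|Re (a s x)| <= 1.
Proof. by case: (sqr_le1_norm (avg_le1 F k m s x l1)). Qed.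
Let Im1 s x : `|Im (a s x)| <= 1.
Proof. by case: (sqr_le1_norm (avg_le1 F k m s x l1)). Qed.

Let mRe s : measurable_fun setT (fun x => Re (a s x)).
Proof. by case: (avg_measurable lambda k m s mF). Qed.
Let mIm s : measurable_fun setT (fun x => Im (a s x)).
Proof. by case: (avg_measurable lambda k m s mF). Qed.

Let gap_part (P : C -> R) : (forall s, measurable_fun setT (fun x => P (a s x))) ->
  (forall s x, `|P (a s x)| <= 1) ->
  (forall s s' x, (P (a s x) - P (a s' x)) ^+ 2 <=
     (Re (a s x) - Re (a s' x)) ^+ 2 + (Im (a s x) - Im (a s' x)) ^+ 2) ->
  exists v : torus -> R, [/\ measurable_fun setT v, (forall x, `|v x| <= 1) &
     {ae mu, forall x, P (a (t n) x) @[n --> \oo] --> v x}].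
Proof.
move=> mP P1 PP.
apply: (@ae_cvg_fast _ _ _ mu (fun n x => P (a (t n) x))) => // n.
apply: le_trans (gap (tS_lt n)); apply: le_Rintegral => //.
- apply: (integrable_bounded mu (M := 8)) => [|x].
    by apply: measurable_funX; exact: measurable_funB.
  have z1 : `|0 : R| <= 1 by rewrite normr0.
  have := sumsq_bounded (P1 (t n.+1) x) (P1 (t n) x) z1 z1.
  by rewrite subrr expr0n addr0.
- exact: energy_gap_integrable.
Qed.

(** Averages of nearly least energy are nearly equal by the parallelogram
    identity, since their midpoint is an average too. A minimizing sequence hence
    converges, to some p + i q of energy at least delta. It is also close to its
    own shifts, as these have the same energy; so the limit is fixed by the shift
    and its conjugate is an eigenfunction. *)
Lemma energy_eigenvalue : Defs.eigenvalue F lambda.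
Proof.
have [p [mp p1 pcvg]] : exists v : torus -> R, [/\ measurable_fun setT v,
    (forall x, `|v x| <= 1) & {ae mu, forall x, Re (a (t n) x) @[n --> \oo] --> v x}].
  by apply: gap_part => // s s' x; rewrite lerDl sqr_ge0.
have [q [mq q1 qcvg]] : exists v : torus -> R, [/\ measurable_fun setT v,
    (forall x, `|v x| <= 1) & {ae mu, forall x, Im (a (t n) x) @[n --> \oo] --> v x}].
  by apply: gap_part => // s s' x; rewrite lerDr sqr_ge0.
have [_ muF] := mpF.
have pcvgF := ae_invariant mF muF pcvg; have qcvgF := ae_invariant mF muF qcvg.
(* the conjugate: the limit h satisfies lambda * h o F = h *)
pose g x : C := Complex (p x) (- q x).
have gE x : Re (g x) ^+ 2 + Im (g x) ^+ 2 = p x ^+ 2 + q x ^+ 2 by rewrite /= sqrrN.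
have bnd2 x : `|p x ^+ 2 + q x ^+ 2| <= 2.
  rewrite ger0_norm ?addr_ge0 ?sqr_ge0// -[p x ^+ 2]real_normK ?num_real//.
  rewrite -[q x ^+ 2]real_normK ?num_real// (_ : 2 = 1 + 1)//.
  by rewrite lerD// exprn_ile1.
have mpq : measurable_fun setT (fun x => p x ^+ 2 + q x ^+ 2) by exact: measurable_sumsq.
exists g; split.
- split; first exact: mp.
    exact: measurable_funN.
  rewrite /sqnorm; apply: (@le_lt_trans _ _ (\int[mu]_x (cst 2%:E x))%E); last first.
    rewrite integral_cst//; apply: lte_mul_pinfty => //.
    exact: le_lt_trans (probability_le1 _ _) (ltry _).
  apply: ge0_le_integral => //.
  - by move=> x _; rewrite lee_fin sqr_ge0.
  - apply/measurable_EFinP; rewrite (_ : (fun x => _) = (fun x => p x ^+ 2 + q x ^+ 2))//.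
    by apply/funext => x; rewrite normc_sqrE gE.
  - by move=> x _; rewrite lee_fin normc_sqrE gE (le_trans (ler_norm _)).
- move=> g0.
  have e0 : (\int[mu]_x (p x ^+ 2 + q x ^+ 2))%R = 0.
    rewrite /Rintegral (ae_eq_integral (cst 0%E)) ?integral0//.
      exact/measurable_EFinP.
    apply: filterS g0 => x /(_ I) /= [-> /eqP]; rewrite oppr_eq0 => /eqP -> _.
    by rewrite expr0n/= addr0.
  have cE : energy (a (t n)) @[n --> \oo] --> (\int[mu]_x (p x ^+ 2 + q x ^+ 2))%R.
    apply: (@cvg_Rintegral _ _ _ mu _ _ (fun=> 1)).
    - by move=> n; exact: measurable_sumsq.
    - exact: mpq.
    - exact: finite_measure_integrable_cst.
    - by move=> n x; rewrite ger0_norm ?addr_ge0 ?sqr_ge0// avg_le1.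
    - by apply: filterS2 pcvg qcvg => x hp hq; apply: cvgD; exact: cvg_sqr.
  have : delta <= 0.
    rewrite -e0 -(cvg_lim _ cE)//; apply: limr_ge; last exact: nearW.
    by apply/cvg_ex; exists (\int[mu]_x (p x ^+ 2 + q x ^+ 2))%R.
  by rewrite leNgt delta0.
- pose r x := Re lambda * p (F x) - Im lambda * q (F x) - p x.
  pose i x := Re lambda * q (F x) + Im lambda * p (F x) - q x.
  have mpF' := measurableT_comp mp mF; have mqF' := measurableT_comp mq mF.
  have mr : measurable_fun setT r.
    apply: measurable_funB => //.
    rewrite (_ : (fun x => _) = (fun x => Re lambda * (p \o F) x + - Im lambda * (q \o F) x)).
      exact: measurable_combination.
    by apply/funext => x; rewrite mulNr.
  have mi : measurable_fun setT i.
    exact: (measurable_funB (measurable_combination _ _ mqF' mpF') mq).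
  have cG : energy_gap F lambda k m (Shift (t n)) (t n) @[n --> \oo] -->
      (\int[mu]_x (r x ^+ 2 + i x ^+ 2))%R.
    apply: (@cvg_Rintegral _ _ _ mu _ _ (fun=> 8)).
    - move=> n; exact: (measurable_sumsq
        (measurable_funB (mRe (Shift (t n))) (mRe (t n)))
        (measurable_funB (mIm (Shift (t n))) (mIm (t n)))).
    - exact: measurable_sumsq.
    - exact: finite_measure_integrable_cst.
    - move=> n x; apply: sumsq_bounded; [exact: (Re1 (Shift (t n)))|exact: Re1|
        exact: (Im1 (Shift (t n)))|exact: Im1].
    - have pqF : {ae mu, forall x, (Re (a (t n) (F x)) @[n --> \oo] --> p (F x)) /\
          (Im (a (t n) (F x)) @[n --> \oo] --> q (F x))}.
        by apply: filterS2 pcvgF qcvgF => x; split.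
      apply: filterS3 pcvg qcvg pqF => x hp hq [hpF hqF].
      under eq_fun do rewrite /= Re_mulc Im_mulc.
      apply: cvgD; apply: cvg_sqr; apply: cvgB => //.
        by apply: cvgB; (apply: cvgM; first exact: cvg_cst).
      by apply: cvgD; (apply: cvgM; first exact: cvg_cst).
  have cG0 : energy_gap F lambda k m (Shift (t n)) (t n) @[n --> \oo] --> (0 : R).
    have c4 : (4 * 4 ^- n) @[n --> \oo] --> (0 : R).
      rewrite -[X in _ --> X](mulr0 4); apply: cvgM; first exact: cvg_cst.
      under eq_fun do rewrite -exprVn.
      by apply: cvg_expr; rewrite ger0_norm ?invr_ge0// invf_lt1// ltr1n.
    apply: (squeeze_cvgr _ (cvg_cst 0) c4); apply: nearW => n.
    rewrite gap; last by rewrite energy_shift// tE.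
    rewrite andbT; apply: Rintegral_ge0 => x _; by rewrite addr_ge0 ?sqr_ge0.
  have e0 : (\int[mu]_x (r x ^+ 2 + i x ^+ 2))%R = 0 by exact: (cvg_unique _ cG cG0).
  have ri0 : {ae mu, forall x, r x ^+ 2 + i x ^+ 2 = 0}.
    have iri : mu.-integrable setT (EFin \o (fun x => r x ^+ 2 + i x ^+ 2)).
      have rb x : `|r x| <= `|Re lambda| + `|Im lambda| + 1.
        rewrite (le_trans (ler_normB _ _))// lerD// (le_trans (ler_normB _ _))//.
        by rewrite lerD// normrM ler_piMr.
      have ib x : `|i x| <= `|Re lambda| + `|Im lambda| + 1.
        rewrite (le_trans (ler_normB _ _))// lerD// (le_trans (ler_normD _ _))//.
        by rewrite lerD// normrM ler_piMr.
      apply: (integrable_bounded mu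
        (M := (`|Re lambda| + `|Im lambda| + 1) ^+ 2 + (`|Re lambda| + `|Im lambda| + 1) ^+ 2)).
        exact: measurable_sumsq.
      move=> x; rewrite ger0_norm ?addr_ge0 ?sqr_ge0//.
      rewrite -[r x ^+ 2]real_normK ?num_real// -[i x ^+ 2]real_normK ?num_real//.
      by rewrite lerD// lerXn2r// nnegrE (le_trans _ (rb x)).
    have ri_ge0 x : 0 <= r x ^+ 2 + i x ^+ 2 by rewrite addr_ge0 ?sqr_ge0.
    exact: (Rintegral_eq0_ae ri_ge0 iri e0).
  apply: filterS ri0 => x /eqP; rewrite paddr_eq0 ?sqr_ge0// !sqrf_eq0.
  move=> /andP[/eqP r0 /eqP i0] _; rewrite /koopman /= /g.
  move: r0 i0 l1; rewrite /r /i; case: (lambda) => u v /= /subr0_eq <- /subr0_eq <- luv.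
  have {}luv : u ^+ 2 + v ^+ 2 = 1.
    by have := congr1 (fun z => z ^+ 2) luv; rewrite /= sqr_sqrtr ?addr_ge0 ?sqr_ge0// expr1n.
  congr Complex.
    transitivity (p (F x) * (u ^+ 2 + v ^+ 2)); [by rewrite luv mulr1|by ring].
  transitivity (- q (F x) * (u ^+ 2 + v ^+ 2)); [by rewrite luv mulr1|by ring].
Qed.

End minimizing.

(** The point x moves along with F because an average evaluates later samples at
    F x; equicontinuity of the maps makes the induction work. *)
Lemma cvg_avg (F_ : nat -> torus -> torus) F (lambda_ : nat -> C) lambda k m t
    (x_ : nat -> torus) x :
  (forall j x y, mdist (F_ j x) (F_ j y) <= 2 * mdist x y) ->
  (forall x, mdist (F_ j x) (F x) @[j --> \oo] --> (0 : R)) ->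
  Re (lambda_ j) @[j --> \oo] --> Re lambda ->
  Im (lambda_ j) @[j --> \oo] --> Im lambda ->
  mdist (x_ j) x @[j --> \oo] --> (0 : R) ->
  (Re (avg (F_ j) (lambda_ j) k m t (x_ j)) @[j --> \oo] -->
    Re (avg F lambda k m t x)) /\
  (Im (avg (F_ j) (lambda_ j) k m t (x_ j)) @[j --> \oo] -->
    Im (avg F lambda k m t x)).
Proof.
move=> LF cF cr ci; elim: t x_ x => [|t IH|s IHs t IHt] x_ x cx.
- split; apply: cvg_phase => //; [exact: cosD_tau|exact: cos_lipschitz|
    exact: sinD_tau|exact: sin_lipschitz].
- have cFx : mdist (F_ j (x_ j)) (F x) @[j --> \oo] --> (0 : R).
    have c2 : (2 * mdist (x_ j) x + mdist (F_ j x) (F x)) @[j --> \oo] --> (0 : R).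
      rewrite -[X in _ --> X](addr0 0) -[X in _ --> X + _](mulr0 2).
      by apply: cvgD; [apply: cvgM; [exact: cvg_cst|]|exact: cF].
    apply: (squeeze_cvgr _ (cvg_cst 0) c2); apply: nearW => j.
    rewrite mdist_ge0 /= (le_trans (metric_triangle _ (F_ j x) _))//.
    by rewrite lerD2r.
  have [IHr IHi] := IH _ _ cFx.
  rewrite /= Re_mulc Im_mulc; split.
    under eq_fun do rewrite Re_mulc.
    by apply: cvgB; apply: cvgM.
  under eq_fun do rewrite Im_mulc.
  by apply: cvgD; apply: cvgM.
- have [sr si] := IHs _ _ cx; have [tr ti] := IHt _ _ cx.
  by split; apply: cvgM; [exact: cvg_cst|exact: cvgD|exact: cvg_cst|exact: cvgD].
Qed.

Lemma energy_ge_closed (F_ : nat -> torus -> torus) F (lambda_ : nat -> C) lambda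
    k m (delta : R) t :
  (forall j, measurable_fun setT (F_ j)) -> measurable_fun setT F ->
  (forall j, normc (lambda_ j) = 1) -> normc lambda = 1 ->
  (forall j x y, mdist (F_ j x) (F_ j y) <= 2 * mdist x y) ->
  (forall x, mdist (F_ j x) (F x) @[j --> \oo] --> (0 : R)) ->
  Re (lambda_ j) @[j --> \oo] --> Re lambda ->
  Im (lambda_ j) @[j --> \oo] --> Im lambda ->
  (forall j, delta <= energy (avg (F_ j) (lambda_ j) k m t)) ->
  delta <= energy (avg F lambda k m t).
Proof.
move=> mF_ mF l_1 l1 LF cF cr ci le.
have cE : energy (avg (F_ j) (lambda_ j) k m t) @[j --> \oo] -->
    energy (avg F lambda k m t).
  apply: (@cvg_Rintegral _ _ _ mu _ _ (fun=> 1)).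
  - move=> j; have [mr mi] := avg_measurable (lambda_ j) k m t (mF_ j).
    exact: (measurable_sumsq mr mi).
  - have [mr mi] := avg_measurable lambda k m t mF.
    exact: (measurable_sumsq mr mi).
  - exact: finite_measure_integrable_cst.
  - by move=> j x; rewrite ger0_norm ?addr_ge0 ?sqr_ge0// avg_le1.
  - apply: aeW => x.
    have cx : mdist x x @[_ --> \oo] --> (0 : R).
      by rewrite metric_structure.mdistxx; exact: cvg_cst.
    have [h1 h2] := cvg_avg k m t LF cF cr ci cx.
    by apply: cvgD; exact: cvg_sqr.
rewrite -(cvg_lim _ cE)//; apply: limr_ge; last exact: nearW.
by apply/cvg_ex; exists (energy (avg F lambda k m t)).
Qed.

End hull_limit.

(** * The complex plane and the Hausdorff metric *)

Section near_seq.

Lemma near_all_seq (T : eqType) (s : seq T) (P : T -> nat -> Prop) :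
  (forall z, z \in s -> \forall n \near \oo, P z n) ->
  \forall n \near \oo, forall z, z \in s -> P z n.
Proof.
elim: s => [|a s IH] h; first by apply: nearW.
have ha := h a (mem_head _ _).
have hs := IH (fun z zs => h z (mem_behead (s := a :: s) zs)).
apply: filterS2 ha hs => n Pa Ps z; rewrite inE => /orP[/eqP ->//|].
exact: Ps.
Qed.

Lemma near_all_leq (N : nat) (P : nat -> nat -> Prop) :
  (forall i, (i <= N)%N -> \forall n \near \oo, P i n) ->
  \forall n \near \oo, forall i, (i <= N)%N -> P i n.
Proof.
move=> h; have := @near_all_seq _ (iota 0 N.+1) P.
have hs i : i \in iota 0 N.+1 -> \forall n \near \oo, P i n.
  by rewrite mem_iota => /h.
by move=> /(_ hs); apply: filterS => n hn i iN; apply: hn; rewrite mem_iota.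
Qed.

End near_seq.

Section complex_plane.
Variable R : realType.
Local Notation C := (R[i])^o.
Import Normc.
Implicit Types (z w : C) (K : set C).

Lemma normc_ge0 z : 0 <= normc z.
Proof. by case: z => a b; rewrite /= sqrtr_ge0. Qed.

Lemma normc_distC z w : normc (z - w) = normc (w - z).
Proof. by rewrite -normcN opprB. Qed.

Lemma normc_dist_triangle v z w : normc (z - w) <= normc (z - v) + normc (v - w).
Proof. by have := le_normcD (z - v) (v - w); rewrite addrA subrK. Qed.

Lemma nbhs_normc z (e : R) : 0 < e -> nbhs z [set w | normc (z - w) < e].
Proof.
move=> e0; apply/nbhs_ballP; exists e%:C%C => /=; first by rewrite ltcR.
by move=> w /=; rewrite -ball_normE /= ltcR.
Qed.

Lemma normc_dist_continuous w : continuous (fun z => normc (z - w)).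
Proof.
move=> z A /nbhs_ballP[e /= e0 eA]; apply: filterS (nbhs_normc z e0) => v /= zv.
apply: eA; rewrite -ball_normE /=; apply: le_lt_trans zv; rewrite ler_norml lerBrDl lerBlDr.
have := normc_dist_triangle v z w; have := normc_dist_triangle z v w.
rewrite (normc_distC v z); lra.
Qed.

Lemma closed_disc w (r : R) : closed [set z | normc (z - w) <= r].
Proof.
by apply: (@closed_comp _ _ (fun z => normc (z - w)) [set x | x <= r]);
  [move=> x _; exact: normc_dist_continuous|exact: closed_le].
Qed.

Lemma closed_codisc w (r : R) : closed [set z | r <= normc (z - w)].
Proof.
by apply: (@closed_comp _ _ (fun z => normc (z - w)) [set x | r <= x]);
  [move=> x _; exact: normc_dist_continuous|exact: closed_ge].
Qed.

Lemma closed_circle : closed [set z : C | normc z = 1].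
Proof.
by apply: (@closed_comp _ _ (@normc R : C -> R) [set x | x = 1]);
  [move=> x _; exact: normc_continuous|exact: closed_eq].
Qed.

Lemma Re_normc z : `|complex.Re z| <= normc z.
Proof.
case: z => a b /=; rewrite -sqrtr_sqr ler_sqrt ?addr_ge0 ?sqr_ge0//.
by rewrite lerDl sqr_ge0.
Qed.

Lemma Im_normc z : `|complex.Im z| <= normc z.
Proof.
case: z => a b /=; rewrite -sqrtr_sqr ler_sqrt ?addr_ge0 ?sqr_ge0//.
by rewrite lerDr sqr_ge0.
Qed.

Lemma normc_le_sum z : normc z <= `|complex.Re z| + `|complex.Im z|.
Proof.
case: z => a b /=; rewrite -[leRHS]ger0_norm ?addr_ge0// -sqrtr_sqr.
rewrite ler_sqrt ?sqr_ge0// -[a ^+ 2]real_normK ?num_real//.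
rewrite -[b ^+ 2]real_normK ?num_real//.
by have := normr_ge0 a; have := normr_ge0 b; nra.
Qed.

(** The theorem of Bolzano and Weierstrass. The indices s i need not increase:
    that they go to infinity is enough to take limits. *)
Lemma circle_subsequence K (lambda_ : nat -> C) : closed K ->
  (forall j, K (lambda_ j)) -> (forall j, normc (lambda_ j) = 1) ->
  exists2 lambda : C, K lambda /\ normc lambda = 1 &
  exists2 s : nat -> nat, (forall i, (i <= s i)%N) &
    normc (lambda_ (s i) - lambda) @[i --> \oo] --> (0 : R).
Proof.
move=> cK Kl l1.
have cpt : compact (K `&` [set z : C | normc z = 1]).
  apply: (@bounded_closed_compactC _ _ 1).
    by apply: closedI => //; exact: closed_circle.
  by move=> z [_ /= ->].
have [|lambda [[Klam lam1] clu]] := cpt (lambda_ @ \oo) _.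
  by exists 0%N => // j _; split => /=.
exists lambda => //.
have H i : exists j, (i <= j)%N /\ normc (lambda - lambda_ j) < i.+1%:R^-1.
  have i0 : 0 < i.+1%:R^-1 :> R by rewrite invr_gt0.
  have := clu [set lambda_ j | j in [set j | (i <= j)%N]] _ _ (nbhs_normc lambda i0).
  case=> [|_ [[j ij <-] h]]; last by exists j.
  by exists i => // j ij; exists j.
exists (fun i => sval (cid (H i))) => [i|]; first by case: (cid (H i)) => j [].
apply/cvgrPdist_lt => e e0; have [N Ne] := @ltr_add_invr R 0 e e0.
rewrite add0r in Ne; near=> i.
rewrite sub0r normrN ger0_norm ?normc_ge0//; case: (cid (H i)) => j [_ /= h].
rewrite normc_distC (lt_trans h)// (le_lt_trans _ Ne)//.
rewrite lef_pV2 ?posrE// ler_nat ltnS; near: i; exact: nbhs_infty_ge.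
Unshelve. all: by end_near.
Qed.

Lemma cvg_Re (z_ : nat -> C) z : normc (z_ i - z) @[i --> \oo] --> (0 : R) ->
  complex.Re (z_ i) @[i --> \oo] --> complex.Re z.
Proof.
move=> h; apply/cvgrPdist_lt => e e0; move/cvgrPdist_lt : h => /(_ e e0).
apply: filterS => i; rewrite sub0r normrN ger0_norm ?normc_ge0//.
by apply: le_lt_trans; rewrite distrC -raddfB; exact: Re_normc.
Qed.

Lemma cvg_Im (z_ : nat -> C) z : normc (z_ i - z) @[i --> \oo] --> (0 : R) ->
  complex.Im (z_ i) @[i --> \oo] --> complex.Im z.
Proof.
move=> h; apply/cvgrPdist_lt => e e0; move/cvgrPdist_lt : h => /(_ e e0).
apply: filterS => i; rewrite sub0r normrN ger0_norm ?normc_ge0//.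
by apply: le_lt_trans; rewrite distrC -raddfB; exact: Im_normc.
Qed.

Lemma hausdorff_le (K L : compacts R) (r : R) :
  (forall z, sval K z -> exists2 w, sval L w & normc (z - w) <= r) ->
  (forall w, sval L w -> exists2 z, sval K z & normc (w - z) <= r) ->
  mdist K L <= r.
Proof.
have half (A B : compacts R) : (forall z, sval A z -> exists2 w, sval B w & normc (z - w) <= r) ->
    sup [set point_dist z (sval B) | z in sval A] <= r.
  move=> AB; have [_ [a Aa]] := svalP A.
  apply: ge_sup; first by exists (point_dist a (sval B)), a.
  move=> _ [z Az <-]; have [w Bw zw] := AB z Az; apply: le_trans zw.
  apply: ge_inf; last by exists w.
  by exists 0 => _ [v _ <-]; exact: normc_ge0.
by move=> h1 h2; rewrite mdist_compacts /hausdorff_dist ge_max !half.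
Qed.

Lemma hausdorff_lt (K L : compacts R) z (r : R) :
  mdist K L < r -> sval K z -> exists2 w, sval L w & normc (z - w) < r.
Proof.
move=> KL Kz.
have hi : has_inf [set normc (z - w) | w in sval L].
  have [_ [l Ll]] := svalP L; split; first by exists (normc (z - l)), l.
  by exists 0 => _ [v _ <-]; exact: normc_ge0.
have d : point_dist z (sval L) < r.
  apply: le_lt_trans KL; rewrite mdist_compacts le_max; apply/orP; left.
  have [cK [k Kk]] := svalP K; have [l Ll] := (svalP L).2.
  have [M KM] := compact_normc_bounded cK.
  apply: ub_le_sup; last by exists z.
  exists (M + normc l) => _ [v Kv <-].
  apply: (@le_trans _ _ (normc (v - l))).
    by apply: ge_inf; [exists 0 => _ [u _ <-]; exact: normc_ge0|exists l].
  by rewrite (le_trans (le_normcD _ _))// normcN lerD2r KM.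
have e0 : 0 < r - point_dist z (sval L) by rewrite subr_gt0.
have [_ [w Lw <-]] := inf_adherent e0 hi.
rewrite (_ : inf _ + _ = r) => [h|]; first by exists w.
by rewrite /point_dist addrC subrK.
Qed.

End complex_plane.

(** * Closed conditions are decided in one limit *)

Section towers.
Variables (R : realType) (M : metricType R) (Xi : Omega_p R -> M).
Variables (xhat : nat -> torus R) (xhat_dense : dense (range xhat)).
Local Notation torus := (torus R).
Local Notation P := (delta1 (sampling_problem Xi xhat_dense)).
Local Notation data := (problem_dom P).
Implicit Types (t : data) (A : Omega_p R) (D : set (Omega_p R)).

Definition reading t (j n : nat) : torus := sval t j n.

(** General algorithms are subject to no computability constraint: any function of
    a fixed finite amount of information is one. *)
Lemma general_algorithm_truncation (T : Type) (Gamma : data -> T) (r : nat) :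
  (forall s t, (forall j n, (j <= r)%N -> (n <= r)%N -> reading s j n = reading t j n) ->
     Gamma s = Gamma t) ->
  general_algorithm (@evaluations R M torus P) Gamma.
Proof.
move=> Gr; exists (fun _ => [set @delta1_info _ _ _ (sampling_problem Xi xhat_dense) jn |
  jn in `I_r.+1 `*` `I_r.+1]) => s; split.
- by move=> _ [jn _ <-]; exists jn.
- by exists (@delta1_info _ _ _ (sampling_problem Xi xhat_dense) (0%N, 0%N)), (0%N, 0%N).
- by apply: finite_image; apply: finite_setX; exact: finite_II.
- move=> t st; split => //; apply: Gr => j n jr nr.
  exact: (esym (st _ (ex_intro2 _ _ (j, n) (conj jr nr) erefl))).
Qed.

Definition element t : Omega_p R := sval (cid (svalP t)).

Lemma element_approximates t j n :
  mdist (reading t j n) (sval (element t) (xhat j)) <= 2 ^- n.+1.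
Proof. exact: (svalP (cid (svalP t))). Qed.

Definition consistent (r : nat) t A := forall j n, (j <= r)%N -> (n <= r)%N ->
  mdist (reading t j n) (sval A (xhat j)) <= 2 ^- n.+1.

Definition plausible D (r : nat) t : bool := `[< exists2 A, D A & consistent r t A >].

Definition pointwise_closed D := forall (A_ : nat -> Omega_p R) A,
  (forall j, D (A_ j)) ->
  (forall x, mdist (sval (A_ j) x) (sval A x) @[j --> \oo] --> (0 : R)) -> D A.

Lemma Omega_p_lipschitz A x y : mdist (sval A x) (sval A y) <= 2 * mdist x y.
Proof. by have [_ _ [_ [_ _ LF _]]] := svalP A; exact: Lip_le. Qed.

Lemma dense_sample x (e : R) : 0 < e -> exists j, mdist x (xhat j) < e.
Proof.
move=> e0; have [y [xy [j _ xj]]] : (ball x e)^° `&` range xhat !=set0.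
  apply: xhat_dense; last exact: open_interior.
  by exists x; apply: nbhsx_ballx.
exists j; rewrite xj; by have /interior_subset := xy; rewrite ballEmdist.
Qed.

(** Elements that agree better and better with the data converge to the element
    that the data describe, because the sample points are dense and all elements
    have the same Lipschitz constant. *)
Lemma consistent_cvg t (A_ : nat -> Omega_p R) x :
  (forall r, consistent r t (A_ r)) ->
  mdist (sval (A_ r) x) (sval (element t) x) @[r --> \oo] --> (0 : R).
Proof.
move=> cA; apply/cvgrPdist_lt => e e0.
have e8 : 0 < e / 8 by rewrite divr_gt0.
have [j xj] := dense_sample x e8.
have [n ne] : exists n, 2 ^- n.+1 < e / 8 :> R.
  have [n] := @ltr_add_invr R 0 _ e8; rewrite add0r => ne.
  exists n; apply: le_lt_trans ne.
  by rewrite lef_pV2 ?posrE ?exprn_gt0// -natrX ler_nat; exact: ltnW (ltn_expl _ _).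
near=> r; rewrite sub0r normrN ger0_norm ?mdist_ge0//.
have h1 := Omega_p_lipschitz (A_ r) x (xhat j).
have h2 := Omega_p_lipschitz (element t) (xhat j) x.
have h3 : mdist (reading t j n) (sval (A_ r) (xhat j)) <= 2 ^- n.+1.
  by apply: cA; near: r; exact: nbhs_infty_ge.
have h4 := element_approximates t j n.
rewrite metric_sym in h3; rewrite (metric_sym (xhat j)) in h2.
have t1 := metric_triangle (sval (A_ r) x) (sval (A_ r) (xhat j)) (sval (element t) x).
have t2 := metric_triangle (sval (A_ r) (xhat j)) (reading t j n) (sval (element t) x).
have t3 := metric_triangle (reading t j n) (sval (element t) (xhat j)) (sval (element t) x).
lra.
Unshelve. all: by end_near.
Qed.

(** If the condition stayed plausible for ever, elements of D consistent with more
    and more data would converge to the true element, which would lie in D as D is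
    closed. *)
Lemma plausible_eventually D t : pointwise_closed D ->
  \forall r \near \oo, plausible D r t = `[< D (element t) >].
Proof.
move=> cD; have [Dt|nDt] := pselect (D (element t)).
  apply: nearW => r; rewrite (asboolT Dt); apply/asboolP; exists (element t) => //.
  by move=> j n _ _; exact: element_approximates.
rewrite (asboolF nDt); apply: contrapT => nev.
have pl r : exists A, D A /\ consistent r t A.
  apply: contrapT => npl; apply: nev; exists r => // q /= rq.
  apply/asboolPn => -[A DA cA]; apply: npl; exists A; split => // j n jr nr.
  by apply: cA; exact: leq_trans rq.
apply: nDt; apply: (cD (fun r => sval (cid (pl r)))) => [r|x].
  by case: (cid (pl r)) => A [].
by apply: consistent_cvg => r; case: (cid (pl r)) => A [].
Qed.

Lemma plausible_local D r s t :
  (forall j n, (j <= r)%N -> (n <= r)%N -> reading s j n = reading t j n) ->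
  plausible D r s = plausible D r t.
Proof.
move=> st; rewrite /plausible; congr asbool; apply/propext; split => -[A DA cA];
  exists A => // j n jr nr; first by rewrite -st//; exact: cA.
by rewrite st//; exact: cA.
Qed.

End towers.

Section detection.
Variable R : realType.
Local Notation C := (R[i])^o.
Import Normc.
Implicit Types (K : set C) (A : Omega_p R).

(** The index i encodes a character (k, m) and a lower bound 1 / (p + 1). The
    existence of lambda in K is part of the condition, so that for closed K it
    remains closed by compactness of the unit circle. *)
Definition detected K (i : nat) : set (Omega_p R) := fun A =>
  if @unpickle (int * int * nat)%type i is Some (k, m, p) then
    exists lambda : C, [/\ K lambda, normc lambda = 1 &
      forall t, p.+1%:R^-1 <= energy (avg (sval A) lambda k m t)]
  else False.

Lemma detected_eigenvalue K i A : detected K i A ->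
  exists2 lambda : C, K lambda & Defs.eigenvalue (sval A) lambda.
Proof.
rewrite /detected; case: unpickle => // -[[k m] p] [lambda [Kl l1 le]].
have [_ mp _] := svalP A.
exists lambda => //; exact: (@energy_eigenvalue _ _ _ k m p.+1%:R^-1).
Qed.

Lemma eigenvalue_detected A (lambda : C) : Defs.eigenvalue (sval A) lambda ->
  exists i, forall K, K lambda -> detected K i A.
Proof.
move=> ev; have [_ mp _] := svalP A.
have [k [m [d d0 de]]] := eigenvalue_energy mp ev.
have [p pd] := @ltr_add_invr R 0 d d0; rewrite add0r in pd.
exists (pickle (k, m, p)) => K Kl; rewrite /detected pickleK.
exists lambda; split => //; first exact: eigenvalue_normc mp ev.
by move=> t; rewrite (le_trans (ltW pd)).
Qed.

Lemma detected_closed K i : closed K -> pointwise_closed (detected K i).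
Proof.
move=> cK A_ A; rewrite /detected; case: unpickle => [[[k m] p]|] DA cA.
  pose l_ j := sval (cid (DA j)).
  have lP j := svalP (cid (DA j)); rewrite -/(l_ _) in lP.
  have [||lambda [Kl l1] [s si sl]] := @circle_subsequence R K l_ cK.
  - by move=> j; case: (lP j).
  - by move=> j; case: (lP j).
  exists lambda; split => // t.
  apply: (@energy_ge_closed _ (fun i => sval (A_ (s i))) _ (fun i => l_ (s i))).
  - by move=> j; have [_ [mF _] _] := svalP (A_ (s j)).
  - by have [_ [mF _] _] := svalP A.
  - by move=> j; case: (lP (s j)).
  - exact: l1.
  - by move=> j x y; exact: Omega_p_lipschitz.
  - move=> x; have := cA x => /cvgrPdist_lt h; apply/cvgrPdist_lt => e e0.
    have [N _ hN] := h e e0; exists N => // j /= Nj.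
    by apply: hN => /=; rewrite (leq_trans Nj).
  - exact: cvg_Re.
  - exact: cvg_Im.
  - by move=> j; case: (lP (s j)).
exact: DA 0%N.
Qed.

End detection.

(** * The two towers of height two *)

Section decision_tower.
Variables (R : realType) (xhat : nat -> torus R) (xhat_dense : dense (range xhat)).
Local Notation C := (R[i])^o.
Local Notation P := (delta1 (sampling_problem (@Xi_p_dec R) xhat_dense)).
Import Normc.

Definition off_one (q : nat) : set C := [set z | q.+1%:R^-1 <= normc (z - 1)].

(** An eigenvalue other than 1 lies in one of the closed sets [off_one q]. *)
Lemma Xi_p_decP (A : Omega_p R) :
  Xi_p_dec A = `[< exists i q, detected (off_one q) i A >].
Proof.
rewrite /Xi_p_dec; apply/asboolPn/asboolP.
  move=> /existsNP[lambda /not_implyP[ev l1]].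
  have d0 : 0 < normc (lambda - 1).
    rewrite lt_neqAle normc_ge0 andbT eq_sym; apply/eqP => /eq0_normc/eqP.
    by rewrite subr_eq0 => /eqP.
  have [q] := @ltr_add_invr R 0 _ d0; rewrite add0r => /ltW qd.
  by have [i h] := eigenvalue_detected ev; exists i, q; exact: h.
move=> [i [q /detected_eigenvalue[lambda /= ql ev]]] /(_ _ ev) l1.
by move: ql; rewrite /off_one /= l1 subrr normc0 leNgt invr_gt0 ltr0n.
Qed.

(** Detections only accumulate when the list of tests grows, which gives the
    convergence from below. *)
Theorem decision_Sigma2G : Sigma2G_decision P.
Proof.
pose Gamma2 n (t : problem_dom P) : decision R :=
  `[< exists i q, [/\ (i <= n)%N, (q <= n)%N & detected (off_one q) i (element t)] >].
pose Gamma21 n r (t : problem_dom P) : decision R :=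
  `[< exists i q, [/\ (i <= n)%N, (q <= n)%N & plausible (detected (off_one q) i) r t] >].
exists Gamma2, Gamma21; split; last first.
  move=> t m n mn; have : Gamma2 m t -> Gamma2 n t.
    move=> /asboolP[i [q [im qm h]]]; apply/asboolP.
    by exists i, q; split => //; exact: leq_trans mn.
  by case: (Gamma2 m t); case: (Gamma2 n t) => // /(_ isT).
split.
- move=> n r; apply: (general_algorithm_truncation (r := r)) => s t st.
  rewrite /Gamma21; congr asbool; apply/propext.
  split => -[i [q [im qm h]]]; exists i, q; split => //; first by rewrite -(plausible_local _ st).
  by rewrite (plausible_local _ st).
- move=> t; apply: cvg_near_cst.
  rewrite (_ : target t = Xi_p_dec (element t))//.
  rewrite Xi_p_decP; have [[i [q h]]|no] := pselect (exists i q, detected (off_one q) i (element t)).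
    exists (maxn i q) => // n /=; rewrite geq_max => /andP[ni nq].
    by apply/asboolP/asboolP => _; exists i, q.
  apply: nearW => n; rewrite /Gamma2 (asboolF no); apply/asboolPn => -[i [q [_ _ h]]].
  by apply: no; exists i, q.
- move=> n t; apply: cvg_near_cst.
  have H : \forall r \near \oo, forall i, (i <= n)%N -> forall q, (q <= n)%N ->
      plausible (detected (off_one q) i) r t = `[< detected (off_one q) i (element t) >].
    apply: near_all_leq => i _; apply: near_all_leq => q _.
    by apply: plausible_eventually; apply: detected_closed; exact: closed_codisc.
  apply: filterS H => r H; rewrite /Gamma21 /Gamma2; congr asbool; apply/propext.
  split => -[i [q [im qm h]]]; exists i, q; split => //.
    by apply/asboolP; rewrite -H.
  by rewrite H//; apply/asboolP.
Qed.

End decision_tower.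

Section spectrum_tower.
Variables (R : realType) (xhat : nat -> torus R) (xhat_dense : dense (range xhat)).
Local Notation C := (R[i])^o.
Local Notation P := (delta1 (sampling_problem (@Xi_p R) xhat_dense)).
Import Normc.

Definition mesh (n : nat) : R := 2 ^- n.+1.

Lemma mesh_gt0 n : 0 < mesh n.
Proof. by rewrite /mesh invr_gt0 exprn_gt0. Qed.

Lemma mesh_le n m : (n <= m)%N -> mesh m <= mesh n.
Proof.
by move=> nm; rewrite /mesh lef_pV2 ?posrE ?exprn_gt0// ler_weXn2l// ler1n.
Qed.

Lemma mesh_small (e : R) : 0 < e -> exists n, mesh n < e.
Proof.
move=> e0; have [n] := @ltr_add_invr R 0 _ e0; rewrite add0r => ne.
exists n; apply: le_lt_trans ne; rewrite /mesh.
rewrite lef_pV2 ?posrE ?exprn_gt0// -natrX ler_nat; exact: ltnW (ltn_expl _ _).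
Qed.

(** A square grid on [-1, 1]^2 of step 2^-(n+2), which takes 2^(n+3) steps along
    each side. *)
Definition lattice (n : nat) : seq C :=
  [seq Complex (a%:R * (mesh n / 2) - 1) (b%:R * (mesh n / 2) - 1) |
     a <- iota 0 (2 ^ n.+3).+1, b <- iota 0 (2 ^ n.+3).+1].

Lemma lattice_coordinate n (x : R) : `|x| <= 1 ->
  exists2 a, a \in iota 0 (2 ^ n.+3).+1 & `|x - (a%:R * (mesh n / 2) - 1)| <= mesh n / 2.
Proof.
rewrite ler_norml => /andP[x0 x1]; have m0 := mesh_gt0 n.
pose y := (x + 1) / (mesh n / 2).
have y0 : 0 <= y by rewrite divr_ge0 ?divr_ge0 ?(ltW m0)//; lra.
have ye : x = y * (mesh n / 2) - 1.
  by rewrite /y mulfVK ?addrK// gt_eqF// divr_gt0.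
exists (Num.truncn y).
  rewrite mem_iota /= add0n ltnS -(ler_nat R).
  have /andP[h _] := truncn_itv y0; rewrite (le_trans h)// /y ler_pdivrMr ?divr_gt0//.
  rewrite /mesh natrX !exprS; have p : 0 < 2 ^+ n :> R by rewrite exprn_gt0.
  rewrite (_ : _ * _ = 2); last by field; rewrite gt_eqF.
  by lra.
have /andP[h1 h2] := truncn_itv y0; rewrite -natr1 in h2.
have -> : x - ((Num.truncn y)%:R * (mesh n / 2) - 1) = (y - (Num.truncn y)%:R) * (mesh n / 2).
  by rewrite {1}ye; ring.
rewrite normrM [X in _ * X]gtr0_norm ?divr_gt0// ler_piMl ?divr_ge0 ?(ltW m0)//.
by rewrite ger0_norm ?subr_ge0//; lra.
Qed.

Lemma lattice_approx n (z : C) : normc z = 1 ->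
  exists2 w, w \in lattice n & normc (z - w) <= mesh n.
Proof.
move=> z1.
have [a aN za] := @lattice_coordinate n (complex.Re z) (eq_ind_r (fun u => _ <= u) (Re_normc z) (esym z1)).
have [b bN zb] := @lattice_coordinate n (complex.Im z) (eq_ind_r (fun u => _ <= u) (Im_normc z) (esym z1)).
exists (Complex (a%:R * (mesh n / 2) - 1) (b%:R * (mesh n / 2) - 1)).
  by apply/allpairsP; exists (a, b).
rewrite (le_trans (normc_le_sum _))//; case: z {z1} za zb => x y /= za zb.
by rewrite [leRHS]splitr lerD.
Qed.

Definition disc (w : C) (r : R) : set C := [set z | normc (z - w) <= r].

Section finite_union.
Variables (Q : C -> bool) (n : nat).

(** The point 1 is always an eigenvalue, and including it keeps the set non-empty. *)
Definition picked : set C := [set z | z = 1 \/ z \in lattice n /\ Q z].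

Lemma picked_compact : compact picked /\ picked !=set0.
Proof.
split; last by exists 1; left.
apply: finite_compact.
have -> : picked = [set 1] `|` [set` [seq z <- lattice n | Q z]].
  apply/seteqP; split=> z.
    by move=> [->|[h1 h2]]; [left|right; change (z \in [seq z <- lattice n | Q z]); rewrite mem_filter h1 h2].
  by move=> [->|]; [left|change (z \in [seq z <- lattice n | Q z] -> picked z); rewrite mem_filter => /andP[h1 h2]; right].
by rewrite finite_setU; split; [exact: finite_set1|exact: finite_seq].
Qed.

Definition picked_compacts : compacts R := exist _ picked picked_compact.

End finite_union.

Lemma setU_compact (K L : compacts R) :
  compact (sval K `|` sval L) /\ sval K `|` sval L !=set0.
Proof.
split; first by apply: compactU; [case: (svalP K)|case: (svalP L)].
by have [_ [z Kz]] := svalP K; exists z; left.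
Qed.

Definition union_compacts (K L : compacts R) : compacts R :=
  exist _ (sval K `|` sval L) (setU_compact K L).

Lemma eigenvalue_mem_spectrum (A : Omega_p R) lambda :
  Defs.eigenvalue (sval A) lambda -> sval (Xi_p A) lambda.
Proof. by move=> h; apply: subset_closure. Qed.

Lemma spectrum_approx (A : Omega_p R) w (e : R) : 0 < e -> sval (Xi_p A) w ->
  exists2 lambda, Defs.eigenvalue (sval A) lambda & normc (w - lambda) < e.
Proof. by move=> e0 /(_ _ (nbhs_normc w e0)) [lambda [ev h]]; exists lambda. Qed.

(** The output at level n consists of the lattice points within [mesh n] of an
    eigenvalue found by one of the first n + 1 tests. It lies within [mesh n] of the
    spectrum, which allows its union with the spectrum as the bounding set. It
    converges because a lattice of fixed mesh is a finite net of the unit circle: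
    once the tests have found one eigenvalue near each of its points that has
    some, every part of the spectrum is approached. *)
Theorem compacts_Sigma2G : Sigma2G_compacts P.
Proof.
pose Q2 n (t : problem_dom P) (z : C) : bool :=
  `[< exists2 i, (i <= n)%N & detected (disc z (mesh n)) i (element t) >].
pose Q21 n r (t : problem_dom P) (z : C) : bool :=
  `[< exists2 i, (i <= n)%N & plausible (detected (disc z (mesh n)) i) r t >].
pose Gamma2 n t := picked_compacts (Q2 n t) n.
pose Gamma21 n r t := picked_compacts (Q21 n r t) n.
have targetE (t : problem_dom P) : target t = Xi_p (element t) by [].
have G2 n t z : sval (Gamma2 n t) z ->
    exists2 w, sval (Xi_p (element t)) w & normc (z - w) <= mesh n.
  move=> [->|[zn /asboolP[i _ /detected_eigenvalue[lambda zl ev]]]].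
    exists 1; first exact: eigenvalue_mem_spectrum (eigenvalue1 _).
    by rewrite subrr normc0 ltW// mesh_gt0.
  exists lambda; first exact: eigenvalue_mem_spectrum.
  by rewrite normc_distC.
exists Gamma2, Gamma21,
  (fun n t => union_compacts (Gamma2 n t) (target t)); split; last first.
  move=> n t; split; first by move=> z; left.
  rewrite -/(mesh n); apply: hausdorff_le => z /=.
    case; first exact: G2.
    by move=> h; exists z => //; rewrite subrr normc0 ltW// mesh_gt0.
  by move=> h; exists z; [right|rewrite subrr normc0 ltW// mesh_gt0].
split.
- move=> n r; apply: (general_algorithm_truncation (r := r)) => s t st.
  rewrite /Gamma21; congr picked_compacts; apply/funext => z.
  rewrite /Q21; congr asbool; apply/propext.
  split => -[i im h]; exists i => //; first by rewrite -(plausible_local _ st).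
  by rewrite (plausible_local _ st).
- move=> t; rewrite targetE; apply: (@cvg_ballP _ _ _ _ _ _ _).2 => e e0.
  have e8 : 0 < e / 8 by rewrite divr_gt0.
  have [N Ne] := mesh_small e8.
  have near_lattice : \forall n \near \oo, forall z, z \in lattice N ->
      (exists2 lambda, Defs.eigenvalue (sval (element t)) lambda & normc (lambda - z) <= mesh N) ->
      exists2 w, sval (Gamma2 n t) w & normc (z - w) <= mesh N + mesh n.
    apply: near_all_seq => z _.
    have [[lambda ev lz]|no] := pselect (exists2 lambda,
      Defs.eigenvalue (sval (element t)) lambda & normc (lambda - z) <= mesh N); last first.
      by apply: nearW.
    have [i hi] := eigenvalue_detected ev.
    exists i => // n /= ni _.
    have l1 : normc lambda = 1.
      by apply: eigenvalue_normc ev; have [_ mp _] := svalP (element t).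
    have [w wn lw] := lattice_approx n l1.
    exists w; last first.
      rewrite (le_trans (normc_dist_triangle lambda _ _))// lerD// normc_distC//.
    by right; split => //; apply/asboolP; exists i => //; exact: hi.
  apply: filterS2 near_lattice (nbhs_infty_ge N) => n hn Nn; rewrite ballEmdist /=.
  have nN : mesh n <= mesh N by exact: mesh_le.
  apply: (@le_lt_trans _ _ (e / 2)); last by rewrite ltr_pdivrMr// ltr_pMr// ltr1n.
  apply: hausdorff_le => w.
    move=> hw; have [lambda ev wl] := spectrum_approx e8 hw.
    have l1 : normc lambda = 1.
      by apply: eigenvalue_normc ev; have [_ mp _] := svalP (element t).
    have [z zN lz] := lattice_approx N l1.
    have [v Gv zv] := hn z zN (ex_intro2 _ _ lambda ev lz).
    exists v => //.
    have t1 := normc_dist_triangle lambda w v.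
    have t2 := normc_dist_triangle z lambda v.
    by lra.
  by move=> /G2 [v Xv wv]; exists v => //; lra.
- move=> n t; apply: cvg_near_cst.
  have H : \forall r \near \oo, forall z, z \in lattice n -> forall i, (i <= n)%N ->
      plausible (detected (disc z (mesh n)) i) r t =
      `[< detected (disc z (mesh n)) i (element t) >].
    apply: near_all_seq => z _; apply: near_all_leq => i _.
    by apply: plausible_eventually; apply: detected_closed; exact: closed_disc.
  apply: filterS H => r H; apply/eqP; apply/eqP.
  apply: eq_exist; rewrite /= /picked; apply/seteqP; split => z [->|[zn h]]; [by left| |by left|];
    right; split => //; move: h => /asboolP[i im h]; apply/asboolP; exists i => //.
    by apply/asboolP; rewrite -H.
  by rewrite H//; apply/asboolP.
Qed.

End spectrum_tower.

(** * Smooth profiles *)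

Section quadratic_remainder.
Variable R : realType.
Implicit Types (f g : R -> R) (x h l M : R).

(** Derivatives are established through quadratic error bounds throughout: such
    bounds survive infinite sums, and they do not distinguish the point 0, where
    the formula for the flat function changes. *)
Lemma is_derive_quadratic f x l M :
  (forall h, `|f (x + h) - f x - h * l| <= M * h ^+ 2) -> is_derive x 1 f l.
Proof.
move=> fq.
have M0 : 0 <= M by have := fq 1; rewrite expr1n mulr1; apply: le_trans.
have cvgl : (fun h : R => h^-1 *: ((f \o shift x) (h *: 1) - f x)) @ 0^' --> l.
  apply/cvgrPdist_lt => e e0; near=> h.
  have hn0 : h != 0 by near: h; exact: nbhs_dnbhs_neq.
  rewrite /= [h *: _]mulr1 [_ *: _]mulrC -normrN opprB [h + x]addrC.
  have -> : (f (x + h) - f x) / h - l = (f (x + h) - f x - h * l) / h.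
    by field.
  rewrite normrM normfV ltr_pdivrMr ?normr_gt0//.
  rewrite (le_lt_trans (fq h))// -real_normK ?num_real// expr2 mulrA.
  rewrite ltr_pM2r ?normr_gt0//.
  apply: (@le_lt_trans _ _ ((M + 1) * `|h|)); first by rewrite ler_wpM2r// lerDl.
  rewrite mulrC -ltr_pdivlMr ?ltr_wpDl//.
  near: h; apply: dnbhs0_lt; by rewrite divr_gt0// ltr_wpDl.
apply: DeriveDef; first by apply/cvg_ex; exists l.
exact: cvg_lim cvgl.
Unshelve. all: by end_near.
Qed.

Lemma mean_value_bound f g x h : (forall x, is_derive x 1 f (g x)) ->
  exists2 c, f (x + h) - f x = g c * h & `|c - x| <= `|h|.
Proof.
move=> fg.
have cf (a b : R) : {within `[a, b], continuous f}.
  by apply: derivable_within_continuous => z _; exact: (@ex_derive _ _ _ _ _ _ _ (fg z)).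
have [h0|/ltW h0] := leP 0 h.
  have xh : x <= x + h by rewrite lerDl.
  have [c cI e] := MVT_segment xh (fun z _ => fg z) (cf x (x + h)).
  exists c; first by rewrite e addrAC subrr add0r.
  move: cI; rewrite in_itv/= => /andP[c1 c2].
  by rewrite !ger0_norm ?subr_ge0//; lra.
have xh : x + h <= x by rewrite gerDl.
have [c cI e] := MVT_segment xh (fun z _ => fg z) (cf (x + h) x).
exists c; first by rewrite -opprB e; ring.
move: cI; rewrite in_itv/= => /andP[c1 c2].
by rewrite ler0_norm ?subr_le0// ler0_norm//; lra.
Qed.

Lemma quadratic_remainder (f f1 f2 : R -> R) M x h :
  (forall x, is_derive x 1 f (f1 x)) -> (forall x, is_derive x 1 f1 (f2 x)) ->
  (forall x, `|f2 x| <= M) -> `|f (x + h) - f x - h * f1 x| <= M * h ^+ 2.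
Proof.
move=> fd f1d f2M; have [c -> cx] := mean_value_bound x h fd.
rewrite [h * _]mulrC -mulrBl normrM -[h ^+ 2]real_normK ?num_real// expr2 mulrA.
rewrite ler_wpM2r// (le_trans (lipschitz_of_derive f1d f2M _ _))//.
by rewrite ler_wpM2l// (le_trans _ (f2M 0)).
Qed.

End quadratic_remainder.

Section flat_function.
Variable R : realType.
Implicit Types (p : {poly R}) (x u : R).

(** The functions p(1/x) exp(-1/x), extended by 0, are closed under
    differentiation; the case p = 1 is the standard flat function. *)
Definition flat p x : R := if 0 < x then p.[x^-1] * expR (- x^-1) else 0.

(** A uniform bound of [flat p], since u ^ i <= i! exp u for u = 1 / x. *)
Definition flat_bound p : R := \sum_(i < size p) `|p`_i| * (i`!)%:R.

Lemma expr_le_expR u n : 0 <= u -> u ^+ n <= (n`!)%:R * expR u.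
Proof.
move=> u0; case: n => [|n].
  by rewrite expr0 fact0 mul1r -expR0 ler_expR.
have := expR_ge1Dxn n u0; have f0 : 0 < (n.+1)`!%:R :> R by rewrite ltr0n fact_gt0.
by move=> h; rewrite [leRHS]mulrC -ler_pdivrMr// (le_trans _ h)// lerDr.
Qed.

Lemma flat_le p x : `|flat p x| <= flat_bound p.
Proof.
have b0 : 0 <= flat_bound p by apply: sumr_ge0 => i _; rewrite mulr_ge0.
rewrite /flat; case: ifPn => x0; last by rewrite normr0.
have u0 : 0 <= x^-1 by rewrite invr_ge0 ltW.
rewrite normrM (ger0_norm (expR_ge0 _)) expRN ler_pdivrMr ?expR_gt0//.
rewrite horner_coef (le_trans (ler_norm_sum _ _ _))// /flat_bound mulr_suml.
apply: ler_sum => i _; rewrite normrM normrX (ger0_norm u0) -mulrA ler_wpM2l//.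
exact: expr_le_expR.
Qed.

Lemma flat_le_sqr p x : `|flat p x| <= flat_bound ('X ^+ 2 * p) * x ^+ 2.
Proof.
have := flat_le ('X ^+ 2 * p) x; rewrite /flat; case: ifPn => x0 h; last first.
  by rewrite normr0 mulr_ge0 ?sqr_ge0// (le_trans _ h)// normr0.
rewrite -ler_pdivrMr ?exprn_gt0// (le_trans _ h)//.
rewrite hornerM hornerXn -mulrA [leRHS]normrM [X in _ <= X * _]ger0_norm.
  by rewrite mulrC exprVn.
by rewrite exprn_ge0 ?invr_ge0 ?ltW.
Qed.

Definition flat_deriv p : {poly R} := 'X ^+ 2 * (p - p^`()).

Lemma is_derive_flat p x : is_derive x 1 (flat p) (flat (flat_deriv p) x).
Proof.
have [x0|x0|->] := ltgtP x 0.
- rewrite [X in is_derive _ _ _ X](_ : _ = 0); last by rewrite /flat ltNge (ltW x0).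
  have dc : is_derive x 1 (cst 0 : R -> R) 0 by exact: is_derive_cst.
  refine (near_eq_is_derive _ dc).
  by near=> y; rewrite /flat ltNge (_ : y <= 0)//; near: y; apply: filterS (lt_nbhsl x0) => t /ltW.
- have xn0 : x != 0 by rewrite gt_eqF.
  have dinv : is_derive x 1 (fun y : R => y^-1) (- x ^- 2).
    apply: is_derive_eq (@is_deriveV R id x 1 1 xn0 (is_derive_id x 1)) _.
    exact: mulr1.
  have dh : is_derive x 1 (fun y => p.[y^-1]) (p^`().[x^-1] * (- x ^- 2)).
    exact: (@is_derive1_comp R (horner p) _ x _ _ (is_derive_poly p x^-1) dinv).
  have de : is_derive x 1 (fun y => expR (- y^-1)) (expR (- x^-1) * - (- x ^- 2)).
    exact: (@is_derive1_comp R expR _ x _ _ (is_derive_expR (- x^-1)) (is_deriveN dinv)).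
  have dm : is_derive x 1 (fun y => p.[y^-1] * expR (- y^-1))
      (p.[x^-1] * (expR (- x^-1) * - (- x ^- 2)) +
       expR (- x^-1) * (p^`().[x^-1] * (- x ^- 2))).
    exact: (is_deriveM dh de).
  apply: (@near_eq_is_derive _ _ _ _ (flat p)); last first.
    apply: is_derive_eq dm _.
    rewrite /flat x0 /flat_deriv hornerM hornerXn hornerD hornerN exprVn; ring.
  by near=> y; rewrite /flat (_ : 0 < y)//; near: y; exact: lt_nbhsr.
- apply: (@is_derive_quadratic _ _ _ _ (flat_bound ('X ^+ 2 * p))) => h.
  by rewrite /flat ltxx mulr0 !subr0 add0r; exact: flat_le_sqr.
Unshelve. all: by end_near.
Qed.

End flat_function.

Section weighted_sum.
Variable R : realType.
Implicit Types (c u v : nat -> R) (M : R).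

(** The total weight is at most 1/4, and the flat function has derivative at most 4:
    profiles are thus 1-Lipschitz, and shears 2-Lipschitz. *)
Definition summable_weights c := forall k, 0 <= c k <= 8^-1 * 2 ^- k.

Definition weighted_sum c u : R := limn (series (fun k => c k * u k)).

Lemma partial_weights c n : summable_weights c -> \sum_(k < n) c k <= 4^-1.
Proof.
move=> cw; apply: (@le_trans _ _ (\sum_(k < n) 8^-1 * 2 ^- k)).
  by apply: ler_sum => k _; case/andP : (cw k).
by rewrite -mulr_sumr; have := @sum_geometric_half R n; lra.
Qed.

Lemma partial_weighted_le c u M n : summable_weights c -> (forall k, `|u k| <= M) ->
  \sum_(k < n) `|c k * u k| <= 4^-1 * M.
Proof.
move=> cw uM; have M0 : 0 <= M by rewrite (le_trans _ (uM 0%N)).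
rewrite (@le_trans _ _ ((\sum_(k < n) c k) * M))//.
  rewrite mulr_suml; apply: ler_sum => k _; have /andP[c0 _] := cw k.
  by rewrite normrM (ger0_norm c0) ler_wpM2l.
by rewrite ler_wpM2r// partial_weights.
Qed.

Lemma cvg_weighted_sum c u M : summable_weights c -> (forall k, `|u k| <= M) ->
  series (fun k => c k * u k) n @[n --> \oo] --> weighted_sum c u.
Proof.
move=> cw uM; apply: normed_cvg; apply: nondecreasing_is_cvgn.
  by apply: nondecreasing_series => n *; exact: normr_ge0.
exists (4^-1 * M) => _ [n _ <-].
have := partial_weighted_le n cw uM.
by rewrite -(big_mkord predT (fun k => `|c k * u k|)).
Qed.

Lemma weighted_sum_le c u M : summable_weights c -> (forall k, `|u k| <= M) ->
  `|weighted_sum c u| <= 4^-1 * M.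
Proof.
move=> cw uM; apply: cvg_norm_le (cvg_weighted_sum cw uM) _ => n.
rewrite /series/= big_mkord (le_trans (ler_norm_sum _ _ _))//.
exact: partial_weighted_le.
Qed.

Lemma weighted_sum_linear c u v (a b M N : R) : summable_weights c ->
  (forall k, `|u k| <= M) -> (forall k, `|v k| <= N) ->
  weighted_sum c (fun k => a * u k + b * v k) =
  a * weighted_sum c u + b * weighted_sum c v.
Proof.
move=> cw uM vN.
have h : (a * series (fun k => c k * u k) n + b * series (fun k => c k * v k) n)
    @[n --> \oo] --> a * weighted_sum c u + b * weighted_sum c v.
  by apply: cvgD; (apply: cvgM; [exact: cvg_cst|]);
    [exact: cvg_weighted_sum uM|exact: cvg_weighted_sum vN].
apply: cvg_lim => //; apply: cvg_trans h; apply: near_eq_cvg; apply: nearW => n.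
rewrite /series/= !mulr_sumr -big_split/=; apply: eq_bigr => k _; ring.
Qed.

Lemma weighted_sum_gt0 c u M k : summable_weights c -> (forall k, `|u k| <= M) ->
  (forall k, 0 <= u k) -> 0 < c k * u k -> 0 < weighted_sum c u.
Proof.
move=> cw uM u0 ck; apply: (lt_le_trans ck); rewrite /weighted_sum; apply: limr_ge.
  by apply/cvg_ex; exists (weighted_sum c u); exact: cvg_weighted_sum uM.
exists k.+1 => // n /= kn; rewrite /series/= big_mkord (bigD1 (Ordinal kn))//= lerDl.
by rewrite sumr_ge0// => j _; rewrite mulr_ge0//; case/andP : (cw j).
Qed.

End weighted_sum.

Section profile.
Variable R : realType.
Implicit Types (c a : nat -> R) (d : nat) (x h : R).

Definition flat_poly d : {poly R} := iter d (@flat_deriv R) 1.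

Definition flat_d d x : R := flat (flat_poly d) x.

Lemma flat_d_le d x : `|flat_d d x| <= flat_bound (flat_poly d).
Proof. exact: flat_le. Qed.

Lemma is_derive_flat_d d x : is_derive x 1 (flat_d d) (flat_d d.+1 x).
Proof. exact: is_derive_flat. Qed.

Definition profile_d c a d x : R := weighted_sum c (fun k => flat_d d (x - a k)).

(** Taylor's formula is summed term by term, its quadratic remainder being uniform
    in the term. *)
Lemma is_derive_profile c a d x : summable_weights c ->
  is_derive x 1 (profile_d c a d) (profile_d c a d.+1 x).
Proof.
move=> cw; pose M := flat_bound (flat_poly d.+2).
have M0 : 0 <= M by rewrite (le_trans _ (flat_d_le d.+2 0)).
apply: (@is_derive_quadratic _ _ _ _ (4^-1 * M)) => h.
have e : profile_d c a d (x + h) - profile_d c a d x - h * profile_d c a d.+1 x =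
    weighted_sum c (fun k => flat_d d (x - a k + h) - flat_d d (x - a k)
      - h * flat_d d.+1 (x - a k)).
  pose M1 := flat_bound (flat_poly d); pose M2 := flat_bound (flat_poly d.+1).
  have b1 (k : nat) : `|1 * flat_d d (x - a k + h) + -1 * flat_d d (x - a k)| <= M1 + M1.
    by rewrite mul1r mulN1r (le_trans (ler_normB _ _))// lerD// flat_d_le.
  transitivity (1 * weighted_sum c (fun k =>
      1 * flat_d d (x - a k + h) + -1 * flat_d d (x - a k))
      + (- h) * weighted_sum c (fun k => flat_d d.+1 (x - a k))).
    rewrite (weighted_sum_linear _ _ cw (fun k => flat_d_le d _) (fun k => flat_d_le d _)).
    rewrite /profile_d !mul1r mulN1r mulNr.
    rewrite (_ : (fun k => flat_d d (x + h - a k)) = (fun k => flat_d d (x - a k + h)))//.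
    by apply/funext => k; rewrite addrAC.
  rewrite -(weighted_sum_linear _ _ cw b1 (fun k => flat_d_le d.+1 _)).
  by congr weighted_sum; apply/funext => k; ring.
rewrite e -mulrA; apply: weighted_sum_le => // k.
apply: quadratic_remainder => y; [exact: is_derive_flat_d|exact: is_derive_flat_d|].
exact: flat_d_le.
Qed.

End profile.

Section shear_profile.
Variable R : realType.
Implicit Types (c a : nat -> R) (d : nat) (x y h : R).

Lemma flat0E (x : R) : flat_d 0 x = if 0 < x then expR (- x^-1) else 0.
Proof. by rewrite /flat_d /flat /=; case: ifP => // _; rewrite hornerC mul1r. Qed.

Lemma flat0_ge0 (x : R) : 0 <= flat_d 0 x.
Proof. by rewrite flat0E; case: ifP => // _; exact: expR_ge0. Qed.

Lemma flat0_le1 (x : R) : `|flat_d 0 x| <= 1.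
Proof.
rewrite ger0_norm ?flat0_ge0// flat0E; case: ifP => // x0.
by rewrite -expR0 ler_expR oppr_le0 invr_ge0 ltW.
Qed.

Lemma flat0_lt (x y : R) : x < y -> 0 < y -> flat_d 0 x < flat_d 0 y.
Proof.
move=> xy y0; rewrite !flat0E y0; case: ifPn => x0; last exact: expR_gt0.
by rewrite ltr_expR ltrN2 ltf_pV2 ?posrE.
Qed.

Lemma flat0_nondecreasing (x y : R) : x <= y -> flat_d 0 x <= flat_d 0 y.
Proof.
rewrite le_eqVlt => /orP[/eqP->//|xy]; have [y0|y0] := ltP 0 y.
  exact/ltW/flat0_lt.
by rewrite !flat0E !ltNge y0 (le_trans (ltW xy)).
Qed.

Lemma flat1_le4 (x : R) : `|flat_d 1 x| <= 4.
Proof.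
rewrite (le_trans (flat_d_le 1 x))// /flat_bound.
have -> : flat_poly R 1 = 'X ^+ 2 by rewrite /= /flat_deriv derivC subr0 mulr1.
rewrite size_polyXn !big_ord_recl big_ord0 /= !coefXn /=.
by rewrite !normr0 !mul0r !add0r normr1 addr0 mul1r ler_nat.
Qed.

Lemma flat0_lipschitz (x y : R) : `|flat_d 0 x - flat_d 0 y| <= 4 * `|x - y|.
Proof.
by apply: lipschitz_of_derive => z; [exact: is_derive_flat_d|exact: flat1_le4].
Qed.

Definition profile c a : R -> R := profile_d c a 0.

Lemma profile_lipschitz c a x y : summable_weights c ->
  `|profile c a x - profile c a y| <= `|x - y|.
Proof.
move=> cw; rewrite -[leRHS]mul1r.
apply: (@lipschitz_of_derive _ _ (profile_d c a 1)) => z; first exact: is_derive_profile.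
rewrite (le_trans (@weighted_sum_le _ _ _ 4 cw _)) ?mulVf// => k; exact: flat1_le4.
Qed.

(** The constant pi makes a shear act as a half turn where the profile vanishes. *)
Definition angle c a x : R := pi + profile c a (cos x).

Lemma angle_periodic c a x : angle c a (x + 2 * pi) = angle c a x.
Proof. by rewrite /angle cosD_tau. Qed.

Lemma angle_lipschitz c a x y : summable_weights c ->
  `|angle c a x - angle c a y| <= `|x - y|.
Proof.
move=> cw; rewrite /angle opprD addrACA subrr add0r.
by rewrite (le_trans (profile_lipschitz _ _ _ cw))// cos_lipschitz.
Qed.

(** A class of functions closed under differentiation that contains the angle; it
    replaces an explicit description of its higher derivatives. *)
Inductive smooth_term c a : (R -> R) -> Prop :=
| smooth_profile d : smooth_term c a (fun x => profile_d c a d (cos x))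
| smooth_cos : smooth_term c a cos
| smooth_sin : smooth_term c a sin
| smooth_id : smooth_term c a id
| smooth_cst (r : R) : smooth_term c a (fun=> r)
| smooth_add f g : smooth_term c a f -> smooth_term c a g ->
    smooth_term c a (fun x => f x + g x)
| smooth_mul f g : smooth_term c a f -> smooth_term c a g ->
    smooth_term c a (fun x => f x * g x).

Lemma smooth_term_derive c a f : summable_weights c -> smooth_term c a f ->
  exists2 g, smooth_term c a g & forall x, is_derive x 1 f (g x).
Proof.
move=> cw; elim => {f} [d|||||f g sf [f' sf' df] sg [g' sg' dg]|f g sf [f' sf' df] sg [g' sg' dg]].
- exists (fun x => profile_d c a d.+1 (cos x) * ((fun=> -1) x * sin x)).
    by apply: smooth_mul; [exact: smooth_profile|apply: smooth_mul;
      [exact: smooth_cst|exact: smooth_sin]].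
  move=> x; have := @is_derive1_comp R (profile_d c a d) cos x _ _
    (is_derive_profile _ _ _ cw) (is_derive_cos x).
  by rewrite /= mulN1r.
- exists (fun x => (fun=> -1) x * sin x).
    by apply: smooth_mul; [exact: smooth_cst|exact: smooth_sin].
  by move=> x; rewrite /= mulN1r; exact: is_derive_cos.
- by exists cos; [exact: smooth_cos|move=> x; exact: is_derive_sin].
- by exists (fun=> 1); [exact: smooth_cst|move=> x; exact: is_derive_id].
- by exists (fun=> 0); [exact: smooth_cst|move=> x; exact: (is_derive_cst r x 1)].
- exists (fun x => f' x + g' x); first exact: smooth_add.
  by move=> x; exact: (is_deriveD (df x) (dg x)).
- exists (fun x => f x * g' x + g x * f' x).
    by apply: smooth_add; exact: smooth_mul.
  by move=> x; exact: (is_deriveM (df x) (dg x)).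
Qed.

Lemma is_diff_of_derive (f : R -> R) x l : is_derive x 1 f l ->
  is_diff x f (fun h => h * l).
Proof.
move=> fl; have df : differentiable f x by apply/derivable1_diffP; exact: ex_derive.
apply: DiffDef => //; rewrite diff1E//; apply/funext => h.
by rewrite derive1E derive_val.
Qed.

(** The lifts of shears and all their iterated directional derivatives have this
    shape. *)
Definition planar (alpha gamma : R -> R) (b : R) (z : R * R) : R * R :=
  (alpha z.1, b * z.2 + gamma z.1).

Lemma is_diff_planar (alpha gamma alpha' gamma' : R -> R) (b : R) (z : R * R) :
  (forall x, is_derive x 1 alpha (alpha' x)) ->
  (forall x, is_derive x 1 gamma (gamma' x)) ->
  is_diff z (planar alpha gamma b)
    (fun v => (v.1 * alpha' z.1, b * v.2 + v.1 * gamma' z.1)).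
Proof.
move=> da dg.
have d1 : is_diff z (fst : R * R -> R) fst.
  pose L := GRing.isLinear.Build R (R * R)%type R _ (fst : R * R -> R) (fun _ _ _ => erefl).
  pose fl : {linear (R * R)%type -> R} := HB.pack (fst : R * R -> R) L.
  have cf : continuous fl by move=> w; exact: cvg_fst.
  have df : differentiable fl z by apply: linear_differentiable.
  by apply: DiffDef df _; apply: (@diff_lin _ _ _ fl).
have d2 : is_diff z (snd : R * R -> R) snd.
  pose L := GRing.isLinear.Build R (R * R)%type R _ (snd : R * R -> R) (fun _ _ _ => erefl).
  pose fl : {linear (R * R)%type -> R} := HB.pack (snd : R * R -> R) L.
  have cf : continuous fl by move=> w; exact: cvg_snd.
  have df : differentiable fl z by apply: linear_differentiable.
  by apply: DiffDef df _; apply: (@diff_lin _ _ _ fl).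
have a1 := is_diff_comp d1 (is_diff_of_derive (da z.1)).
have g1 := is_diff_comp d1 (is_diff_of_derive (dg z.1)).
exact: (is_diff_pair a1 (is_diffD (is_diffZ b d2) g1)).
Qed.

Lemma smooth_planar c a (alpha gamma : R -> R) (b : R) (z : R * R) vs :
  summable_weights c -> smooth_term c a alpha -> smooth_term c a gamma ->
  exists alpha' gamma' b', [/\ smooth_term c a alpha', smooth_term c a gamma' &
    iterated_derivative vs (planar alpha gamma b) = planar alpha' gamma' b'].
Proof.
move=> cw sa sg; elim: vs => [|v vs [a' [g' [b' [sa' sg' e]]]]].
  by exists alpha, gamma, b.
have [a'' sa'' da] := smooth_term_derive cw sa'.
have [g'' sg'' dg] := smooth_term_derive cw sg'.
exists (fun x => (fun=> v.1) x * a'' x), (fun x => (fun=> b' * v.2) x + (fun=> v.1) x * g'' x), 0.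
split.
- by apply: smooth_mul => //; exact: smooth_cst.
- by apply: smooth_add; [exact: smooth_cst|apply: smooth_mul => //; exact: smooth_cst].
- rewrite /= -/(iterated_derivative vs (planar alpha gamma b)) e.
  apply/funext => w; have dp := is_diff_planar b' w da dg.
  rewrite deriveE; last exact: ex_diff.
  by rewrite diff_val /planar /= mul0r add0r.
Qed.

Lemma smooth_near_planar c a (alpha gamma : R -> R) (b : R) (z : R * R) :
  summable_weights c -> smooth_term c a alpha -> smooth_term c a gamma ->
  smooth_near (planar alpha gamma b) z.
Proof.
move=> cw sa sg; near=> w => vs.
have [a' [g' [b' [sa' sg' ->]]]] := smooth_planar b w vs cw sa sg.
have [a'' _ da] := smooth_term_derive cw sa'.
have [g'' _ dg] := smooth_term_derive cw sg'.
by have dp := is_diff_planar b' w da dg; exact: ex_diff.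
Unshelve. all: by end_near.
Qed.

End shear_profile.

(** * Shears of the torus *)

Section rotation.
Variable R : realType.
Local Notation leb := (@lebesgue_measure R).
Local Notation BR := (measurableTypeR R).
Implicit Types (B : set R) (c : R).

Lemma measurable_translation c : measurable_fun [set: BR] (fun x : BR => (x + c : BR)).
Proof. exact: measurable_funD. Qed.

Lemma lebesgue_measure_translation c B : measurable (B : set BR) ->
  leb ((fun x => x + c) @^-1` B) = leb B.
Proof.
move=> mB.
change (pushforward leb (fun x : BR => (x + c : BR)) B = leb B).
apply/esym/lebesgue_measure_unique => //=; first exact: measurable_translation.
move=> _ _ [[a b]] _ <-; rewrite /pushforward.
rewrite (_ : _ @^-1` _ = `]a - c, b - c]%classic); last first.
  by apply/seteqP; split=> x /=; rewrite !in_itv/= ltrBlDr lerBrDr.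
rewrite !lebesgue_measure_itv/= !lte_fin ltrD2r.
by case: ifP => // _; rewrite -!EFinD; congr EFin; ring.
Qed.

Local Notation U := (uniform_prob (twopi_gt0 R)).
Local Notation tau := (2 * pi : R).

Lemma uniform_probE B : measurable (B : set BR) ->
  U B = (tau^-1%:E * leb (B `&` `[0%R, tau[))%E.
Proof.
move=> mB; rewrite /uniform_prob integral_uniform_pdf.
have mI : measurable (B `&` `[0, tau] : set BR).
  by apply: measurableI => //; exact: measurable_itv.
have mJ : measurable (B `&` `[0, tau[ : set BR).
  by apply: measurableI => //; exact: measurable_itv.
rewrite (eq_integral (fun=> tau^-1%:E)); last first.
  move=> x; rewrite inE => -[_]; rewrite /= in_itv/= => x01.
  by rewrite /uniform_pdf x01 subr0.
rewrite integral_cst//; congr (_ * _)%E.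
apply/eqP; rewrite eq_le; apply/andP; split.
  rewrite -[leRHS]adde0 -(lebesgue_measure_set1 tau).
  apply: le_trans (measureU2 leb mJ (measurable_set1 tau)).
  apply: le_measure; rewrite ?inE//; first exact: measurableU.
  move=> x [Bx]; rewrite /= in_itv/= => /andP[x0].
  rewrite le_eqVlt => /orP[/eqP ->|x1]; [by right|left].
  by split => //=; rewrite in_itv/= x0.
apply: le_measure; rewrite ?inE// => x [Bx]; rewrite /= in_itv/= => /andP[x0 x1].
by split => //=; rewrite in_itv/= x0 ltW.
Qed.

(** A rotation by c in [0, 2 pi[ moves [0, 2 pi - c[ onto [c, 2 pi[ and the rest,
    up to a full turn, onto [0, c[; each piece is translated. *)
Lemma uniform_prob_rotation c B : measurable (B : set BR) ->
  (forall x, B (x + tau) <-> B x) -> U ((fun x => x + c) @^-1` B) = U B.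
Proof.
move=> mB perB.
have perN (n : nat) x : B (x + tau * n%:R) <-> B x.
  elim: n x => [|n IH] x; first by rewrite mulr0 addr0.
  by rewrite -[n.+1%:R]natr1 [tau * _]mulrDr mulr1 addrA perB.
have perZ (m : int) x : B (x + tau * m%:~R) <-> B x.
  case: m => n; first exact: perN.
  by rewrite NegzE mulrNz mulrN -(perN n.+1) -pmulrn subrK.
(* by periodicity of B, c may be reduced modulo 2 pi *)
have [m cm] := wrapE c; set c' := wrap c in cm.
have -> : (fun x => x + c) @^-1` B = (fun x => x + c') @^-1` B.
  by apply/seteqP; split=> x /=; rewrite cm addrA perZ.
have /andP[c0 c1] : 0 <= c' < tau by exact: wrap_itv.
have mt (e : R) : measurable ((fun x : R => x + e) @^-1` B : set BR).
  by rewrite -[X in measurable X]setTI; exact: measurable_translation.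
rewrite !uniform_probE//; congr (_ * _)%E.
have mc (D : set R) (a b : R) : measurable (D : set BR) ->
    measurable (D `&` `[a, b[ : set BR).
  by move=> mD; apply: measurableI => //; exact: measurable_itv.
have split_itv (D : set R) (b : R) : 0 <= b <= tau -> measurable (D : set BR) ->
    leb (D `&` `[0, tau[) = (leb (D `&` `[0%R, b[) + leb (D `&` `[b, tau[))%E.
  move=> /andP[b0 b1] mD; rewrite -measureU; [|exact: mc|exact: mc|].
    congr (leb _); rewrite -setIUr; congr (_ `&` _); apply/seteqP; split=> x /=.
      rewrite !in_itv/= => /andP[x0 x1]; have [xb|xb] := ltP x b; [left|right].
        by rewrite x0.
      by rewrite x1.
    by rewrite !in_itv/= => -[|] /andP[x0 x1]; apply/andP; split => //; lra.
  apply/seteqP; split=> // x [[_ /=]]; rewrite in_itv/= => /andP[_ x1] [_ /=].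
  by rewrite in_itv/= => /andP[x2 _]; move: x1; rewrite ltNge x2.
have h1 : 0 <= tau - c' <= tau by apply/andP; split; lra.
have h2 : 0 <= c' <= tau by rewrite c0 ltW.
rewrite (split_itv _ _ h1 (mt c')) (split_itv B c' h2 mB) addeC; congr (_ + _)%E.
- rewrite -(lebesgue_measure_translation (c' - tau) (B := B `&` `[0, c'[)); last exact: mc.
  congr (leb _); apply/seteqP; split=> x /=; rewrite !in_itv/=.
    move=> [Bx /andP[x0 x1]]; split; last by apply/andP; split; lra.
    by rewrite -perB (_ : x + (c' - tau) + tau = x + c')//; ring.
  move=> [Bx /andP[x0 x1]]; split; last by apply/andP; split; lra.
  by rewrite (_ : x + c' = x + (c' - tau) + tau) ?perB//; ring.
- rewrite -(lebesgue_measure_translation c' (B := B `&` `[c', tau[)); last exact: mc.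
  congr (leb _); apply/seteqP; split=> x /=; rewrite !in_itv/=.
    by move=> [Bx /andP[x0 x1]]; split => //; apply/andP; split; lra.
  by move=> [Bx /andP[x0 x1]]; split => //; apply/andP; split; lra.
Qed.

End rotation.

Section shear.
Variable R : realType.
Local Notation torus := (torus R).
Local Notation mu := (torus_measure R).
Local Notation BR := (measurableTypeR R).
Local Notation tau := (2 * pi : R).
Implicit Types (phi : R -> R) (x y : torus).

Definition shear phi x : torus := (x.1, circle_of (val x.2 + phi (val x.1))).

Lemma shearK phi : cancel (shear phi) (shear (fun t => - phi t)).
Proof.
move=> [x y]; congr pair => /=.
by rewrite circle_of_wrapD addrK circle_ofK.
Qed.

Lemma shearNK phi : cancel (shear (fun t => - phi t)) (shear phi).
Proof.
move=> [x y]; congr pair => /=.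
by rewrite circle_of_wrapD subrK circle_ofK.
Qed.

Section regular.
Variable phi : R -> R.
Hypothesis phi_per : forall t, phi (t + tau) = phi t.
Hypothesis phi_lip : forall s t, `|phi s - phi t| <= `|s - t|.

Lemma shear_lipschitz x y : mdist (shear phi x) (shear phi y) <= 2 * mdist x y.
Proof.
have a0 := circle_dist_ge0 x.1 y.1; have b0 := circle_dist_ge0 x.2 y.2.
have h : circle_dist (circle_of (val x.2 + phi (val x.1)))
    (circle_of (val y.2 + phi (val y.1))) <= circle_dist x.2 y.2 + circle_dist x.1 y.1.
  rewrite (le_trans (circle_dist_ofD _ _ _ _))// lerD2l.
  rewrite (le_trans (circle_dist_of _ _))// -[leRHS]mul1r.
  by apply: periodic_lipschitz => // s t; rewrite mul1r.
have c0 := circle_dist_ge0 (circle_of (val x.2 + phi (val x.1)))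
    (circle_of (val y.2 + phi (val y.1))).
rewrite !mdist_torusE /=; set a := circle_dist x.1 _ in a0 h *.
set b := circle_dist x.2 _ in b0 h *; set c := circle_dist (circle_of _) _ in h c0 *.
rewrite -[X in X * _]ger0_norm// -sqrtr_sqr -sqrtrM ?sqr_ge0// ler_sqrt; last first.
  by rewrite mulr_ge0 ?addr_ge0 ?sqr_ge0.
have : c ^+ 2 <= (b + a) ^+ 2 by rewrite ler_pXn2r// nnegrE// addr_ge0.
have : 0 <= (a - b) ^+ 2 by exact: sqr_ge0.
have := sqr_ge0 b; nra.
Qed.

Lemma shear_torus_of (w : R * R) :
  shear phi (torus_of w) = torus_of (w.1, w.2 + phi w.1).
Proof.
by rewrite /shear /torus_of /= circle_of_wrapD (periodic_wrap _ phi_per).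
Qed.

Lemma phi_continuous : continuous phi.
Proof.
move=> t A /nbhs_ballP[e e0 eA]; apply/nbhs_ballP; exists e => // s ts.
by apply: eA; exact: le_lt_trans (phi_lip t s) ts.
Qed.

Lemma phi_measurable : measurable_fun [set: BR] (phi : BR -> BR).
Proof. by apply: continuous_measurable_fun; exact: phi_continuous. Qed.

Lemma shear_measurable : measurable_fun setT (shear phi).
Proof.
apply/measurable_fun_pair; first exact: measurable_fst.
apply: (measurableT_comp (@measurable_circle_of R)).
apply: measurable_funD; first exact: measurable_val2.
exact: (measurableT_comp phi_measurable (@measurable_val1 R)).
Qed.

(** Fubini's theorem reduces the claim to the rotations of the vertical circles. *)
Lemma shear_measure_preserving : measure_preserving (shear phi).
Proof.
split; first exact: shear_measurable.
move=> A mA; rewrite !torus_measureE.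
set B := (@torus_of R) @^-1` A.
have mB : measurable (B : set (BR * BR)).
  by rewrite -[X in measurable X]setTI; exact: measurable_torus_of.
rewrite (_ : (@torus_of R) @^-1` (shear phi @^-1` A) =
   (fun w => B (w.1, w.2 + phi w.1))); last first.
  by apply/funext => w; rewrite /preimage/= shear_torus_of.
rewrite /product_measure1; apply: eq_integral => x _ /=.
have mBx : measurable (xsection B x : set BR) by exact: measurable_xsection.
rewrite -(uniform_prob_rotation (phi x) mBx).
  by congr uniform_prob; apply/seteqP; split=> y; rewrite /= /xsection/= !inE.
move=> y; rewrite /xsection/= !inE /B /= /torus_of /=.
by rewrite -[X in _ + X]mulr1 -[1](_ : 1%:~R = 1)// circle_ofD.
Qed.

End regular.

Definition shear_map (c a : nat -> R) := shear (angle c a).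

Lemma shear_map_Omega_p c a : summable_weights c -> Omega_p_pred (shear_map c a).
Proof.
move=> cw; have per := angle_periodic c a.
have lip s t := angle_lipschitz a s t cw.
split.
- move=> z; exists (planar id (angle c a) 1).
    apply: (@smooth_near_planar _ c a) => //; first exact: smooth_id.
    exact: (smooth_add (smooth_cst c a pi) (smooth_profile c a 0)).
  by near=> w; rewrite /shear_map shear_torus_of// /planar mul1r.
- exact: shear_measure_preserving.
- exists (shear (fun t => - angle c a t)); split.
  + exact: shearK.
  + exact: shearNK.
  + by apply: le_Lip => // x y; exact: shear_lipschitz.
  + apply: le_Lip => // x y; apply: shear_lipschitz => [t|s t]; first by rewrite per.
    by rewrite -opprD normrN.
Unshelve. all: by end_near.
Qed.

End shear.

(** * Eigenvalues of the shears *)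

Section shear_states.
Variable R : realType.
Local Notation torus := (torus R).
Local Notation mu := (torus_measure R).
Local Notation C := (R[i])^o.
Local Notation Re := (@complex.Re R).
Local Notation Im := (@complex.Im R).
Local Notation tau := (2 * pi : R).
Import Normc.
Implicit Types (c a : nat -> R).

Lemma measure_val1 (B : set R) : measurable (B : set (measurableTypeR R)) ->
  mu [set x : torus | B (val x.1)] =
  uniform_prob (twopi_gt0 R) ((@Defs.wrap R) @^-1` B).
Proof.
move=> mB; rewrite torus_measureE.
rewrite (_ : _ @^-1` _ = ((@Defs.wrap R) @^-1` B) `*` setT); last first.
  by apply/seteqP; split=> w /= => [|[]].
rewrite product_measure1E//.
  transitivity (uniform_prob (twopi_gt0 R) ((@Defs.wrap R) @^-1` B) * 1)%E; last by rewrite mule1.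
  by congr (_ * _)%E; exact: probability_setT.
by rewrite -[X in measurable X]setTI; exact: measurable_wrap.
Qed.

Lemma measure_point1 (t : R) : mu [set x : torus | val x.1 = t] = 0%E.
Proof.
have mt : measurable ([set t] : set (measurableTypeR R)) by [].
rewrite (measure_val1 mt) uniform_probE; last first.
  by rewrite -[X in measurable X]setTI; exact: measurable_wrap.
apply/eqP; rewrite mule_eq0; apply/orP; right.
rewrite -measure_le0 -(lebesgue_measure_set1 t); apply: le_measure; rewrite ?inE.
- apply: measurableI; last exact: measurable_itv.
  by rewrite -[X in measurable X]setTI; exact: measurable_wrap.
- exact: measurable_set1.
- by move=> x [/= <-]; rewrite in_itv/= => x01; rewrite wrap_id.
Qed.

Lemma ae_point1 (t : R) : {ae mu, forall x : torus, val x.1 <> t}.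
Proof.
exists [set x : torus | val x.1 = t]; split; last by move=> x /= /contrapT.
  rewrite (_ : [set x : torus | _] = (fun x : torus => val x.1) @^-1` [set t])//.
  rewrite -[X in measurable X]setTI; apply: (@measurable_val1 R) => //.
exact: measure_point1.
Qed.

(** A strip on which the shear is a half turn carries an eigenfunction for -1: the
    sign that distinguishes the two halves of the vertical circles. *)
Section plateau.
Variables (c a : nat -> R) (b : R).
Hypothesis b1 : -1 < b <= 1.
Hypothesis flat_b : forall k, c k = 0 \/ b <= a k.

Lemma profile_plateau y : y <= b -> profile c a y = 0.
Proof.
move=> yb; rewrite /profile /profile_d /weighted_sum.
rewrite (_ : series _ = (fun=> 0)); first by apply: cvg_lim => //; exact: cvg_cst.
apply/funext => n; rewrite /series/= big1// => k _.
have [->|ak] := flat_b k; first by rewrite mul0r.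
by rewrite flat0E ltNge subr_le0 (le_trans yb ak)/= mulr0.
Qed.

Lemma wrap_half_turn (t : R) : 0 <= t < tau -> (wrap (t + pi) < pi) = ~~ (t < pi).
Proof.
move=> /andP[t0 t2]; have [tp|tp] := ltP t pi.
  by rewrite wrap_id ?ltNge ?lerDr ?t0//; apply/andP; split; lra.
have e : t + pi = (t - pi) + tau * 1%:~R by rewrite mulr1z; ring.
by rewrite e wrapD wrap_id; [|apply/andP; split]; lra.
Qed.

Definition half_sign (x : torus) : C :=
  Complex ((cos (val x.1) <= b)%R%:R * (if val x.2 < pi then 1 else -1)) 0.

Lemma half_sign_shear x : half_sign (shear_map c a x) = -1 * half_sign x.
Proof.
case: x => x y; rewrite /half_sign /=; have [xb|xb] := leP (cos (val x)) b; last first.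
  by rewrite !mul0r; apply/eqP; rewrite eq_complex /=; apply/andP; split; apply/eqP; ring.
rewrite !mul1r /angle profile_plateau// addr0 wrap_half_turn; last exact: (valP y).
apply/eqP; rewrite eq_complex /=; case: (_ < pi) => /=; apply/andP; split; apply/eqP; ring.
Qed.

Lemma half_sign_measurable : measurable_fun setT (fun x => Re (half_sign x)).
Proof.
rewrite /half_sign /=; apply: measurable_funM.
  apply: (measurableT_comp (f := fun u : bool => u%:R : R)) => //.
  apply: measurable_fun_ler => //.
  apply: measurableT_comp (@measurable_val1 R).
  by apply: continuous_measurable_fun; exact: continuous_cos.
apply: measurable_fun_if => //.
by apply: measurable_fun_ltr => //; exact: measurable_val2.
Qed.

Lemma half_sign_norm x : normc (half_sign x) <= 1.
Proof.
rewrite -(@ler_pXn2r _ 2)// ?nnegrE ?normc_ge0// normc_sqrE /= expr0n addr0 expr1n.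
by case: ifP => _; case: (_ <= b); rewrite ?mul0r ?mul1r ?expr0n ?sqrrN ?expr1n.
Qed.

Lemma half_sign_eq0 x : half_sign x = 0 -> ~ (cos (val x.1) <= b).
Proof.
move=> [+] xb; rewrite xb mul1r; case: ifP => _ /eqP; rewrite ?oppr_eq0 oner_eq0//.
Qed.

Lemma plateau_measure : (0 < mu [set x : torus | (acos b <= val x.1 <= pi)%R])%E.
Proof.
have /andP[b0 b2] := b1.
have s0 : 0 <= acos b by apply: acos_ge0; rewrite b2 ltW.
have sp : acos b < pi by apply: acos_ltpi.
have mI : measurable (`[acos b, pi]%classic : set (measurableTypeR R)) by exact: measurable_itv.
have -> : [set x : torus | acos b <= val x.1 <= pi] =
    [set x : torus | `[acos b, pi]%classic (val x.1)].
  by apply/seteqP; split=> x /=; rewrite in_itv.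
rewrite (measure_val1 mI) uniform_probE; last first.
  by rewrite -[X in measurable X]setTI; exact: measurable_wrap.
rewrite mule_gt0// ?lte_fin ?invr_gt0 ?twopi_gt0//.
rewrite (_ : _ `&` _ = `[acos b, pi]%classic).
  by rewrite lebesgue_measure_itv/= lte_fin sp -EFinD lte_fin subr_gt0.
have p0 := pi_gt0 R.
apply/seteqP; split=> x /=; rewrite !in_itv/=.
  by move=> [h x02]; move: h; rewrite wrap_id.
move=> /andP[x0 x1].
have x02 : 0 <= x < tau by apply/andP; split; lra.
by rewrite wrap_id// x0 x1.
Qed.

Lemma eigenvalue_plateau : Defs.eigenvalue (shear_map c a) (-1).
Proof.
exists half_sign; split.
- split; first exact: half_sign_measurable.
    exact: measurable_cst.
  rewrite /sqnorm; apply: (@le_lt_trans _ _ (\int[mu]_x (cst 1%:E x))%E); last first.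
    rewrite integral_cst//; apply: lte_mul_pinfty => //.
    exact: le_lt_trans (probability_le1 _ _) (ltry _).
  apply: ge0_le_integral => //.
  + by move=> x _; rewrite lee_fin sqr_ge0.
  + apply/measurable_EFinP.
    rewrite (_ : (fun x => _) = (fun x => Re (half_sign x) ^+ 2)).
      by apply: measurable_funX; exact: half_sign_measurable.
    by apply/funext => x; rewrite normc_sqrE /= expr0n addr0.
  + by move=> x _; rewrite lee_fin exprn_ile1 ?normc_ge0// half_sign_norm.
- move=> [N [mN N0 sN]].
  have := plateau_measure; rewrite ltNge => /negP; apply; rewrite -N0.
  apply: le_measure; rewrite ?inE//.
    rewrite (_ : [set x : torus | _] = (fun x : torus => val x.1) @^-1` `[acos b, pi]%classic).
      by rewrite -[X in measurable X]setTI; apply: (@measurable_val1 R) => //; exact: measurable_itv.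
    by apply/seteqP; split=> x /=; rewrite in_itv.
  move=> x /= /andP[x0 x1]; apply: sN => /= /(_ I)/half_sign_eq0; apply.
  have /andP[b0 b2] := b1; have b11 : -1 <= b <= 1 by rewrite b2 ltW.
  rewrite -[leRHS]acosK ?in_itv//= leNgt ltr_cos ?in_itv/= -?leNgt//.
    by rewrite x1 (le_trans _ x0)// acos_ge0.
  by rewrite acos_ge0// acos_lepi.
- apply: aeW => x _; rewrite /koopman /=; exact: half_sign_shear.
Qed.

End plateau.

(** A single term with a_i = -1 suffices to make the profile strictly increasing on
    [-1, 1], as every term is nondecreasing. *)
Section strict_profile.
Variables (c a : nat -> R) (i : nat).
Hypothesis cw : summable_weights c.
Hypothesis ci : 0 < c i.
Hypothesis ai : a i = -1.

Lemma profile_increasing y z : -1 <= y -> y < z -> profile c a y < profile c a z.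
Proof.
move=> y1 yz; rewrite -subr_gt0.
have -> : profile c a z - profile c a y =
    weighted_sum c (fun k => 1 * flat_d 0 (z - a k) + -1 * flat_d 0 (y - a k)).
  by rewrite (weighted_sum_linear _ _ cw (fun k => flat0_le1 _) (fun k => flat0_le1 _)) mul1r mulN1r.
apply: (@weighted_sum_gt0 _ _ _ 2 i) => // [k|k|].
- by rewrite mul1r mulN1r (le_trans (ler_normB _ _))// (_ : 2 = 1 + 1)// lerD// flat0_le1.
- by rewrite mul1r mulN1r subr_ge0 flat0_nondecreasing// lerD2r ltW.
- rewrite mulr_gt0// mul1r mulN1r subr_gt0 ai flat0_lt ?ltrD2r//.
  by rewrite opprK; lra.
Qed.

Lemma cos_level (y t : R) : 0 <= t < tau -> cos t = y ->
  t = acos y \/ t = tau - acos y.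
Proof.
move=> /andP[t0 t2] <-; have [tp|tp] := leP t pi.
  by left; rewrite cosK// in_itv/= t0.
right; have e : cos t = cos (tau - t) by rewrite -cosN -cosD_tau; congr cos; ring.
rewrite e cosK ?in_itv/=; first by ring.
by apply/andP; split; lra.
Qed.

(** A level set of the angle is contained in a level set of the cosine. *)
Lemma ae_angle_neq (t : R) : {ae mu, forall x : torus, angle c a (val x.1) <> t}.
Proof.
have [[x0 x0t]|no] := pselect (exists x : torus, angle c a (val x.1) = t); last first.
  by apply: aeW => x xt; apply: no; exists x.
pose y := cos (val x0.1).
apply: filterS2 (ae_point1 (acos y)) (ae_point1 (tau - acos y)) => x h1 h2 xt.
have cosE : cos (val x.1) = y.
  have : profile c a (cos (val x.1)) = profile c a y.
    by apply: (addrI pi); rewrite -/(angle c a _) xt -x0t.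
  rewrite /y; have [||//] := ltgtP (cos (val x.1)) (cos (val x0.1)).
    by move=> /(profile_increasing (cos_geN1 _)); rewrite lt_neqAle => /andP[/eqP].
  by move=> /(profile_increasing (cos_geN1 _)); rewrite lt_neqAle => /andP[/eqP + _] => /nesym.
by have [] := cos_level (valP x.1) cosE.
Qed.

Lemma cos_eq1 (t : R) : cos t = 1 -> exists m : int, t = tau * m%:~R.
Proof.
move=> ct; have [m wm] := wrapE t.
have w02 := wrap_itv t; have cw1 : cos (wrap t) = 1 by rewrite periodic_wrap//; exact: cosD_tau.
suff w0 : wrap t = 0 by exists (- m); rewrite mulrNz mulrN; move: wm; rewrite w0; lra.
have [e|e] := cos_level w02 cw1; rewrite acos1 in e => //.
by move: w02; rewrite e subr0 ltxx andbF.
Qed.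

Section twist.
Variables (lambda : C) (k m : int).
Hypothesis l1 : normc lambda = 1.
Hypothesis lambda1 : lambda <> 1.

(** The shear turns lambda * e into e times this function of modulus 1, which is
    itself invariant under the shear; binomial averages of the orbit of e are
    therefore e times powers of (1 + twist) / 2. *)
Definition twist (x : torus) : C :=
  lambda * Complex (cos (m%:~R * angle c a (val x.1))) (sin (m%:~R * angle c a (val x.1))).

(** The exceptional points lie in countably many level sets of the angle, one for
    each value that it may take there; if m = 0, the twist is the constant lambda. *)
Lemma ae_twist_neq1 : {ae mu, forall x, twist x <> 1}.
Proof.
have [m0|m0] := eqVneq m 0.
  apply: aeW => x; rewrite /twist m0 mul0r cos0 sin0 => h; apply: lambda1.
  by rewrite -h; apply/eqP; rewrite eq_complex /=; case: (lambda) => u v /=;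
    apply/andP; split; apply/eqP; ring.
have [[x0 x01]|no] := pselect (exists x, twist x = 1); last first.
  by apply: aeW => x xt; apply: no; exists x.
pose t0 := angle c a (val x0.1).
pose value (j : int) := t0 + tau * j%:~R / m%:~R.
have h : {ae mu, forall x : torus, forall n : nat,
    forall j : int, @unpickle int n = Some j -> angle c a (val x.1) <> value j}.
  apply: ae_foralln => n; case: unpickle => [j|]; last by apply: aeW => x j.
  by apply: filterS (ae_angle_neq (value j)) => x h j' [<-].
apply: filterS h => x h xt.
have mr0 : m%:~R != 0 :> R by rewrite intr_eq0.
have l0 : lambda != 0 by apply/eqP => l0; move: l1; rewrite l0 normc0 => /esym/eqP; rewrite oner_eq0.
have e : twist x = twist x0 by rewrite xt x01.
move: e => /(mulfI l0) [ec es].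
have : cos (m%:~R * angle c a (val x.1) - m%:~R * t0) = 1.
  by rewrite cosB ec es -!expr2 cos2Dsin2.
move=> /cos_eq1 [j ej].
apply: (h (pickle j) j (pickleK j)); rewrite /value -ej.
by field.
Qed.

Fixpoint binomial_average (n : nat) : average :=
  if n is n'.+1 then Mid (binomial_average n') (Shift (binomial_average n')) else Seed.

Lemma character_shear x : lambda * character k m (shear_map c a x) = character k m x * twist x.
Proof.
rewrite /twist mulrCA; congr (_ * _).
have phE (f : R -> R) : (forall t, f (t + tau) = f t) ->
    f (phase k m (shear_map c a x)) = f (phase k m x + m%:~R * angle c a (val x.1)).
  move=> fp; rewrite /phase /shear_map /shear /=.
  have [j ->] := wrapE (val x.2 + angle c a (val x.1)).
  rewrite -[RHS](periodic_int (m * j) _ fp) intrM /=; congr f.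
  move: (val x.1) (val x.2) (angle _ _ _) => u v w; ring.
rewrite /character (phE cos (@cosD_tau R)) (phE sin (@sinD_tau R)) cosD sinD.
by apply/eqP; rewrite eq_complex /=; apply/andP; split; apply/eqP; ring.
Qed.

Lemma avg_binomial n x : avg (shear_map c a) lambda k m (binomial_average n) x =
  character k m x * (Complex (2^-1) 0 * (1 + twist x)) ^+ n.
Proof.
elim: n x => [|n IH] x; first by rewrite expr0 mulr1.
rewrite [LHS]/= !IH.
have tF : twist (shear_map c a x) = twist x by [].
rewrite tF mulrA character_shear exprS.
set w := (_ * (1 + _)) ^+ n; set e := character k m x; set t := twist x.
transitivity (Complex (2^-1) 0 * (e * w + e * t * w)); last by ring.
by apply/eqP; rewrite eq_complex /=; apply/andP; split; apply/eqP;
  case: (e * w) (e * t * w) => u v [u' v'] /=; ring.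
Qed.

(** The midpoint of 1 and a point of the unit circle other than 1 lies inside the
    unit disc, so its powers tend to 0. *)
Lemma binomial_energy_cvg0 :
  energy (avg (shear_map c a) lambda k m (binomial_average n)) @[n --> \oo] --> (0 : R).
Proof.
have [_ [mF _] _] := shear_map_Omega_p a cw.
pose q x := normc (Complex (2^-1) 0 * (1 + twist x)) ^+ 2.
have t1 x : normc (twist x) = 1.
  by rewrite normcM l1 mul1r /= cos2Dsin2 sqrtr1.
have qE x : q x = 2^-1 * (1 + Re (twist x)).
  have := congr1 (fun u => u ^+ 2) (t1 x); rewrite /q !normc_sqrE expr1n.
  rewrite Re_mulc Im_mulc; case: (twist x) => u v /= uv.
  transitivity (4^-1 * (1 + 2 * u + (u ^+ 2 + v ^+ 2))); first by field.
  by rewrite uv; field.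
have eE n x : Re (avg (shear_map c a) lambda k m (binomial_average n) x) ^+ 2 +
    Im (avg (shear_map c a) lambda k m (binomial_average n) x) ^+ 2 = q x ^+ n.
  rewrite -normc_sqrE avg_binomial normcM.
  have -> : normc (character k m x) = 1 by rewrite /= cos2Dsin2 sqrtr1.
  rewrite mul1r /q -exprM mulnC exprM; congr (_ ^+ 2).
  by elim: n => [|n IH]; rewrite ?expr0 ?normc1// !exprS normcM IH.
rewrite -[X in _ --> X](_ : (\int[mu]_x (0 : R))%R = 0); last first.
  by rewrite Rintegral_cst// mul0r.
apply: (@cvg_Rintegral _ _ _ mu _ _ (fun=> 1)).
- move=> n; have [mr mi] := avg_measurable lambda k m (binomial_average n) mF.
  exact: (measurable_sumsq mr mi).
- exact: measurable_cst.
- exact: finite_measure_integrable_cst.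
- by move=> n x; rewrite ger0_norm ?addr_ge0 ?sqr_ge0// avg_le1.
- apply: filterS ae_twist_neq1 => x tx.
  under eq_fun do rewrite eE.
  apply: cvg_expr; rewrite ger0_norm; last by rewrite /q sqr_ge0.
  have := congr1 (fun u => u ^+ 2) (t1 x); rewrite qE normc_sqrE expr1n => uv.
  have [u1|u1] := ltP (Re (twist x)) 1; first by lra.
  exfalso; apply: tx; move: uv u1; case: (twist x) => u v /= uv u1.
  have v0 : v = 0.
    by apply/eqP; rewrite -sqrf_eq0 eq_le sqr_ge0 andbT; nra.
  have uu : u = 1 by move: uv; rewrite v0 expr0n addr0 => uv; nra.
  by rewrite v0 uu.
Qed.

End twist.

(** For an eigenvalue lambda the averages of some character have energy bounded
    below, whereas the binomial ones have energy tending to 0 if lambda <> 1. *)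
Lemma eigenvalue_strict lambda : Defs.eigenvalue (shear_map c a) lambda -> lambda = 1.
Proof.
move=> ev; apply: contrapT => lambda1.
have [_ mp _] := shear_map_Omega_p a cw.
have l1 := eigenvalue_normc mp ev.
have [k [m [d d0 de]]] := eigenvalue_energy mp ev.
have c0 := binomial_energy_cvg0 k m l1 lambda1.
suff : d <= 0 by rewrite leNgt d0.
rewrite -(cvg_lim _ c0)//; apply: limr_ge; last by apply: nearW => n; exact: de.
by apply/cvg_ex; exists 0.
Qed.

End strict_profile.

End shear_states.

(** * Probabilistic runs as events on the coins *)

Section coin_events.
Variable R : realType.
Local Notation P := (coin_measure R).

(** By induction on the number of coins, conditioning on the last one. *)
Lemma measurable_finitely_determined (r : nat) (S : set coins) :
  (forall a b : coins, (forall j, (j < r)%N -> a j = b j) -> S a -> S b) -> measurable S.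
Proof.
elim: r S => [|r IH] S Sr.
  have [[a Sa]|S0] := pselect (exists a, S a).
    rewrite (_ : S = setT); first exact: measurableT.
    by apply/seteqP; split=> // b _; apply: Sr Sa.
  rewrite (_ : S = set0); first exact: measurable0.
  by apply/seteqP; split=> // b Sb; case: S0; exists b.
pose replace (c : bool) (a : coins) : coins := fun j => if j == r then c else a j.
pose heads : set coins := [set a : coins | a r = true].
have mh : measurable heads by apply: sub_sigma_algebra; exists r.
have mS c : measurable [set a | S (replace c a)].
  apply: IH => a b ab; apply: Sr => j; rewrite ltnS leq_eqVlt /replace.
  by case: eqP => //= _; exact: ab.
have replaceK a j : replace (a r) a j = a j by rewrite /replace; case: eqP => // ->.
rewrite (_ : S = (heads `&` [set a | S (replace true a)]) `|`
                 (~` heads `&` [set a | S (replace false a)])).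
  by apply: measurableU; apply: measurableI => //; exact: measurableC.
apply/seteqP; split=> a.
  move=> Sa; rewrite /heads /=; case ar : (a r); [left|right]; split => //; rewrite -ar;
    by apply: Sr Sa => j _; rewrite replaceK.
rewrite /heads /= => -[[ar]|[/negP/negPf ar]]; rewrite -{1}ar; apply: Sr => j _;
  exact: replaceK.
Qed.

Lemma bigcup_gt (E : nat -> set coins) (x : \bar R) :
  (forall r, measurable (E r)) -> {homo E : m n / (m <= n)%N >-> m `<=` n} ->
  (x < P (\bigcup_r E r))%E -> forall q, exists2 r, (q <= r)%N & (x < P (E r))%E.
Proof.
move=> mE E_mono xE q.
have mU : measurable (\bigcup_r E r) by exact: bigcupT_measurable.
have ndE : nondecreasing_seq E by move=> m n mn; apply/subsetPset; exact: E_mono.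
have h := nondecreasing_cvg_mu (mu := P) mE mU ndE.
have [r xr] : exists r, (x < P (E r))%E.
  apply: contrapT => /forallNP no; move: xE; rewrite ltNge => /negP; apply.
  rewrite -(cvg_lim (@ereal_hausdorff R) h); apply: lime_le; first exact: cvgP h.
  by apply: nearW => r; rewrite leNgt; apply/negP; exact: no.
exists (maxn q r); first exact: leq_maxl.
by rewrite (lt_le_trans xr)// le_measure ?inE//; apply: E_mono; exact: leq_maxr.
Qed.

Lemma disjoint_half (E F : set coins) : measurable E -> measurable F ->
  (2^-1%:E < P E)%E -> (2^-1%:E < P F)%E -> E `&` F !=set0.
Proof.
move=> mE mF E2 F2; apply: contrapT => /set0P/negP; rewrite negbK => /eqP EF.
have := measureU P mE mF EF; have := probability_le1 P (measurableU _ _ mE mF).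
move=> + e; rewrite e leNgt => /negP; apply.
rewrite (_ : 1%E = (2^-1 + 2^-1)%:E); last by congr (_%:E); field.
by rewrite EFinD; exact: lteD.
Qed.

End coin_events.

Section certified_runs.
Variables (R : realType) (M V : metricType R) (Q : comp_problem M V).
Variable known : nat -> set (info_index Q).
Hypothesis known_mono : forall r s, (r <= s)%N -> known r `<=` known s.
Hypothesis known_all : forall i, exists r, known r i.
Variable Gamma : problem_dom Q * coins -> option M.
Hypothesis Gamma_alg : @probabilistic_general_algorithm R M V Q Gamma.
Local Notation P := (coin_measure R).
Implicit Types (U : set M) (A B : problem_dom Q) (a b : coins).

Definition outputs_in U A : set coins := [set a | exists2 v, U v & Gamma (A, a) = Some v].

(** Runs whose output depends only on the first r coins and on what is known at
    stage r. Phrased in terms of the values of Gamma alone, this does not mention the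
    reading sets of the algorithm; it is measurable, and it does not depend on the
    rest of the input. *)
Definition certified r U A : set coins := [set a | exists2 v, U v &
  forall B b, (forall i, known r i -> info i A = info i B) ->
    (forall j, (j < r)%N -> a j = b j) -> Gamma (B, b) = Some v].

Lemma certified_mono r s U A : (r <= s)%N -> certified r U A `<=` certified s U A.
Proof.
move=> rs a [v Uv h]; exists v => // B b AB ab; apply: h => [i ri|j jr].
  by apply: AB; exact: known_mono ri.
by apply: ab; exact: leq_trans rs.
Qed.

Lemma certified_transfer r U A B :
  (forall i, known r i -> info i A = info i B) -> certified r U A `<=` outputs_in U B.
Proof. by move=> AB a [v Uv h]; exists v => //; exact: h. Qed.

Lemma measurable_certified r U A : measurable (certified r U A).
Proof.
apply: (@measurable_finitely_determined r) => a b ab [v Uv h]; exists v => // B c AB bc.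
by apply: h => // j jr; rewrite ab// bc.
Qed.

(** A run that halts has read finitely much. *)
Lemma outputs_inE U A : outputs_in U A = \bigcup_r certified r U A.
Proof.
apply/seteqP; split=> [a [v Uv av]|a [r _]]; last exact: certified_transfer.
have [LG h] := Gamma_alg; have [LL _ LB LF] := h (A, a).
have fin : finite_set (LG (A, a)) by apply: LF; rewrite av.
pose local r (f : problem_dom Q * coins -> V + bool) :=
  (exists2 i, known r i & f = fun Aa => inl (info i Aa.1)) \/
  (exists2 j, (j < r)%N & f = fun Aa => inr (Aa.2 j)).
have ex f : exists r, LG (A, a) f -> local r f.
  have [Lf|nLf] := pselect (LG (A, a) f); last by exists 0%N.
  have [[_ [i _ <-] <-]|[j _ <-]] := LL f Lf.
    by have [r ri] := known_all i; exists r => _; left; exists i.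
  by exists j.+1 => _; right; exists j.
pose rank f := sval (cid (ex f)).
have /finite_seqP[s rs] := finite_image rank fin.
pose r := (\max_(k <- s) k)%N.
have rank_r f : LG (A, a) f -> (rank f <= r)%N.
  move=> Lf; apply: leq_bigmax_seq => //.
  by have : [set` s] (rank f) by rewrite -rs; exists f.
exists r => //; exists v => // B b AB ab; rewrite -av.
apply: (LB (B, b) _).2 => f Lf; have := rank_r f Lf; rewrite /rank.
case: cid => q /= /(_ Lf) [[i qi ->]|[j jq ->]] qr /=.
  by rewrite AB//; exact: known_mono qi.
by rewrite ab// (leq_trans jq).
Qed.

Lemma measurable_outputs_in U A : measurable (outputs_in U A).
Proof.
by rewrite outputs_inE; apply: bigcupT_measurable => r; exact: measurable_certified.
Qed.

Lemma outputs_certified U A (x : \bar R) q : (x < P (outputs_in U A))%E ->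
  exists2 r, (q <= r)%N & (x < P (certified r U A))%E.
Proof.
rewrite outputs_inE => h; apply: bigcup_gt h q; first by move=> r; exact: measurable_certified.
by move=> m n; exact: certified_mono.
Qed.

End certified_runs.

Section success.
Variables (R : realType) (M V : metricType R) (Q : comp_problem M V).
Variable known : nat -> set (info_index Q).
Hypothesis known_mono : forall r s, (r <= s)%N -> known r `<=` known s.
Hypothesis known_all : forall i, exists r, known r i.
Variable Gamma : nat -> problem_dom Q * coins -> option M.
Hypothesis Gamma_alg : forall n, @probabilistic_general_algorithm R M V Q (Gamma n).
Local Notation P := (coin_measure R).

Lemma cvg_haltingP (u : nat -> option M) (m : M) :
  cvg_halting u m <-> forall k, \forall n \near \oo,
    exists2 v, ball m k.+1%:R^-1 v & u n = Some v.
Proof.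
split=> [[v uv /cvg_ballP vm] k|h].
  near=> n; exists (v n); last by near: n.
  by near: n; apply: vm; rewrite invr_gt0.
exists (fun n => odflt m (u n)).
  by apply: filterS (h 0%N) => n [v _ ->].
apply/cvg_ballP => e e0; have [k] := @ltr_add_invr R 0 e e0; rewrite add0r => ke.
apply: filterS (h k) => n [v mv ->] /=; apply: le_ball mv; exact: ltW.
Unshelve. all: by end_near.
Qed.

Definition ultimately_in (N : nat) (U : set M) A : set coins :=
  \bigcap_(n in [set n | (N <= n)%N]) outputs_in (Gamma n) U A.

Lemma measurable_ultimately_in N U A : measurable (ultimately_in N U A).
Proof.
by apply: bigcap_measurable => [|n _]; [exists N => /=|exact: (measurable_outputs_in known_mono)].
Qed.

(** Convergence means that every neighbourhood of the target is eventually never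
    left; so for one neighbourhood this happens from some fixed index on with almost
    the same probability. *)
Lemma success_ultimately A (x : \bar R) (e : R) : 0 < e ->
  (x < P [set a | cvg_halting (fun n => Gamma n (A, a)) (target A)])%E ->
  forall q, exists2 N, (q <= N)%N & (x < P (ultimately_in N (ball (target A) e) A))%E.
Proof.
move=> e0 xP; apply: bigcup_gt => [N|m n mn a h k /= nk|].
- exact: measurable_ultimately_in.
- by apply: h => /=; exact: leq_trans nk.
apply: (lt_le_trans xP).
pose success k N := ultimately_in N (ball (target A) k.+1%:R^-1) A.
have eq : [set a | cvg_halting (fun n => Gamma n (A, a)) (target A)] =
    \bigcap_k \bigcup_N success k N.
  apply/seteqP; split=> a /=.
    by move/cvg_haltingP => h k _; have [N _ hN] := h k; exists N => // n /= Nn; exact: hN.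
  by move=> h; apply/cvg_haltingP => k; have [N _ hN] := h k I; exists N.
have m k : measurable (\bigcup_N success k N).
  by apply: bigcupT_measurable => N; exact: measurable_ultimately_in.
rewrite eq; apply: le_measure; rewrite ?inE.
- exact: bigcapT_measurable.
- by apply: bigcupT_measurable => N; exact: measurable_ultimately_in.
have [k] := @ltr_add_invr R 0 e e0; rewrite add0r => ke.
move=> a /(_ k I) [N _ hN]; exists N => // n Nn; have [v tv gv] := hN n Nn.
by exists v => //; apply: le_ball tv; exact: ltW.
Qed.

End success.

(** * The adversary *)

Lemma stagewise_choice (X : Type) (inv : nat -> X -> Prop) (step : nat -> X -> X -> Prop) :
  (exists x, inv 0%N x) ->
  (forall k x, inv k x -> exists2 y, inv k.+1 y & step k x y) ->
  exists f : nat -> X, forall k, inv k (f k) /\ step k (f k) (f k.+1).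
Proof.
move=> [x0 ix0] h.
have next k x : exists y, inv k x -> inv k.+1 y /\ step k x y.
  by have [/h[y iy sy]|nx] := pselect (inv k x); [exists y|exists x].
pose f := fix f k := if k is k'.+1 then sval (cid (next k' (f k'))) else x0.
have fi k : inv k (f k).
  by elim: k => //= k IH; case: (cid (next k (f k))) => y /= /(_ IH)[].
by exists f => k; split => //=; case: (cid (next k (f k))) => y /= /(_ (fi k))[].
Qed.

(** A play visits two kinds of positions in turn, told apart by the parity of the
    stage, whose targets keep a distance e; each move changes the map at most by a
    prescribed amount, and a play has a limit. *)
Section adversary.
Variables (R : realType) (M : metricType R) (Xi : Omega_p R -> M).
Variables (xhat : nat -> torus R) (xhat_dense : dense (range xhat)).
Local Notation Q := (delta1 (sampling_problem Xi xhat_dense)).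
Local Notation P := (coin_measure R).
Variables (S : Type) (F : S -> Omega_p R) (stage : nat -> set S).
Variables (ext : nat -> S -> S -> Prop) (e : R).
Hypothesis start : stage 0%N !=set0.
Hypothesis small_move : forall k s (delta : R), stage k s -> 0 < delta ->
  exists2 s', stage k.+1 s' & ext k s s' /\
    forall x, mdist (sval (F s) x) (sval (F s') x) <= delta.
Hypothesis limit : forall s_ : nat -> S, (forall k, stage k (s_ k)) ->
  (forall k, ext k (s_ k) (s_ k.+1)) -> exists A : Omega_p R, forall x (eps : R), 0 < eps ->
    \forall k \near \oo, mdist (sval (F (s_ k)) x) (sval A x) <= eps.
Hypothesis e0 : 0 < e.
Hypothesis separated : forall k l s s', stage k s -> stage l s' -> ~~ odd k -> odd l ->
  e <= mdist (Xi (F s)) (Xi (F s')).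

Definition nearby (side : bool) : set M := [set v | exists k s,
  [/\ stage k s, odd k = side & ball (Xi (F s)) (e / 4) v]].

(** The radii are e / 4 so that a ball that met both sets would bring two
    positions of opposite kinds closer than e. *)
Lemma nearby_disjoint m : exists side, ball m (e / 4) `&` nearby side = set0.
Proof.
apply: contrapT => /forallNP h.
have [v [mv [k [s [sk /negbT ok sv]]]]] : ball m (e / 4) `&` nearby false !=set0.
  by apply/set0P/eqP; exact: h.
have [w [mw [l [s' [sl ol sw]]]]] : ball m (e / 4) `&` nearby true !=set0.
  by apply/set0P/eqP; exact: h.
have := separated sk sl ok ol; move: mv sv mw sw; rewrite !ballEmdist /= => mv sv mw sw.
have t1 := metric_triangle (Xi (F s)) v (Xi (F s')).
have t2 := metric_triangle v m (Xi (F s')); have t3 := metric_triangle m w (Xi (F s')).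
rewrite (metric_sym v m) in t2; rewrite (metric_sym w) in t3; move: e0; lra.
Qed.

Definition known (r : nat) : set (info_index Q) :=
  [set jn : nat * nat | (jn.1 < r)%N /\ (jn.2 < r)%N].

Let table := nat -> nat -> torus R.

(** Strict inequalities leave room for the next move. *)
Definition accurate (t : table) (A : Omega_p R) :=
  forall j n, mdist (t j n) (sval A (xhat j)) < 2 ^- n.+1.

Lemma accurate_margin t A r : accurate t A -> exists2 delta : R, 0 < delta &
  forall j n, (j < r)%N -> (n < r)%N -> mdist (t j n) (sval A (xhat j)) + delta < 2 ^- n.+1.
Proof.
move=> tA.
pose gap (jn : 'I_r * 'I_r) : R :=
  2 ^- (jn.2 : nat).+1 - mdist (t jn.1 jn.2) (sval A (xhat jn.1)).
exists (2^-1 * \big[Num.min/1]_jn gap jn) => [|j n jr nr].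
  rewrite mulr_gt0//; apply: (big_ind (fun x : R => 0 < x)) => // [x y x0 y0|jn _].
    by rewrite lt_min x0.
  by rewrite subr_gt0; exact: tA.
have := bigmin_le_cond 1 gap (isT : xpredT (Ordinal jr, Ordinal nr)).
rewrite /gap /=; have := tA j n; set b := \big[_/_]_(_ | _) _; set u := 2 ^- _.
move=> h hb; lra.
Qed.

Variable Gamma : nat -> problem_dom Q * coins -> option M.
Hypothesis Gamma_alg : forall n, @probabilistic_general_algorithm R M (torus R) Q (Gamma n).
Hypothesis Gamma_succeeds : forall A,
  (2^-1%:E < P [set a | cvg_halting (fun n => Gamma n (A, a)) (target A)])%E.

Let position := (S * table * nat)%type.

Definition invariant k (p : position) :=
  [/\ stage k p.1.1, accurate p.1.2 (F p.1.1) & (k <= p.2)%N].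

Definition answered k (t : table) r := exists2 n, (k <= n)%N &
  forall T : problem_dom Q, sval T = t ->
    (2^-1%:E < P (certified known (Gamma n) r (nearby (odd k)) T))%E.

Definition round k (p q : position) := [/\ ext k p.1.1 q.1.1,
  forall j n, (j < q.2)%N -> (n < q.2)%N -> p.1.2 j n = q.1.2 j n,
  (p.2 <= q.2)%N & answered k p.1.2 q.2].

Lemma known_mono r s : (r <= s)%N -> known r `<=` known s.
Proof. by move=> rs [j n] [/= jr nr]; split; exact: leq_trans rs. Qed.

Lemma known_all i : exists r, known r i.
Proof.
by case: i => j n; exists (maxn j n).+1; split; rewrite /= ltnS ?leq_maxl ?leq_maxr.
Qed.

(** At the current position the algorithm succeeds, so for some N >= k its N-th output
    is near the target with probability more than 1/2; for some r this is already
    certified by the entries known at stage r. The move is made within the margin of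
    these entries, which are kept, while all others are reset to exact values. *)
Lemma play_round k p : invariant k p -> exists2 q, invariant k.+1 q & round k p q.
Proof.
case: p => [[s t] r] [/= sk tA kr].
have tQ : exists A, @approximates R M _ (sampling_problem Xi xhat_dense) t A.
  by exists (F s) => j n; exact: ltW.
pose T : problem_dom Q := exist _ t tQ.
have e4 : 0 < e / 4 by rewrite divr_gt0.
have [N kN SN] := success_ultimately known_mono known_all Gamma_alg e4 (Gamma_succeeds T) k.
have TE : target T = Xi (F s).
  by apply: (@delta1_targetE _ _ _ (sampling_problem Xi xhat_dense)) => j n; exact: ltW.
have oN : (2^-1%:E < P (outputs_in (Gamma N) (nearby (odd k)) T))%E.
  apply: (lt_le_trans SN); apply: le_measure; rewrite ?inE.
  - exact: (measurable_ultimately_in known_mono known_all Gamma_alg).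
  - exact: (measurable_outputs_in known_mono known_all (Gamma_alg _)).
  move=> a /(_ N (leqnn N)) [v Tv av]; exists v => //; exists k, s.
  by rewrite -TE.
have [r' rr' cr'] := outputs_certified known_mono known_all (Gamma_alg N) (maxn r k.+1) oN.
have [delta d0 dlt] := accurate_margin r' tA.
have [s' s'k [ess' ds]] := small_move sk d0.
exists (s', fun j n => if (j < r')%N && (n < r')%N then t j n else sval (F s') (xhat j), r').
  split => //=; last by rewrite (leq_trans _ rr')// leq_maxr.
  move=> j n; case: ifP => [/andP[jr nr]|_]; last first.
    by rewrite /= mdistxx invr_gt0 exprn_gt0.
  rewrite (le_lt_trans _ (dlt j n jr nr))//.
  by rewrite (le_trans (metric_triangle _ (sval (F s) (xhat j)) _))// lerD2l.
split => //=; first by move=> j n -> ->.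
  by rewrite (leq_trans _ rr')// leq_maxl.
exists N => // T' T't; rewrite (_ : T' = T)//.
by case: T' T't => t' pt' /= e'; move: pt'; rewrite e' => pt'; congr exist; exact: Prop_irrelevance.
Qed.

(** The table that the play converges to describes the limit element. Near its
    target the outputs stay, from some index N on and with probability more than 1/2,
    away from one of the two sets of answers. A stage of that side after N provides
    a certified output in this set, again with probability more than 1/2. *)
Lemma adversary_wins : False.
Proof.
have [|p hp] := stagewise_choice _ play_round.
  have [s s0] := start; exists (s, fun j _ => sval (F s) (xhat j), 0%N); split => // j n.
  by rewrite /= mdistxx invr_gt0 exprn_gt0.
pose s k := (p k).1.1; pose t k := (p k).1.2; pose r k := (p k).2.
have [A cA] := @limit s (fun k => let: And3 x _ _ := (hp k).1 in x)
  (fun k => let: And4 x _ _ _ := (hp k).2 in x).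
have kr k : (k <= r k)%N by have [[]] := hp k.
have t_const k l j n : (k <= l)%N -> (j < r k.+1)%N -> (n < r k.+1)%N -> t l j n = t k j n.
  move=> /subnK <- jr nr; elim: (l - k)%N => // d IH; rewrite -IH addSn.
  have rd : (r k.+1 <= r (d + k).+1)%N.
    elim: d {IH} => // d IH; rewrite (leq_trans IH)//.
    by have [_ []] := hp (d.+1 + k)%N.
  by have [_ [_ /(_ j n) h _ _]] := hp (d + k)%N; rewrite /t h//; apply: leq_trans rd.
(* an entry (j, n) is known, and hence kept, from stage max(j, n) + 1 on *)
pose u j n := t (maxn j n) j n.
have uE k j n : (j < r k.+1)%N -> (n < r k.+1)%N -> u j n = t k j n.
  move=> jr nr; rewrite /u.
  have jm : (j < r (maxn j n).+1)%N by rewrite (leq_trans _ (kr _))// ltnS leq_maxl.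
  have nm : (n < r (maxn j n).+1)%N by rewrite (leq_trans _ (kr _))// ltnS leq_maxr.
  have [km|mk] := leqP k (maxn j n); first by rewrite (t_const k).
  by rewrite [RHS](t_const (maxn j n))// ltnW.
have uA : @approximates R M _ (sampling_problem Xi xhat_dense) u A.
  move=> j n; apply/ler_addgt0Pr => eps eps0.
  have [K _ KA] := cA (xhat j) eps eps0.
  pose k := maxn K (maxn j n); have Kk : (K <= k)%N by exact: leq_maxl.
  have jr : (j < r k.+1)%N.
    by rewrite (leq_trans _ (kr _))// ltnS (leq_trans (leq_maxl j n))// leq_maxr.
  have nr : (n < r k.+1)%N.
    by rewrite (leq_trans _ (kr _))// ltnS (leq_trans (leq_maxr j n))// leq_maxr.
  rewrite (uE k)//; have [[_ /(_ j n) h _] _] := hp k.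
  rewrite (le_trans (metric_triangle _ (sval (F (s k)) (xhat j)) _))// lerD//.
    exact: ltW.
  exact: KA.
pose U : problem_dom Q := exist _ u (ex_intro _ A uA).
have [side dis] := nearby_disjoint (target U).
have e4 : 0 < e / 4 by rewrite divr_gt0.
have [N _ SN] := success_ultimately known_mono known_all Gamma_alg e4 (Gamma_succeeds U) 0%N.
(* any stage after N with the parity of this side *)
pose k := (N.*2 + side)%N.
have ok : odd k = side by rewrite oddD odd_double /= oddb.
have [[_ tk _] [_ _ _ [n kn cert]]] := hp k.
have tQ : exists A, @approximates R M _ (sampling_problem Xi xhat_dense) (t k) A.
  by exists (F (s k)) => j i; apply: ltW; exact: tk.
have := cert (exist _ (t k) tQ) erefl; rewrite ok => ck.
have Nn : (N <= n)%N by rewrite (leq_trans _ kn)// /k -addnn -addnA leq_addr.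
have oU : (2^-1%:E < P (outputs_in (Gamma n) (nearby side) U))%E.
  apply: (lt_le_trans ck); apply: le_measure; rewrite ?inE.
  - exact: measurable_certified.
  - exact: (measurable_outputs_in known_mono known_all (Gamma_alg _)).
  by apply: certified_transfer => -[j i] [/= jr ir]; rewrite /delta1_info /= (uE k).
have [a [/(_ n Nn)[v Tv av] [w sw aw]]] := disjoint_half
  (measurable_ultimately_in known_mono known_all Gamma_alg N _ U)
  (measurable_outputs_in known_mono known_all (Gamma_alg n) _ U) SN oU.
move: aw; rewrite av => -[vw]; rewrite -vw in sw.
by have : set0 v by rewrite -dis.
Qed.

End adversary.

(** * The game played with shears *)

Section shear_game.
Variable R : realType.
Local Notation C := (R[i])^o.
Import Normc.
Implicit Types (c a : nat -> R) (y : R).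

Lemma profile_dist c a c' a' (B : R) y : summable_weights c -> summable_weights c' ->
  (forall n, `|\sum_(k < n) (c k * flat_d 0 (y - a k) - c' k * flat_d 0 (y - a' k))| <= B) ->
  `|profile c a y - profile c' a' y| <= B.
Proof.
move=> cw cw' h.
have cvg_diff : (series (fun k => c k * flat_d 0 (y - a k)) n -
    series (fun k => c' k * flat_d 0 (y - a' k)) n) @[n --> \oo] -->
    profile c a y - profile c' a' y.
  by apply: cvgB; apply: cvg_weighted_sum => // k; exact: flat0_le1.
apply: (cvg_norm_le cvg_diff) => n; apply: le_trans (h n).
by rewrite /series /= !big_mkord -sumrB.
Qed.

Lemma shear_map_dist c a c' a' (B : R) x :
  (forall y, `|profile c a y - profile c' a' y| <= B) ->
  mdist (shear_map c a x) (shear_map c' a' x) <= B.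
Proof.
move=> h; rewrite (le_trans (mdist_le_circle_dist _ _))//= circle_distxx add0r.
rewrite (le_trans (circle_dist_of _ _))// (le_trans _ (h (cos (val x.1))))//.
by rewrite /angle le_eqVlt; apply/orP; left; apply/eqP; congr `|_|; ring.
Qed.

(** The effect of a move: two profiles that differ in one term. *)
Lemma profile_change i c a c' a' (B : R) y : summable_weights c -> summable_weights c' ->
  (forall j, j <> i -> c j = c' j /\ a j = a' j) ->
  `|c i * flat_d 0 (y - a i) - c' i * flat_d 0 (y - a' i)| <= B ->
  `|profile c a y - profile c' a' y| <= B.
Proof.
move=> cw cw' eqj iB; apply: profile_dist => // n.
have [ni|ni] := leqP n i.
  rewrite big1 ?normr0 ?(le_trans _ iB)// => k _.
  have /eqj[-> ->] : (k : nat) <> i by move=> ki; move: (ltn_ord k); rewrite ki ltnNge ni.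
  by rewrite subrr.
rewrite (bigD1 (Ordinal ni))//= big1 ?addr0// => k ki.
have /eqj[-> ->] : (k : nat) <> i by move=> e; move/eqP : ki; apply; exact/val_inj.
by rewrite subrr.
Qed.

(** The convergence of a play: two profiles with the same first terms. *)
Lemma profile_tail m c a c' a' y : summable_weights c -> summable_weights c' ->
  (forall j, (j < m)%N -> c j = c' j /\ a j = a' j) ->
  `|profile c a y - profile c' a' y| <= 2 ^- m.
Proof.
move=> cw cw' eqj; apply: profile_dist => // n.
rewrite (le_trans (ler_norm_sum _ _ _))//.
apply: (@le_trans _ _ (\sum_(k < n) (if (m <= k)%N then 2^-1 * 2 ^- k else 0))).
  apply: ler_sum => k _; case: leqP => [mk|/eqj[-> ->]]; last by rewrite subrr normr0.
  have /andP[c0 c1] := cw k; have /andP[c'0 c'1] := cw' k.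
  have p : 0 < 2 ^- k :> R by rewrite invr_gt0 exprn_gt0.
  rewrite (le_trans (ler_normB _ _))// !normrM !ger0_norm ?flat0_ge0//.
  have f1 := flat0_le1 (y - a k); have f1' := flat0_le1 (y - a' k).
  rewrite ger0_norm ?flat0_ge0// in f1; rewrite ger0_norm ?flat0_ge0// in f1'.
  have := ler_piMr c0 f1; have := ler_piMr c'0 f1'; lra.
suff h : \sum_(k < n) (if (m <= k)%N then 2^-1 * 2 ^- k else 0) <=
    2 ^- m - 2 ^- maxn m n :> R.
  by rewrite (le_trans h)// gerBl invr_ge0 exprn_ge0.
elim: n => [|n IH]; first by rewrite big_ord0 maxn0 subrr.
rewrite big_ord_recr /=; move: IH; case: leqP => mn.
  rewrite (maxn_idPr (leqW mn)) exprS invfM; lra.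
by rewrite (maxn_idPl mn) addr0.
Qed.

Definition shear_data := {p : (nat -> R) * (nat -> R) | summable_weights p.1}.
Implicit Types s : shear_data.

Definition weight s : nat -> R := (sval s).1.
Definition level s : nat -> R := (sval s).2.

Definition shear_element s : Omega_p R :=
  exist _ _ (shear_map_Omega_p (level s) (svalP s)).

(** Stages 2 i and 2 i + 1 both have i finished terms with a_j > -1. A term with
    a_i = -1 is present at stage 2 i + 1 and absent at stage 2 i. *)
Definition shear_stage (k : nat) : set shear_data := fun s =>
  [/\ forall j, (j < k./2)%N -> -1 < level s j <= 1,
      forall j, (k./2 + odd k <= j)%N -> weight s j = 0 &
      odd k -> 0 < weight s k./2 /\ level s k./2 = -1].

Definition shear_ext (k : nat) s s' := forall j, j <> k./2 ->
  weight s j = weight s' j /\ level s j = level s' j.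

Definition update (f : nat -> R) i v : nat -> R := fun j => if j == i then v else f j.

Lemma shear_start : shear_stage 0%N !=set0.
Proof.
have w0 : @summable_weights R (fun=> 0).
  by move=> k; rewrite lexx mulr_ge0 ?invr_ge0// exprn_ge0.
by exists (exist _ (fun=> 0, fun=> 0) w0); split.
Qed.

(** From an even stage the new term comes in with a small weight; from an odd stage
    its threshold moves from -1 to -1 + eta, which by the Lipschitz bound changes the
    profile by at most 4 eta c_i. *)
Lemma shear_move k s (delta : R) : shear_stage k s -> 0 < delta ->
  exists2 s', shear_stage k.+1 s' & shear_ext k s s' /\
    forall x, mdist (sval (shear_element s) x) (sval (shear_element s') x) <= delta.
Proof.
case: s => [[c a] /= cw] [/= lv wt od] d0.
have p : 0 < 8^-1 * 2 ^- k./2 :> R by rewrite mulr_gt0 ?invr_gt0// exprn_gt0.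
have offi f v j : j <> k./2 -> f j = update f k./2 v j by rewrite /update => /eqP/negPf ->.
have cw' v : 0 <= v <= 8^-1 * 2 ^- k./2 -> summable_weights (update c k./2 v).
  by move=> hv j; rewrite /update; case: eqP => [->|_].
case ok: (odd k) in wt od; rewrite /= ?addn0 ?addn1 in wt od.
  have [ci ai] := od isT.
  pose eta := Num.min 1 delta.
  have e0 : 0 < eta by rewrite lt_min ltr01.
  have e1 : eta <= 1 by rewrite ge_min lexx.
  have ed : eta <= delta by rewrite ge_min lexx orbT.
  exists (exist _ (c, update a k./2 (-1 + eta)) cw).
    rewrite /shear_stage /weight /level /= ok /= uphalf_half ok add1n addn0; split=> // j.
      rewrite ltnS leq_eqVlt /update; case: eqP => [_ _|_ /= /lv//].
      by apply/andP; split; lra.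
  split=> [j ji|x]; first by split => //=; exact: offi.
  apply: shear_map_dist => y; apply: (@profile_change k./2) => // [j ji|].
    by split => //=; exact: offi.
  rewrite /level /update /= in ai *; rewrite eqxx -mulrBr normrM ai.
  have := flat0_lipschitz (y - -1) (y - (-1 + eta)).
  have /andP[c0 c1] := cw k./2; rewrite (ger0_norm c0) /= in c1 *.
  rewrite (_ : y - -1 - (y - (-1 + eta)) = eta) ?(gtr0_norm e0); last by ring.
  have : 2 ^- k./2 <= 1 :> R by rewrite invf_le1 ?exprn_gt0// exprn_ege1// ler1n.
  set g := `|_| => h1 h2; have g0 : 0 <= g by exact: normr_ge0.
  nra.
pose v := Num.min delta (8^-1 * 2 ^- k./2).
have v0 : 0 < v by rewrite lt_min d0.
have vw : 0 <= v <= 8^-1 * 2 ^- k./2 by rewrite (ltW v0) ge_min lexx orbT.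
exists (exist _ (update c k./2 v, update a k./2 (-1)) (cw' v vw)).
  rewrite /shear_stage /weight /level /= ok /= uphalf_half ok add0n addn1; split=> [j jk|j kj|_].
  - by rewrite /update ltn_eqF//; exact: lv.
  - by rewrite /update gtn_eqF//; apply: wt; exact: ltnW.
  - by rewrite /update eqxx.
split=> [j ji|x]; first by split; exact: offi.
apply: shear_map_dist => y; apply: (@profile_change k./2) => // [|j ji|].
- exact: cw'.
- by split; exact: offi.
rewrite /level /weight /update /= in wt *; rewrite !eqxx wt// mul0r sub0r normrN normrM (gtr0_norm v0).
rewrite (le_trans (ler_piMr _ (flat0_le1 _))) ?(ltW v0)//.
by rewrite ge_min lexx.
Qed.

(** The term j is not touched after stage 2 j + 2. *)
Lemma shear_limit (s_ : nat -> shear_data) : (forall k, shear_stage k (s_ k)) ->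
  (forall k, shear_ext k (s_ k) (s_ k.+1)) ->
  exists A : Omega_p R, forall x (eps : R), 0 < eps ->
    \forall k \near \oo, mdist (sval (shear_element (s_ k)) x) (sval A x) <= eps.
Proof.
move=> _ ext.
have stable j k : (j.+1.*2 <= k)%N ->
    weight (s_ k) j = weight (s_ j.+1.*2) j /\ level (s_ k) j = level (s_ j.+1.*2) j.
  move=> /subnK <-; elim: (k - _)%N => // d [IHw IHl]; rewrite addSn -IHw -IHl.
  have [|-> ->] := ext (d + j.+1.*2)%N j; last by [].
  move=> e; have : (j.+1 <= j)%N; last by rewrite ltnn.
  by rewrite [leqRHS]e -[leqLHS]doubleK half_leq// leq_addl.
pose c j := weight (s_ j.+1.*2) j; pose a j := level (s_ j.+1.*2) j.
have cw : summable_weights c by move=> j; exact: (svalP (s_ j.+1.*2) j).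
exists (shear_element (exist _ (c, a) cw)) => x eps eps0.
have [m] := @ltr_add_invr R 0 eps eps0; rewrite add0r => me.
exists m.*2 => // k /= mk; apply: shear_map_dist => y.
apply: le_trans (@profile_tail m _ _ _ _ _ (svalP (s_ k)) cw _) _ => [j jm|].
  by apply: stable; rewrite (leq_trans _ mk)// leq_double.
rewrite (le_trans _ (ltW me))// lef_pV2 ?posrE ?exprn_gt0//.
by rewrite -natrX ler_nat; exact: ltn_expl.
Qed.

Lemma even_stage_eigenvalue k s : shear_stage k s -> ~~ odd k ->
  Defs.eigenvalue (sval (shear_element s)) (-1).
Proof.
move=> [lv wt _] /negPf ok; rewrite ok addn0 in wt.
pose b := \big[Num.min/1]_(j < k./2) level s j.
apply: (@eigenvalue_plateau _ _ _ b) => [|j].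
  apply/andP; split; last exact: bigmin_le_id.
  apply: (big_ind (fun x : R => -1 < x)) => [|x y x1 y1|j _]; first by lra.
    by rewrite lt_min x1.
  by have /andP[] := lv j (ltn_ord j).
have [jk|kj] := ltnP j k./2; last by left; exact: wt.
by right; exact: (bigmin_le_cond 1 (fun j : 'I_(k./2) => level s j) (isT : xpredT (Ordinal jk))).
Qed.

Lemma odd_stage_eigenvalue k s lambda : shear_stage k s -> odd k ->
  Defs.eigenvalue (sval (shear_element s)) lambda -> lambda = 1.
Proof.
move=> [_ _ od] ok; have [ci ai] := od ok.
exact: (eigenvalue_strict (svalP s) ci ai).
Qed.

Lemma opp1_neq1 : (-1 : C) <> 1.
Proof. by move=> /eqP; rewrite eq_complex /= => /andP[/eqP h _]; move: h; lra. Qed.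

Lemma separated_spectra k l s s' : shear_stage k s -> shear_stage l s' -> ~~ odd k -> odd l ->
  1 <= mdist (Xi_p (shear_element s)) (Xi_p (shear_element s')).
Proof.
move=> ks ls ok ol; rewrite leNgt; apply/negP => /hausdorff_lt h.
have [w w1] : exists2 w : C, sval (Xi_p (shear_element s')) w & normc (-1 - w) < 1.
  by apply: h; apply: subset_closure; exact: even_stage_eigenvalue ks ok.
have -> : w = 1.
  have /closure_id e := @closed_disc R 1 0.
  suff : [set z : C | normc (z - 1) <= 0] w.
    by move=> /= w0; apply/eqP; rewrite -subr_eq0; apply/eqP/eq0_normc/le_anti; rewrite w0 normc_ge0.
  rewrite e; apply: closureS w1 => z /(odd_stage_eigenvalue ls ol) ->.
  by rewrite /= !subrr expr0n addr0 sqrtr0.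
rewrite (_ : -1 - 1 = Complex (-2) 0); last first.
  by apply/eqP; rewrite eq_complex /=; apply/andP; split; apply/eqP; ring.
by rewrite /= expr0n addr0 sqrtr_sqr normrN ger0_norm//; lra.
Qed.

Lemma separated_decisions k l s s' : shear_stage k s -> shear_stage l s' -> ~~ odd k -> odd l ->
  1 <= mdist (Xi_p_dec (shear_element s)) (Xi_p_dec (shear_element s')).
Proof.
move=> ks ls ok ol; have e1 : Xi_p_dec (shear_element s) = true.
  by apply/asboolPn => h; apply: opp1_neq1; apply: h; exact: even_stage_eigenvalue ks ok.
have e0 : Xi_p_dec (shear_element s') = false.
  by apply/negbF/asboolP => lambda; exact: odd_stage_eigenvalue ls ol.
by rewrite e1 e0.
Qed.

Variables (xhat : nat -> torus R) (xhat_dense : dense (range xhat)).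

(** On a problem whose values separate even from odd stages, an algorithm that
    succeeds with probability more than 1/2 on all inputs loses the game. *)
Lemma lower_bound (M : metricType R) (Xi : Omega_p R -> M) :
  (forall k l s s', shear_stage k s -> shear_stage l s' -> ~~ odd k -> odd l ->
    1 <= mdist (Xi (shear_element s)) (Xi (shear_element s'))) ->
  notin_Delta2P_half (delta1 (sampling_problem Xi xhat_dense)).
Proof.
move=> sep Gamma Gamma_alg; rewrite leNgt; apply/negP => lt.
apply: (adversary_wins shear_start shear_move shear_limit ltr01 sep Gamma_alg) => A.
by apply: (lt_le_trans lt); apply: ereal_inf_lbound; exists A.
Qed.

End shear_game.

Theorem theorem2p12 (R : realType) (xhat : nat -> torus R)
    (xhat_dense : dense (range xhat)) :
  (notin_Delta2P_half (delta1 (sampling_problem (@Xi_p R) xhat_dense)) /\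
   Sigma2G_compacts (delta1 (sampling_problem (@Xi_p R) xhat_dense))) /\
  (notin_Delta2P_half (delta1 (sampling_problem (@Xi_p_dec R) xhat_dense)) /\
   Sigma2G_decision (delta1 (sampling_problem (@Xi_p_dec R) xhat_dense))).
Proof.
split; split.
- by apply: lower_bound; exact: separated_spectra.
- exact: compacts_Sigma2G.
- by apply: lower_bound; exact: separated_decisions.
- exact: decision_Sigma2G.
Qed.
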